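(* Suppose that $Z_1,\ldots,Z_M,Z_{M+1}\mid\mu$ are iid $\mathrm{IBP}(G_A|\mu)$, where $\mu$ is $\mathrm{CRM}(\rho B_0)$. Let $\omega_1,\ldots,\omega_K$ be the distinct features possessed by at least one of $Z_1,\ldots,Z_M$, and let $a_{i,\ell}$ be the value (possibly $0$) that $Z_i$ assigns to $\omega_\ell$. Put $\rho_M(s|\omega)=[1-\pi_A(s)]^M\rho(s|\omega)$. Then the distribution of $Z_{M+1}\mid Z_1,\ldots,Z_M$ is equal to the distribution of $$\tilde Z_{M+1}+\sum_{\ell=1}^K A_\ell\,\delta_{\omega_\ell},$$ where $\tilde Z_{M+1}$ is $\mathrm{IBP}(A,\rho_M B_0)$ and, independently of $\tilde Z_{M+1}$, the $A_\ell$ are independent, each $A_\ell\mid J_\ell=s$ has distribution $G_A(da|s)$, and the marginal distribution of $J_\ell$ is $$\mathbb{P}_{\ell,M}(J_\ell\in ds)\propto[1-\pi_A(s)]^M\rho(s|\omega_\ell)\prod_{i=1}^M h_{i,\ell}(s)\,ds,\qquad h_{i,\ell}(s)=\left[\frac{G_A(da_{i,\ell}|s)}{1-\pi_A(s)}\right]^{\mathbb{I}_{\{a_{i,\ell}\neq0\}}}.$$ That is, $A_\ell$ has distribution $\int_0^\infty G_A(da|y)\,\mathbb{P}_{\ell,M}(dy)$.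
   Context: **Setting.** $\Omega$ is a Polish space with a probability measure $B_0$, taken non-atomic so that the features $\tilde\omega_k$ below are a.s. distinct. $\rho(s|\omega)\ge 0$ is a measurable (Lévy) density in $s\in(0,\infty)$, possibly depending on $\omega\in\Omega$, with $\int_0^\infty\min(s,1)\rho(s|\omega)\,ds<\infty$; the total mass $\int_0^\infty\rho(s|\omega)\,ds$ may be infinite or finite. **PRM and CRM.** $N$ is $\mathrm{PRM}(\rho B_0)$ if $N=\sum_k\delta_{(\tau_k,\tilde\omega_k)}$ is a Poisson random measure on $(0,\infty)\times\Omega$ with mean intensity $\rho(s|\omega)\,ds\,B_0(d\omega)$. Then $\mu(d\omega)=\int_0^\infty sN(ds,d\omega)=\sum_k\tau_k\delta_{\tilde\omega_k}$ is said to be $\mathrm{CRM}(\rho B_0)$. **IBP processes.** $G_A(da|s)$ is a probability kernel giving, for each $s$, the distribution of a variable $A$ (possibly vector valued, discrete or continuous or mixed). Write $\pi_A(s)=\mathbb{P}(A\neq0|s)$; it is assumed that $1-\pi_A(s)=\mathbb{P}(A=0|s)>0$. $Z_1,Z_2,\ldots\mid\mu$ are iid $\mathrm{IBP}(G_A|\mu)$ if $Z_i=\sum_k A_{i,k}\delta_{\tilde\omega_k}$, where conditionally on $N$ the variables $A_{i,k}$ are independent over $(i,k)$ with $A_{i,k}\sim G_A(da|\tau_k)$. If $Z|\mu$ is $\mathrm{IBP}(G_A|\mu)$ with $\mu$ a $\mathrm{CRM}(\rho B_0)$, the marginal (unconditional) distribution of $Z$ is denoted $\mathrm{IBP}(A,\rho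 B_0)$; $\mathrm{IBP}(A,\rho_M B_0)$ is the same with $\rho_M$ in place of $\rho$. **Finiteness.** It is assumed that $\int_\Omega\int_0^\infty\pi_A(s)\rho(s|\omega)\,ds\,B_0(d\omega)<\infty$, so that the number $K$ of features $\tilde\omega_k$ with $A_{i,k}\ne0$ for some $i\le M$ is a.s. finite. **Reading of the formulas.** Note that $[1-\pi_A(s)]^M\prod_{i=1}^M h_{i,\ell}(s)=\prod_{i=1}^M G_A(da_{i,\ell}|s)$, where for $a_{i,\ell}=0$ the factor is the mass $G_A(\{0\}|s)=1-\pi_A(s)$. The law of $J_\ell$ given $(a_{1,\ell},\ldots,a_{M,\ell})$ is the conditional distribution (disintegration) of the joint measure $\rho(s|\omega_\ell)\,ds\prod_{i}G_A(da_{i,\ell}|s)$ restricted to $(a_{1,\ell},\ldots,a_{M,\ell})\neq(0,\ldots,0)$. *)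

(* Defs.v *)
From HB Require Import structures.
From mathcomp Require Import all_boot all_order all_algebra.
From mathcomp Require Import all_classical all_reals all_analysis.
From mathcomp Require Import measurable_realfun.

Set Implicit Arguments.
Unset Strict Implicit.
Unset Printing Implicit Defensive.

Import Order.TTheory GRing.Theory Num.Theory.
Import numFieldNormedType.Exports.

Local Open Scope classical_set_scope.
Local Open Scope ring_scope.
Local Open Scope ereal_scope.

Notation borel T := (g_sigma_algebraType (@open T)).

(* R^n with its Borel sigma-algebra: the values of the variable A. *)
Notation vec R n := (borel 'rV[R]_n).

(* R^n-valued set functions on Omega, with the sigma-algebra generated by the
   evaluations z |-> z B at the Borel sets B. *)
Definition eval_cylinders (R : realType) (n : nat)
    (Omega : completePseudoMetricType R) : set (set (set Omega -> 'rV[R]_n)) :=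
  [set C | exists (B : set (borel Omega)) (D : set (vec R n)),
    [/\ measurable B, measurable D & C = [set z | D (z B)]]].

Notation vmeas n Omega := (g_sigma_algebraType (@eval_cylinders _ n Omega)).

(* Product rule for one event from each class. When every class is a
   sigma-algebra this covers subfamilies too (take setT elsewhere). *)
Definition mutually_independent d (T : measurableType d) (R : realType)
    (P : probability T R) (I : finType) (F : I -> set (set T)) : Prop :=
  forall H : I -> set T, (forall i, F i (H i)) ->
    P (\bigcap_i H i) = (\prod_i fine (P (H i)))%:E.

(* Q is a regular version of the conditional distribution of X given the
   sub-sigma-algebra S. *)
Definition regular_conditional_law d d' (T : measurableType d)
    (T' : measurableType d') (R : realType) (P : probability T R)
    (S : set (set T)) (X : T -> T') (Q : T -> probability T' R) : Prop :=
  forall C : set T', measurable C ->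
    (forall Y : set (\bar R), measurable Y -> S [set t | Y (Q t C)]) /\
    (forall H : set T, S H -> P (H `&` X @^-1` C) = \int[P]_(t in H) Q t C).

(* A Poisson variable with infinite mean is +oo almost surely.  The library's
   [poisson_prob r _] does not depend on its nat argument, and is the Dirac mass
   at 0 for r = 0 (unlike [poisson_pmf], which is constantly 1 there). *)
Definition is_PRM d d' (T : measurableType d) (X : measurableType d')
    (R : realType) (P : probability T R) (N : T -> set X -> \bar R)
    (nu : set X -> \bar R) : Prop :=
  [/\ forall B, measurable B -> measurable_fun [set: T] (N ^~ B),
      forall B (m : nat), measurable B -> nu B < +oo ->
        P [set t | N t B = m%:R%:E] = poisson_prob (fine (nu B)) 0%N [set m],
      forall B, measurable B -> nu B = +oo -> P [set t | N t B = +oo] = 1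
    & forall (k : nat) (B : 'I_k -> set X),
        (forall j, measurable (B j)) -> trivIset setT B ->
        mutually_independent P
          (fun j => g_sigma_algebra_preimage (fun t => N t (B j)))].

(* A countable, possibly finite, collection of points (tau_k, w_k) of
   (0, oo) x Omega is encoded by two sequences; index k is actually used when
   0 < tau_k, and otherwise there is no k-th point. *)
Definition present (R : realType) (T : Type) (tau : nat -> T -> R) (t : T) :
    set nat := [set k | (0 < tau k t)%R].

Definition point_measure (R : realType) (Omega : completePseudoMetricType R)
    (T : Type) (tau : nat -> T -> R) (w : nat -> T -> Omega) (t : T)
    (B : set (R * borel Omega)%type) : \bar R :=
  \esum_(k in present tau t) \d_((tau k t, w k t) : R * borel Omega) B.

Definition levy_intensity (R : realType) (Omega : completePseudoMetricType R)
    (rho : R -> Omega -> R) (B0 : probability (borel Omega) R)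
    (D : set (R * borel Omega)%type) : \bar R :=
  \int[B0]_w \int[lebesgue_measure]_(s in [set s : R | (0 < s)%R /\ D (s, w)])
    (rho s w)%:E.

Definition is_CRM (R : realType) (Omega : completePseudoMetricType R)
    d (T : measurableType d) (P : probability T R)
    (rho : R -> Omega -> R) (B0 : probability (borel Omega) R)
    (tau : nat -> T -> R) (w : nat -> T -> Omega)
    (mu : T -> set (borel Omega) -> \bar R) : Prop :=
  is_PRM P (point_measure tau w) (levy_intensity rho B0) /\
  forall t B, measurable B ->
    mu t B = \esum_(k in present tau t) (tau k t)%:E * \d_(w k t : borel Omega) B.

Definition points_sigma (R : realType) (Omega : completePseudoMetricType R)
    d (T : measurableType d) (tau : nat -> T -> R) (w : nat -> T -> Omega) :
    set (set T) :=
  <<s \bigcup_k g_sigma_algebra_preimage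
        (fun t => (tau k t, w k t) : R * borel Omega) >>.

(* Z_i = sum_k A_{i,k} delta_{w_k} a.s., where given the points the A_{i,k} are
   independent with A_{i,k} ~ G(tau_k).  Only indices of actual points are
   constrained.  The \sum_(k \in _) is a finite-support sum. *)
Definition iid_IBP (R : realType) (n : nat) (Omega : completePseudoMetricType R)
    d (T : measurableType d) (P : probability T R) (G : R.-pker R ~> vec R n)
    (tau : nat -> T -> R) (w : nat -> T -> Omega)
    (m : nat) (Z : 'I_m -> {RV P >-> vmeas n Omega}) : Prop :=
  exists A : 'I_m -> nat -> {RV P >-> vec R n},
    (forall (H : set T) (r : nat) (D : 'I_m -> nat -> set (vec R n)),
      points_sigma tau w H -> (forall i k, measurable (D i k)) ->
      P (H `&` [set t | forall i k, (k < r)%N -> present tau t k ->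
                          D i k (A i k t)]) =
      \int[P]_(t in H)
        (\prod_(k < r | (0 < tau k t)%R) \prod_(i < m)
           fine (G (tau k t) (D i k)))%:E) /\
    (forall i, {ae P, forall t, forall B : set (borel Omega), measurable B ->
      Z i t B = (\sum_(k \in [set k | present tau t k /\ B (w k t)])
                   (A i k t : 'rV[R]_n))%R}).

Definition is_IBP_law (R : realType) (n : nat)
    (Omega : completePseudoMetricType R) (G : R.-pker R ~> vec R n)
    (rho : R -> Omega -> R) (B0 : probability (borel Omega) R)
    (L : set (vmeas n Omega) -> \bar R) : Prop :=
  exists d (T : measurableType d) (P : probability T R)
    (tau : nat -> {RV P >-> R}) (w : nat -> {RV P >-> borel Omega})
    (mu : T -> set (borel Omega) -> \bar R)
    (Z : 'I_1 -> {RV P >-> vmeas n Omega}),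
    [/\ is_CRM P rho B0 tau w mu,
        iid_IBP G tau w Z
      & forall C, measurable C -> L C = P (Z ord0 @^-1` C)].

Definition pi_A (R : realType) (n : nat) (G : R.-pker R ~> vec R n) (s : R) : R :=
  fine (G s [set a | a != (0 : 'rV[R]_n)%R]).

Definition rho_upd (R : realType) (n : nat) (Omega : Type)
    (G : R.-pker R ~> vec R n) (rho : R -> Omega -> R) (M : nat) :
    R -> Omega -> R :=
  fun s w => ((1 - pi_A G s) ^+ M * rho s w)%R.

(* \int .. \int f(a_1, .., a_M) nu(da_M) .. nu(da_1) *)
Fixpoint iterated_integral (R : realType) d (E : measurableType d)
    (nu : set E -> \bar R) (M : nat) : (M.-tuple E -> \bar R) -> \bar R :=
  match M with
  | 0 => fun f => f [tuple]
  | M'.+1 => fun f =>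
      \int[nu]_a iterated_integral nu (fun t => f [tuple of a :: t])
  end.

(* K(w, .) is a version of the conditional law of s given (a_1, .., a_M) under
   the joint measure rho(s|w) ds G(da_1|s) .. G(da_M|s) on (0, oo) x (E^M \ {0}):
   joint(S x D) = \int_{(s, a), a \in D} K(w, a)(S) joint(ds, da).
   With h_i(s) = G(da_i|s) / (1 - pi_A s) if a_i != 0 and h_i(s) = 1 otherwise,
   G(da_1|s) .. G(da_M|s) = (1 - pi_A s)^M h_1(s) .. h_M(s), so K(w, a)(ds) is
   the law proportional to (1 - pi_A s)^M rho(s|w) h_1(s) .. h_M(s) ds. *)
Definition disintegrates (R : realType) (n : nat)
    (Omega : completePseudoMetricType R) (G : R.-pker R ~> vec R n)
    (rho : R -> Omega -> R) (M : nat)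
    (K : R.-pker (borel Omega * M.-tuple (vec R n))%type ~> R)
    (w : Omega) : Prop :=
  forall (S : set R) (D : set (M.-tuple (vec R n))),
    measurable S -> measurable D ->
    D `<=` [set a | exists i, tnth a i != (0 : 'rV[R]_n)%R] ->
    \int[lebesgue_measure]_(s in `]0%R, +oo[ `&` S)
      ((rho s w)%:E * iterated_integral (G s) (fun a => (\1_D a)%:E)) =
    \int[lebesgue_measure]_(s in `]0%R, +oo[)
      ((rho s w)%:E *
       iterated_integral (G s) (fun a => (\1_D a)%:E * K (w, a) S)).

Definition features (R : realType) (n : nat) (Omega : Type) (M : nat)
    (z : 'I_M -> set Omega -> 'rV[R]_n) : set Omega :=
  [set x | exists i, z i [set x] != 0%R].

(* Q is the law of Ztilde + sum_l A_l delta_{w_l}, where w_1, .., w_K enumerate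
   the features of z_1, .., z_M without repetition. *)
Definition is_predictive_law (R : realType) (n : nat)
    (Omega : completePseudoMetricType R) (B0 : probability (borel Omega) R)
    (G : R.-pker R ~> vec R n) (rho : R -> Omega -> R) (M : nat)
    (PJ : R.-pker (borel Omega * M.-tuple (vec R n))%type ~> R)
    (z : 'I_M -> set Omega -> 'rV[R]_n)
    (Q : set (vmeas n Omega) -> \bar R) : Prop :=
  exists d (T : measurableType d) (P : probability T R)
    (Zt : {RV P >-> vmeas n Omega}) (K : nat) (w : 'I_K -> Omega)
    (J : 'I_K -> {RV P >-> R}) (A : 'I_K -> {RV P >-> vec R n}),
    [/\ injective w /\ range w = features z,
        is_IBP_law G (rho_upd G rho M) B0 (distribution P Zt),
        forall l,
          (forall S, measurable S ->
             distribution P (J l) S = PJ (w l, [tuple z i [set w l] | i < M]) S) /\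
          (forall S D, measurable S -> measurable D ->
             P (J l @^-1` S `&` A l @^-1` D) =
             \int[distribution P (J l)]_(s in S) G s D),
        mutually_independent P (fun o : option 'I_K =>
          if o is Some l
          then g_sigma_algebra_preimage (fun t => (J l t, A l t) : R * vec R n)
          else g_sigma_algebra_preimage (Zt : T -> vmeas n Omega))
      & forall C, measurable C ->
          Q C = P [set t | C (fun B : set Omega =>
            (Zt t B + \sum_(l < K | w l \in B) (A l t : 'rV[R]_n))%R)]].

(* Main.v *)
(* Given the points (tau_k, w_k), the mark vectors (A_{1,k}, .., A_{M+1,k}) are
   independent with laws G(tau_k)^{M+1}, so the marked points form a Poisson
   process on (0, oo) x Omega x E^{M+1} with intensity
   rho(s|w) ds B0(dw) G(s)^{M+1}; this is read off Laplace functionals.  The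
   points whose first M marks vanish have intensity (1 - pi_A(s))^M rho(s|w) and
   produce Ztilde.  They are independent of the observed points, i.e. those with
   a nonzero mark among the first M, because Poisson counts over disjoint regions
   are independent.

   Almost surely there are finitely many observed points and, B0 being
   non-atomic, their locations are distinct, hence separated by disjoint sets
   V_1, .., V_K of a countable base.  That each V_l contains exactly one feature
   and the complement none is an event determined by Z_1, .., Z_M.  On this event
   the observed points are independent, the l-th one being distributed as the
   intensity restricted to V_l, and disintegrating this intensity with respect to
   the location and the first M marks yields the law
   int PJ(w_l, a_l)(ds) G(s) of the next mark.  Completeness of Omega serves to
   recover the location in V_l as a measurable function of Z_1, .., Z_M.  Finally
   the countably many choices of V_1, .., V_K are glued together.

   Measures are used through the functionals they define on nonnegative
   measurable functions, so that identities between product measures can be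
   checked on indicators, one coordinate at a time. *)
Require Import Defs.
From HB Require Import structures.
From mathcomp Require Import all_boot all_order all_algebra.
From mathcomp Require Import all_classical all_reals all_analysis.
From mathcomp Require Import measurable_realfun.
From mathcomp Require Import ring lra.
From Stdlib Require List.

Set Implicit Arguments.
Unset Strict Implicit.
Unset Printing Implicit Defensive.

Import Order.TTheory GRing.Theory Num.Theory.
Import numFieldNormedType.Exports HBNNSimple.

Local Open Scope classical_set_scope.
Local Open Scope ring_scope.
Local Open Scope ereal_scope.

(** * Integral-like functionals *)

(** The hypotheses speak of one given enumeration of the points, whose law as a sequence is unknown.
    Laplace functionals forget the enumeration, and finite products over indices converge to them.
    The way back uses that counts are integers: the transform at the integers c > 0 already fixes
    all level probabilities, by peeling off the lowest level and letting c grow. No conditional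
    probability is normalised. The joint law of cells, data, next marks and new part is computed
    twice, with the true next marks and with the kernel; the void probabilities appear as the same
    factor both times. Exceptional locations of the disintegration are [B0]-null and disappear under
    the intensity. Values of Z are identified with points only on the almost sure event [good].
    Events of the past are therefore written in terms of Z alone, and translated into points on that
    event. *)

Lemma gsigmaT (T : Type) (G : set (set T)) : <<s G >> setT.
Proof. by have := sigma_algebraCD (@sigma_algebra0 _ setT G); rewrite setD0. Qed.

Lemma gsigmaC (T : Type) (G : set (set T)) A : <<s G >> A -> <<s G >> (~` A).
Proof. by move=> GA; have := sigma_algebraCD GA; rewrite setTD. Qed.

Lemma gsigmaU (T : Type) (G : set (set T)) A B :
  <<s G >> A -> <<s G >> B -> <<s G >> (A `|` B).
Proof.
move=> GA GB; rewrite -bigcup2E; apply: sigma_algebra_bigcup => -[|[|n]] //=.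
exact: sigma_algebra0.
Qed.

Lemma gsigmaI (T : Type) (G : set (set T)) A B :
  <<s G >> A -> <<s G >> B -> <<s G >> (A `&` B).
Proof.
move=> GA GB; rewrite -[A `&` B]setCK setCI; apply: gsigmaC.
by apply: gsigmaU; exact: gsigmaC.
Qed.

Lemma adde_injl {R : realType} (x y z : \bar R) : x \is a fin_num ->
  x + y = x + z -> y = z.
Proof.
by move=> fx; rewrite ![x + _]addeC => /(congr1 (fun t => t - x)); rewrite !addeK.
Qed.

Lemma integral_prob_cst {R : realType} d (T : measurableType d)
  (P : probability T R) (c : \bar R) : \int[P]_t c = c.
Proof. by rewrite integral_cst// [X in _ * X]probability_setT mule1. Qed.

Section integral_like.
Context {R : realType}.

Definition nnmf d (S : measurableType d) (f : S -> \bar R) :=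
  measurable_fun [set: S] f /\ forall x, 0 <= f x.

(** The properties of integration against a measure that survive composition with kernels. No
    finiteness is asked for, so infinite Levy intensities are covered, and [L] is left unconstrained
    off [nnmf]. *)
Record integral_like d (S : measurableType d) (L : (S -> \bar R) -> \bar R) :
  Prop := IntegralLike {
  il_ge0 : forall f, nnmf f -> 0 <= L f ;
  il_le : forall f g, nnmf f -> nnmf g -> (forall x, f x <= g x) -> L f <= L g ;
  ilD : forall f g, nnmf f -> nnmf g -> L (fun x => f x + g x) = L f + L g ;
  ilZ : forall (c : R) f, (0 <= c)%R -> nnmf f ->
    L (fun x => c%:E * f x) = c%:E * L f ;
  il_lim : forall f : (S -> \bar R)^nat, (forall n, nnmf (f n)) ->
    (forall x, nondecreasing_seq (f ^~ x)) ->
    L (fun x => limn (f ^~ x)) = limn (L \o f) }.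

Definition ind d (S : measurableType d) (A : set S) : S -> \bar R :=
  fun x => (\1_A x)%:E.

Lemma nnmf_ind d (S : measurableType d) (A : set S) : measurable A -> nnmf (ind A).
Proof.
move=> mA; split; last by move=> x; rewrite lee_fin.
by apply/measurable_EFinP; exact: measurable_indic.
Qed.

Lemma nnmf_cst d (S : measurableType d) (c : \bar R) :
  0 <= c -> nnmf (fun _ : S => c).
Proof. by move=> c0; split => //; exact: measurable_cst. Qed.

Lemma nnmfD d (S : measurableType d) (f g : S -> \bar R) :
  nnmf f -> nnmf g -> nnmf (fun x => f x + g x).
Proof.
by move=> [mf f0] [mg g0]; split=> [|x]; [exact: emeasurable_funD|exact: adde_ge0].
Qed.

Lemma nnmfM d (S : measurableType d) (f g : S -> \bar R) :
  nnmf f -> nnmf g -> nnmf (fun x => f x * g x).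
Proof.
by move=> [mf f0] [mg g0]; split=> [|x]; [exact: emeasurable_funM|exact: mule_ge0].
Qed.

Lemma nnmf_prod d (S : measurableType d) (I : Type) (s : seq I) (p : pred I)
    (f : I -> S -> \bar R) :
  (forall i, nnmf (f i)) -> nnmf (fun x => \prod_(i <- s | p i) f i x).
Proof.
move=> nf; elim: s => [|i s IH].
  rewrite [X in nnmf X](_ : _ = fun=> 1); last first.
    by apply/funext => x; rewrite big_nil.
  exact: nnmf_cst.
rewrite [X in nnmf X](_ : _ = fun x => if p i then f i x * \prod_(j <- s | p j) f j x
  else \prod_(j <- s | p j) f j x); last by apply/funext => x; rewrite big_cons.
by case: (p i) => //; exact: nnmfM.
Qed.

Lemma nnmf_sum d (S : measurableType d) (I : Type) (s : seq I) (p : pred I)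
    (f : I -> S -> \bar R) :
  (forall i, nnmf (f i)) -> nnmf (fun x => \sum_(i <- s | p i) f i x).
Proof.
move=> nf; elim: s => [|i s IH].
  rewrite [X in nnmf X](_ : _ = fun=> 0); last first.
    by apply/funext => x; rewrite big_nil.
  exact: nnmf_cst.
rewrite [X in nnmf X](_ : _ = fun x => if p i then f i x + \sum_(j <- s | p j) f j x
  else \sum_(j <- s | p j) f j x); last by apply/funext => x; rewrite big_cons.
by case: (p i) => //; exact: nnmfD.
Qed.

Lemma nnmf_comp d d' (S : measurableType d) (S' : measurableType d')
    (h : S' -> S) (f : S -> \bar R) :
  measurable_fun [set: S'] h -> nnmf f -> nnmf (fun x => f (h x)).
Proof. by move=> mh [mf f0]; split => //; exact: measurableT_comp. Qed.

Lemma nnmf_lim d (S : measurableType d) (f : (S -> \bar R)^nat) :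
  (forall n, nnmf (f n)) -> (forall x, nondecreasing_seq (f ^~ x)) ->
  nnmf (fun x => limn (f ^~ x)).
Proof.
move=> nf ndf; split=> [|x].
  apply: (emeasurable_fun_cvg f) => [n|x _]; first by case: (nf n).
  exact: ereal_nondecreasing_is_cvgn.
by apply: lime_ge; [exact: ereal_nondecreasing_is_cvgn|apply: nearW => n; case: (nf n)].
Qed.

Lemma nnmf_EFin d (S : measurableType d) (f : S -> R) :
  measurable_fun setT f -> (forall x, 0 <= f x)%R -> nnmf (fun x => (f x)%:E).
Proof. by move=> mf f0; split=> [|x]; [exact/measurable_EFinP|rewrite lee_fin]. Qed.

Lemma indE d (S : measurableType d) (A : set S) x : ind A x = (x \in A)%:R%:E.
Proof. by rewrite /ind indicE. Qed.

Lemma ind1 d (S : measurableType d) (A : set S) x : A x -> ind A x = 1.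
Proof. by move=> Ax; rewrite indE mem_set. Qed.

Lemma ind0 d (S : measurableType d) (A : set S) x : ~ A x -> ind A x = 0.
Proof. by move=> Ax; rewrite indE memNset. Qed.

Lemma indT d (S : measurableType d) : ind [set: S] = fun=> 1.
Proof. by apply/funext => x; rewrite ind1. Qed.

Lemma indI d (S : measurableType d) (A B : set S) x :
  ind (A `&` B) x = ind A x * ind B x.
Proof. by rewrite /ind indicI EFinM. Qed.

Lemma ind_le1 d (S : measurableType d) (A : set S) x : ind A x <= 1.
Proof. by rewrite indE lee_fin; case: (_ \in _). Qed.

Lemma ind_ge0 d (S : measurableType d) (A : set S) x : 0 <= ind A x.
Proof. by rewrite indE lee_fin; case: (_ \in _). Qed.

Lemma le_ind d (S : measurableType d) (A B : set S) x :
  (A x -> B x) -> ind A x <= ind B x.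
Proof.
move=> AB; have [Ax|Ax] := pselect (A x); first by rewrite !ind1//; exact: AB.
by rewrite (ind0 Ax) ind_ge0.
Qed.

Lemma integral_ind d (S : measurableType d) (mu : {measure set S -> \bar R})
  (A : set S) : measurable A -> \int[mu]_x ind A x = mu A.
Proof. by move=> mA; rewrite integral_indic// setIT. Qed.

Lemma integral_ind_mul d (S : measurableType d) (mu : {measure set S -> \bar R})
  (A : set S) (f : S -> \bar R) : measurable A ->
  \int[mu]_x (ind A x * f x) = \int[mu]_(x in A) f x.
Proof.
move=> mA; rewrite [RHS]integral_mkcond; apply: eq_integral => x _.
by rewrite epatch_indic /= muleC.
Qed.

Lemma il_eq d (S : measurableType d) (L : (S -> \bar R) -> \bar R) f g :
  f =1 g -> L f = L g.
Proof. by move=> /funext ->. Qed.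

Lemma il0 d (S : measurableType d) (L : (S -> \bar R) -> \bar R) :
  integral_like L -> L (fun=> 0) = 0.
Proof.
move=> iL; rewrite (_ : (fun=> 0) = (fun x => 0%:E * (fun _ : S => 0) x)).
  by rewrite ilZ ?mul0e//; exact: nnmf_cst.
by apply/funext => x; rewrite mul0e.
Qed.

Lemma il_sum d (S : measurableType d) (L : (S -> \bar R) -> \bar R) (I : Type)
    (s : seq I) (p : pred I) (f : I -> S -> \bar R) :
  integral_like L -> (forall i, nnmf (f i)) ->
  L (fun x => \sum_(i <- s | p i) f i x) = \sum_(i <- s | p i) L (f i).
Proof.
move=> iL nf; elim: s => [|i s IH].
  rewrite big_nil -[RHS](il0 iL); apply: il_eq => x; exact: big_nil.
rewrite big_cons -IH; case: ifPn => pi; last first.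
  by apply: il_eq => x; rewrite big_cons (negbTE pi).
rewrite -ilD//; last exact: nnmf_sum.
by apply: il_eq => x; rewrite big_cons pi.
Qed.

Lemma integral_like_int d (S : measurableType d) (mu : {measure set S -> \bar R}) :
  integral_like (fun f => \int[mu]_x f x).
Proof.
split.
- by move=> f [mf f0]; exact: integral_ge0.
- by move=> f g [mf f0] [mg g0] fg; apply: ge0_le_integral.
- by move=> f g [mf f0] [mg g0]; rewrite ge0_integralD.
- by move=> c f c0 [mf f0]; rewrite ge0_integralZl_EFin.
- move=> f nf ndf; rewrite monotone_convergence//.
  + by move=> n; case: (nf n).
  + by move=> n x _; case: (nf n).
Qed.

Lemma nnmf_integralZl d (S : measurableType d) (mu : {measure set S -> \bar R})
    c (f : S -> \bar R) : nnmf f -> 0 <= c ->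
  \int[mu]_x (c * f x) = c * \int[mu]_x f x.
Proof. by move=> [mf f0] c0; rewrite ge0_integralZl. Qed.

Lemma nnmf_integralZr d (S : measurableType d) (mu : {measure set S -> \bar R})
    c (f : S -> \bar R) : nnmf f -> 0 <= c ->
  \int[mu]_x (f x * c) = (\int[mu]_x f x) * c.
Proof. by move=> [mf f0] c0; rewrite ge0_integralZr. Qed.

Lemma nnmf_integral_ge0 d (S : measurableType d) (mu : {measure set S -> \bar R})
    (f : S -> \bar R) : nnmf f -> 0 <= \int[mu]_x f x.
Proof. by move=> [_ f0]; exact: integral_ge0. Qed.

(** For [w = +oo] the product is not continuous at 0. Monotonicity saves the exchange: either some
    [u N] is positive and both sides are +oo, or [u] vanishes identically and the convention +oo * 0
    = 0 applies. *)
Lemma limn_mul_nd (w : \bar R) (u : (\bar R)^nat) : 0 <= w ->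
  (forall n, 0 <= u n) -> nondecreasing_seq u ->
  w * limn u = limn (fun n => w * u n).
Proof.
move=> w0 u0 ndu; have cu := ereal_nondecreasing_is_cvgn ndu.
have [wfin|] := boolP (w \is a fin_num); first by rewrite limeMl.
rewrite ge0_fin_numE// -leNgt leye_eq => /eqP ->.
have [[N uN]|/forallNP u00] := pselect (exists N, 0 < u N).
- have lu : 0 < limn u.
    apply: (lt_le_trans uN); apply: lime_ge => //.
    by exists N => // n /= Nn; exact: ndu.
  rewrite gt0_mulye//; apply/esym/cvg_lim => //; apply: cvg_near_cst.
  exists N => // n /= Nn; rewrite gt0_mulye//.
  by rewrite (lt_le_trans uN)//; exact: ndu.
- have {}u00 n : u n = 0.
    by apply/eqP; rewrite eq_le u0 andbT leNgt; apply/negP/u00.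
  rewrite (_ : u = fun=> 0); last exact/funext.
  by rewrite lim_cst// mule0 lim_cst.
Qed.

(* A family of integral-like functionals depending measurably on a parameter:
   an unnormalised, possibly infinite, kernel seen as an operator. *)
Record kernel_op d d' (S : measurableType d) (S' : measurableType d')
    (K : (S -> \bar R) -> S' -> \bar R) : Prop := KernelOp {
  kop_meas : forall f, nnmf f -> measurable_fun setT (K f) ;
  kop_il : forall t, integral_like (fun f => K f t) }.

Lemma kop_nnmf d d' (S : measurableType d) (S' : measurableType d')
  (K : (S -> \bar R) -> S' -> \bar R) f : kernel_op K -> nnmf f -> nnmf (K f).
Proof.
by move=> kK nf; split=> [|x]; [exact: kop_meas|exact: (il_ge0 (kop_il kK x))].
Qed.

Lemma integral_like_kop d d' (S : measurableType d) (S' : measurableType d')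
    (L : (S' -> \bar R) -> \bar R) (K : (S -> \bar R) -> S' -> \bar R) :
  integral_like L -> kernel_op K -> integral_like (fun f => L (K f)).
Proof.
move=> iL kK; have iK := kop_il kK; split.
- by move=> f nf; apply: il_ge0 => //; exact: kop_nnmf.
- by move=> f g nf ng fg; apply: (il_le iL); [exact: kop_nnmf..|move=> x; exact: (il_le (iK x))].
- move=> f g nf ng; rewrite -(ilD iL); [|exact: kop_nnmf..].
  by apply: il_eq => x; rewrite (ilD (iK x)).
- move=> c f c0 nf; rewrite -(ilZ iL)//; [|exact: kop_nnmf..].
  by apply: il_eq => x; rewrite (ilZ (iK x)).
- move=> f nf ndf; have ndK x : nondecreasing_seq (fun n => K (f n) x).
    by move=> m n mn; apply: (il_le (iK x)) => // y; exact: ndf.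
  have := il_lim iL (fun n => kop_nnmf kK (nf n)) ndK => /= <-.
  by apply: il_eq => x; rewrite (il_lim (iK x)).
Qed.

Lemma kop_comp d d' d'' (S : measurableType d) (S' : measurableType d')
    (S'' : measurableType d'') (K' : (S' -> \bar R) -> S'' -> \bar R)
    (K : (S -> \bar R) -> S' -> \bar R) :
  kernel_op K' -> kernel_op K -> kernel_op (fun f => K' (K f)).
Proof.
move=> kK' kK; split.
- by move=> f nf; apply: kop_meas => //; exact: kop_nnmf.
- by move=> t; exact: (integral_like_kop (kop_il kK' t) kK).
Qed.

Lemma kop_pull d d' (S : measurableType d) (S' : measurableType d')
    (h : S' -> S) : measurable_fun setT h ->
  kernel_op (fun (f : S -> \bar R) t => f (h t)).
Proof.
move=> mh; split; first by move=> f [mf _]; exact: measurableT_comp.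
by move=> t; split => //= f [].
Qed.

Lemma kop_mul d (S : measurableType d) (w : S -> \bar R) : nnmf w ->
  kernel_op (fun (f : S -> \bar R) t => w t * f t).
Proof.
move=> [mw w0]; split; first by move=> f [mf _]; exact: emeasurable_funM.
move=> t; split => //=.
- by move=> f [_ f0]; exact: mule_ge0.
- by move=> f g _ _ fg; exact: lee_wpmul2l.
- by move=> f g [_ f0] [_ g0]; rewrite ge0_muleDr.
- by move=> c f c0 _; rewrite muleCA.
- by move=> f nf ndf; rewrite limn_mul_nd// => n; case: (nf n).
Qed.

Lemma integral_like_scale d (S : measurableType d) (L : (S -> \bar R) -> \bar R)
  (c : \bar R) : 0 <= c -> integral_like L -> integral_like (fun f => c * L f).
Proof.
move=> c0 iL; split.
- by move=> f nf; rewrite mule_ge0//; exact: (il_ge0 iL).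
- by move=> f g nf ng fg; rewrite lee_wpmul2l//; exact: (il_le iL).
- by move=> f g nf ng; rewrite (ilD iL)// ge0_muleDr//; exact: (il_ge0 iL).
- by move=> a f a0 nf; rewrite (ilZ iL)// muleCA.
- move=> f nf ndf; rewrite (il_lim iL)// limn_mul_nd//= => [n|m n mn].
    exact: (il_ge0 iL).
  by apply: (il_le iL) => // x; exact: ndf.
Qed.

Lemma kop_ker d d' (S : measurableType d) (S' : measurableType d')
    (k : R.-pker S' ~> S) : kernel_op (fun f t => \int[k t]_x f x).
Proof.
split; last by move=> t; exact: integral_like_int.
move=> f [mf f0]; apply: measurable_fun_integral_kernel => //.
exact: measurable_kernel.
Qed.

Lemma kop_ker2 d d' d'' (S : measurableType d) (S' : measurableType d')
    (S'' : measurableType d'') (k : R.-pker S' ~> S) (h : S' * S -> S'') :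
  measurable_fun setT h ->
  kernel_op (fun (f : S'' -> \bar R) t => \int[k t]_x f (h (t, x))).
Proof.
move=> mh; split.
  move=> f [mf f0]; apply: (measurable_fun_integral_sfinite_kernel (f \o h) k).
    by move=> x; exact: f0.
  exact: measurableT_comp.
move=> t; apply: (integral_like_kop (integral_like_int (k t))).
apply: (kop_pull (h := fun x => h (t, x))).
by apply: measurableT_comp => //; exact: pair1_measurable.
Qed.

Lemma kop_fubini d d' (S : measurableType d) (S' : measurableType d')
    (mu : {sigma_finite_measure set S -> \bar R}) :
  kernel_op (fun (f : S * S' -> \bar R) t => \int[mu]_x f (x, t)).
Proof.
split.
  by move=> f [mf f0]; exact: measurable_fun_fubini_tonelli_G.
move=> t; apply: (integral_like_kop (integral_like_int mu)).
exact: (kop_pull (h := fun x => (x, t)) (pair2_measurable _)).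
Qed.

End integral_like.

(** * Uniqueness of functionals from their values on a pi-system *)

Section integral_like_unique.
Context {R : realType} d (S : measurableType d).
Variables L1 L2 : (S -> \bar R) -> \bar R.
Hypotheses (iL1 : integral_like L1) (iL2 : integral_like L2).

Lemma integral_like_eq :
  (forall A, measurable A -> L1 (ind A) = L2 (ind A)) ->
  forall f, nnmf f -> L1 f = L2 f.
Proof.
move=> L12 f [mf f0].
pose a := nnsfun_approx measurableT mf.
have -> : f = fun x => limn (fun n => (a n x)%:E).
  apply/funext => x; apply/esym/cvg_lim => //.
  by apply: cvg_nnsfun_approx => //.
have na n : nnmf (fun x => (a n x)%:E).
  by split; [apply/measurable_EFinP; exact: measurable_funPT|move=> x; rewrite lee_fin].
have nda x : nondecreasing_seq (fun n => (a n x)%:E).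
  by move=> m n mn; rewrite lee_fin; exact/(lefP _ _ (nd_nnsfun_approx _ _ mn)).
rewrite (il_lim iL1 na nda) (il_lim iL2 na nda); congr (limn _).
apply/funext => n /=.
(* The coefficient is truncated at 0 so that [ilZ] applies to every real [y]; on the range of [a n],
   which is nonnegative, the truncation changes nothing. *)
have nn (y : R) : nnmf (fun x => (Num.max 0 y)%:E * ind (a n @^-1` [set y]) x).
  apply: nnmfM; first by apply: nnmf_cst; rewrite lee_fin le_max lexx.
  exact: nnmf_ind.
have -> : (fun x => (a n x)%:E) = fun x => \sum_(y <- finmap.enum_fset (fset_set (range (a n))))
    (Num.max 0 y)%:E * ind (a n @^-1` [set y]) x.
  apply/funext => x; rewrite fimfunE fsbig_finite//= -sumEFin.
  apply: eq_big_seq => y; rewrite in_fset_set// inE => -[z _ <-].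
  by rewrite max_r// EFinM.
rewrite !il_sum//; apply: eq_bigr => y _.
rewrite !ilZ ?le_max ?lexx//; [|exact: nnmf_ind..].
by rewrite L12.
Qed.

(** Dynkin's argument. Finiteness of [L1] at 1 is what allows the common value on a subset to be
    cancelled in a proper difference. *)
Lemma integral_like_sigma (G : set (set S)) :
  G `<=` measurable -> setI_closed G ->
  (forall A, G A -> L1 (ind A) = L2 (ind A)) ->
  L1 (fun=> 1) = L2 (fun=> 1) -> L1 (fun=> 1) < +oo ->
  forall A, <<s G >> A -> L1 (ind A) = L2 (ind A).
Proof.
move=> GM GI L12 L1E L1oo A GA.
pose H := [set A | measurable A /\ L1 (ind A) = L2 (ind A)].
have GH : G `<=` H.
  by move=> B GB; split; [exact: GM|exact: L12].
suff : lambda_system setT H.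
  move=> lH; have := lambda_system_subset GI lH GH (fun _ _ => @subsetT _ _).
  by move=> /(_ _ GA)[].
split => //.
- by split; [exact: measurableT|rewrite indT].
- move=> B C CB [mB eB] [mC eC]; have mBC := measurableD mB mC; split => //.
  have BE : ind B = (fun x => ind C x + ind (B `\` C) x) :> (S -> \bar R).
    apply/funext => x; have [Cx|Cx] := pselect (C x).
      by rewrite (ind1 Cx) (ind1 (CB _ Cx)) ind0 ?adde0//= => -[].
    rewrite (ind0 Cx) add0e; have [Bx|Bx] := pselect (B x); first by rewrite !ind1.
    by rewrite !ind0// => -[].
  have C1oo : L1 (ind C) \is a fin_num.
    rewrite ge0_fin_numE; last by apply: (il_ge0 iL1); exact: nnmf_ind.
    apply: le_lt_trans L1oo; apply: (il_le iL1); [exact: nnmf_ind|exact: nnmf_cst|].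
    exact: ind_le1.
  move: eB; rewrite BE ilD//; [|exact: nnmf_ind..].
  rewrite ilD//; [|exact: nnmf_ind..].
  by rewrite -eC => /(adde_injl C1oo).
- move=> F ndF HF; have mF n : measurable (F n) by case: (HF n).
  split; first exact: bigcupT_measurable.
  have ndi x : nondecreasing_seq (fun n => ind (F n) x : \bar R).
    by move=> m n mn; apply: le_ind; have /subsetPset := ndF _ _ mn; exact.
  have -> : ind (\bigcup_n F n) = (fun x => limn (fun n => ind (F n) x)) :> (S -> \bar R).
    apply/funext => x; apply/esym/cvg_lim => //.
    have [[n _ Fnx]|nFx] := pselect ((\bigcup_n F n) x).
      rewrite ind1; last by exists n.
      apply: cvg_near_cst; exists n => // m /= nm; rewrite ind1//.
      by have /subsetPset := ndF _ _ nm; exact.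
    rewrite ind0//; apply: cvg_near_cst; apply: nearW => m.
    by rewrite ind0// => Fmx; apply: nFx; exists m.
  rewrite (il_lim iL1 (fun n => nnmf_ind (mF n)) ndi).
  rewrite (il_lim iL2 (fun n => nnmf_ind (mF n)) ndi).
  by congr (limn _); apply/funext => n /=; case: (HF n).
Qed.

Lemma integral_like_unique (G : set (set S)) :
  measurable = <<s G >> -> setI_closed G ->
  (forall A, G A -> L1 (ind A) = L2 (ind A)) ->
  L1 (fun=> 1) = L2 (fun=> 1) -> L1 (fun=> 1) < +oo ->
  forall f, nnmf f -> L1 f = L2 f.
Proof.
move=> GE GI L12 L1E L1oo; apply: integral_like_eq => A mA.
apply: (@integral_like_sigma G) => //; last by rewrite -GE.
by rewrite GE; exact: sub_gen_smallest.
Qed.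

End integral_like_unique.

Section multilinear_unique.
Context {R : realType} d (S : measurableType d).

Definition unit_fun (f : S -> \bar R) := nnmf f /\ forall x, f x <= 1.

Definition upd (phi : nat -> S -> \bar R) k f := fun i => if i == k then f else phi i.

Lemma unit_fun_ind (A : set S) : measurable A -> unit_fun (ind A).
Proof. by move=> mA; split; [exact: nnmf_ind|exact: ind_le1]. Qed.

Lemma unit_fun_cst1 : unit_fun (fun=> 1).
Proof. by split => //; exact: nnmf_cst. Qed.

Lemma upd_id phi k : upd phi k (phi k) = phi.
Proof. by apply/funext => i; rewrite /upd; case: eqP => // ->. Qed.

(** A monotone class argument in several variables, run one coordinate at a time. Restricting to
    functions with values in [0, 1] keeps the total masses finite while the other coordinates are
    frozen. Families are indexed by [nat] so that [upd] can replace a coordinate without dependent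
    types; the locality hypotheses discard the indices from [q] on. *)
Lemma multilinear_unique (q : nat) (G : set (set S))
    (F1 F2 : (nat -> S -> \bar R) -> \bar R) :
  measurable = <<s G >> -> setI_closed G -> G setT ->
  (forall phi k, (k < q)%N -> (forall i, unit_fun (phi i)) ->
    integral_like (fun f => F1 (upd phi k f))) ->
  (forall phi k, (k < q)%N -> (forall i, unit_fun (phi i)) ->
    integral_like (fun f => F2 (upd phi k f))) ->
  (forall phi, (forall i, unit_fun (phi i)) -> F1 phi < +oo) ->
  (forall phi psi, (forall i, (i < q)%N -> phi i = psi i) -> F1 phi = F1 psi) ->
  (forall phi psi, (forall i, (i < q)%N -> phi i = psi i) -> F2 phi = F2 psi) ->
  (forall A : nat -> set S, (forall i, G (A i)) ->
    F1 (fun i => ind (A i)) = F2 (fun i => ind (A i))) ->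
  forall phi, (forall i, unit_fun (phi i)) -> F1 phi = F2 phi.
Proof.
move=> GE GI GT iF1 iF2 F1oo loc1 loc2 F12.
have GM A : G A -> measurable A by move=> GA; rewrite GE; exact: sub_sigma_algebra.
(* Induction on the number [j] of coordinates that may be arbitrary: those from [j] on are still
   indicators of sets of [G]. *)
have main j : (j <= q)%N -> forall phi, (forall i, unit_fun (phi i)) ->
    (exists A : nat -> set S, forall i, (j <= i)%N -> G (A i) /\ phi i = ind (A i)) ->
    F1 phi = F2 phi.
  elim: j => [_ phi uphi [A hA]|j IH jq phi uphi [A hA]].
    have -> : phi = fun i => ind (A i) by apply/funext => i; case: (hA i).
    by apply: F12 => i; case: (hA i).
  rewrite -(upd_id phi j).
  have := integral_like_unique (iF1 phi j jq uphi) (iF2 phi j jq uphi) GE GI.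
  have IHj B : G B -> F1 (upd phi j (ind B)) = F2 (upd phi j (ind B)).
    move=> GB; apply: IH; [exact: ltnW| |].
      by move=> i; rewrite /upd; case: ifP => // _; apply: unit_fun_ind; exact: GM.
    exists (fun i => if i == j then B else A i) => i ji; rewrite /upd.
    by case: eqVneq => [//|ij]; apply: hA; rewrite ltn_neqAle eq_sym ij.
  move=> /(_ IHj); apply; last by case: (uphi j).
    by rewrite -(@indT R _ S); exact: IHj.
  apply: F1oo => i; rewrite /upd; case: ifP => // _; exact: unit_fun_cst1.
move=> phi uphi; pose psi i := if (i < q)%N then phi i else ind setT.
rewrite (loc1 phi psi) ?(loc2 phi psi); [|by move=> i iq; rewrite /psi iq..].
apply: (main q) => //.
  by move=> i; rewrite /psi; case: ifP => // _; exact: unit_fun_ind.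
exists (fun=> setT) => i qi; split => //.
by rewrite /psi ltnNge qi.
Qed.

End multilinear_unique.

(** * Probability kernels *)

Section kernel_constructions.
Context {R : realType}.

Lemma pker_le1 d d' (X : measurableType d) (Y : measurableType d')
  (k : R.-pker X ~> Y) x U : measurable U -> k x U <= 1.
Proof.
by move=> mU; rewrite -(@prob_kernel _ _ _ _ _ k x); apply: le_measure; rewrite ?inE.
Qed.

Lemma pker_fin d d' (X : measurableType d) (Y : measurableType d')
  (k : R.-pker X ~> Y) x U : measurable U -> k x U \is a fin_num.
Proof.
by move=> mU; rewrite ge0_fin_numE// (le_lt_trans (pker_le1 k x mU))// ltry.
Qed.

Section kpull.
Context d d' d'' (X' : measurableType d) (X : measurableType d')
  (Y : measurableType d'') (k : R.-pker X ~> Y) (h : X' -> X).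

Definition kpull (mh : measurable_fun setT h) (x : X') :
  {measure set Y -> \bar R} := k (h x).

Hypothesis mh : measurable_fun setT h.

Let measurable_kpull U : measurable U -> measurable_fun [set: X'] (kpull mh ^~ U).
Proof.
by move=> mU; apply: measurableT_comp (measurable_kernel k _ mU) mh.
Qed.

HB.instance Definition _ := isKernel.Build _ _ _ _ _ (kpull mh) measurable_kpull.

Let kpull_prob x : kpull mh x [set: Y] = 1.
Proof. exact: prob_kernel. Qed.

HB.instance Definition _ := Kernel_isProbability.Build _ _ _ _ _
  (kpull mh) kpull_prob.

End kpull.

Section kseq.
Context d d' d'' (X : measurableType d) (Y : measurableType d')
  (Z : measurableType d'') (l : R.-pker X ~> Y) (k : R.-pker (X * Y) ~> Z).

Definition kseq_comp : X -> {measure set Z -> \bar R} := mkcomp l k.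

Lemma kseq_compE x U : kseq_comp x U = \int[l x]_y k (x, y) U.
Proof. by []. Qed.

Let measurable_kseq U : measurable U -> measurable_fun [set: X] (kseq_comp ^~ U).
Proof.
by move=> mU; exact: (measurable_kernel (mkcomp l k)).
Qed.

HB.instance Definition _ := isKernel.Build _ _ _ _ _ kseq_comp measurable_kseq.

Let kseq_prob x : kseq_comp x [set: Z] = 1.
Proof.
rewrite kseq_compE; under eq_integral do rewrite prob_kernel.
by rewrite integral_cst// mul1e prob_kernel.
Qed.

HB.instance Definition _ := Kernel_isProbability.Build _ _ _ _ _
  kseq_comp kseq_prob.

Lemma integral_kseq x f : nnmf f ->
  \int[kseq_comp x]_z f z = \int[l x]_y \int[k (x, y)]_z f z.
Proof. by move=> [mf f0]; exact: integral_kcomp. Qed.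

End kseq.

Section kprodt.
Context d d' (A : measurableType d) (B : measurableType d') (k : R.-pker A ~> B).

Lemma measurable_thead m : measurable_fun [set: m.+1.-tuple A] (@thead m A).
Proof. exact: measurable_tnth. Qed.

Lemma measurable_beheadl m :
  measurable_fun [set: m.+1.-tuple A * B] (fun p => [tuple of behead p.1]).
Proof. exact: (measurableT_comp (@measurable_behead _ A m)). Qed.

Lemma measurable_consl m :
  measurable_fun [set: (m.+1.-tuple A * B) * m.-tuple B] (fun p => [tuple of p.1.2 :: p.2]).
Proof. by apply: measurable_cons => //; exact: measurableT_comp. Qed.

Definition kprodt_step m (km : R.-pker (m.-tuple A) ~> (m.-tuple B)) :
  R.-pker (m.+1.-tuple A) ~> (m.+1.-tuple B) :=
  kseq_comp (kpull k (@measurable_thead m))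
    (kseq_comp (kpull km (@measurable_beheadl m)) (kdirac (@measurable_consl m))).

(** The independent product of the laws k(x_1), .., k(x_m). Building it from kernel compositions
    gives its measurability in the parameter for free. *)
Fixpoint kprodt m : R.-pker (m.-tuple A) ~> (m.-tuple B) :=
  match m with
  | 0 => kdirac (measurable_cst [tuple])
  | m'.+1 => kprodt_step (kprodt m')
  end.

Lemma integral_kprodt0 (x : 0.-tuple A) (f : 0.-tuple B -> \bar R) :
  nnmf f -> \int[kprodt 0 x]_y f y = f [tuple].
Proof. by move=> [mf f0]; rewrite integral_dirac// diracT mul1e. Qed.

Lemma integral_kprodtS m (x : m.+1.-tuple A) (f : m.+1.-tuple B -> \bar R) :
  nnmf f -> \int[kprodt m.+1 x]_y f y =
  \int[k (thead x)]_y \int[kprodt m [tuple of behead x]]_z f [tuple of y :: z].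
Proof.
move=> nf; rewrite integral_kseq//; apply: eq_integral => y _.
rewrite integral_kseq//; apply: eq_integral => z _.
by rewrite integral_dirac ?diracT ?mul1e//; case: nf.
Qed.

Lemma nnmf_tnth_prod m (f : 'I_m -> B -> \bar R) : (forall i, nnmf (f i)) ->
  nnmf (fun y : m.-tuple B => \prod_(i < m) f i (tnth y i)).
Proof.
by move=> nf; apply: nnmf_prod => i; exact: (nnmf_comp (measurable_tnth i)).
Qed.

Lemma tnth_behead_lift (T : Type) m (x : m.+1.-tuple T) i :
  tnth [tuple of behead x] i = tnth x (lift ord0 i).
Proof. by rewrite [in RHS](tuple_eta x) tnthS. Qed.

Lemma integral_kprodt_prod m (x : m.-tuple A) (f : 'I_m -> B -> \bar R) :
  (forall i, nnmf (f i)) ->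
  \int[kprodt m x]_y \prod_(i < m) f i (tnth y i) =
  \prod_(i < m) \int[k (tnth x i)]_y f i y.
Proof.
elim: m => [|m IH] in x f * => nf.
  by rewrite integral_kprodt0 ?big_ord0//; exact: nnmf_tnth_prod.
rewrite integral_kprodtS; last exact: nnmf_tnth_prod.
set c := \prod_(i < m) \int[k (tnth [tuple of behead x] i)]_y f (lift ord0 i) y.
have c0 : 0 <= c.
  by apply: prode_ge0 => i _; exact: nnmf_integral_ge0.
transitivity (\int[k (thead x)]_y (f ord0 y * c)).
  apply: eq_integral => y _; rewrite /c -IH// -nnmf_integralZl; last 2 first.
  - exact: (nnmf_tnth_prod (f := fun i => f (lift ord0 i))).
  - by case: (nf ord0).
  apply: eq_integral => z _; rewrite big_ord_recl tnth0.
  by congr (_ * _); apply: eq_bigr => i _; rewrite tnthS.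
rewrite nnmf_integralZr//.
rewrite big_ord_recl; congr (_ * _); apply: eq_bigr => i _.
by rewrite tnth_behead_lift.
Qed.

(** Translates the iterated integrals of the disintegration property into a product kernel, whose
    dependence on [s] is measurable. *)
Lemma iterated_integralE m (s : A) (f : m.-tuple B -> \bar R) : nnmf f ->
  iterated_integral (k s) f = \int[kprodt m (nseq_tuple m s)]_y f y.
Proof.
elim: m => [|m IH] in f * => nf; first by rewrite integral_kprodt0.
rewrite [LHS]/= integral_kprodtS// [thead _](_ : _ = s); last exact: tnth_nseq.
apply: eq_integral => y _.
rewrite IH; last first.
  apply: (nnmf_comp (h := fun t : m.-tuple B => [tuple of y :: t])) => //.
  exact: measurable_cons.
by congr (integral _ _ _); congr (kprodt m _); apply: val_inj.
Qed.

End kprodt.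
End kernel_constructions.

Section lebesgue_integral_like.
Context {R : realType}.

(* [lebesgue_measure] lives on a copy of [R] with another display, hence the
   field-by-field transfers. *)
Lemma integral_like_lebesgue :
  @integral_like R _ R (fun f => \int[lebesgue_measure]_x f x).
Proof.
have H := integral_like_int (@lebesgue_measure R).
split.
- exact: (il_ge0 H).
- exact: (il_le H).
- exact: (ilD H).
- exact: (ilZ H).
- exact: (il_lim H).
Qed.

Lemma kop_lebesgue d (S : measurableType d) :
  kernel_op (fun (f : R * S -> \bar R) t => \int[lebesgue_measure]_x f (x, t)).
Proof.
have H := kop_fubini S (@lebesgue_measure R).
split; first by move=> f nf; exact: (kop_meas H nf).
move=> t; apply: (integral_like_kop integral_like_lebesgue
  (K := fun f x => f (x, t))).
exact: (kop_pull (pair2_measurable _)).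
Qed.

End lebesgue_integral_like.

(** * Laplace transforms of counts *)

Section exponential.
Context {R : realType}.

Definition lap (x : \bar R) : \bar R := expeR (- x).

Lemma lap0 : lap 0 = 1. Proof. by rewrite /lap oppe0 expeR0. Qed.

Lemma lap_ge0 x : 0 <= lap x. Proof. exact: expeR_ge0. Qed.

Lemma lapy : lap +oo = 0. Proof. by []. Qed.

Lemma lapE (x : R) : lap x%:E = (expR (- x))%:E. Proof. by []. Qed.

Lemma le_lap x y : (lap x <= lap y) = (y <= x).
Proof. by rewrite /lap lee_expeR leeN2. Qed.

Lemma lap_le1 x : 0 <= x -> lap x <= 1.
Proof. by move=> x0; rewrite -lap0 le_lap. Qed.

Lemma lapD x y : 0 <= x -> 0 <= y -> lap (x + y) = lap x * lap y.
Proof.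
move=> x0 y0; rewrite /lap oppeD ?expeRD//.
by apply: ge0_adde_def; rewrite inE.
Qed.

Lemma lap_sum (I : Type) (s : seq I) (p : pred I) (f : I -> \bar R) :
  (forall i, 0 <= f i) ->
  lap (\sum_(i <- s | p i) f i) = \prod_(i <- s | p i) lap (f i).
Proof.
move=> f0; elim: s => [|i s IH]; first by rewrite !big_nil lap0.
rewrite !big_cons; case: ifP => // _.
by rewrite lapD ?IH//; exact: sume_ge0.
Qed.

Lemma measurable_lap : measurable_fun [set: \bar R] lap.
Proof.
rewrite (_ : lap = fun x => if x == +oo then 0 else
  if x == -oo then +oo else (expR (- fine x))%:E); last first.
  by apply/funext => -[].
have meq (y : \bar R) : measurable_fun [set: \bar R] (fun x => x == y).
  exact: measurable_fun_eqe.
apply: measurable_fun_ifT => //; apply: measurable_fun_ifT => //.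
apply/measurable_EFinP; apply: measurableT_comp => //.
apply: measurableT_comp => //; exact: fine_measurable.
Qed.

Lemma nnmf_lap d (S : measurableType d) (f : S -> \bar R) :
  measurable_fun setT f -> nnmf (fun x => lap (f x)).
Proof.
by move=> mf; split => [|x]; [exact: (measurableT_comp measurable_lap)|exact: lap_ge0].
Qed.

(** The error vanishes in the limit: exp n >= 1 + n exceeds K / e as soon as n does. *)
Lemma lee_expR_decay (x y : \bar R) (K : R) :
  (forall n : nat, (0 < n)%N -> x <= y + (expR (- n%:R) * K)%:E) -> x <= y.
Proof.
move=> xy; apply/lee_addgt0Pr => e e0.
have [n n0 nK] : exists2 n : nat, (0 < n)%N & (expR (- n%:R) * K <= e)%R.
  pose n := (Num.truncn (K / e)%R).+1; exists n => //.
  have Kn : (K / e <= n%:R)%R by apply: ltW; rewrite truncnS_gt.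
  rewrite expRN mulrC ler_pdivrMr ?expR_gt0// -ler_pdivrMl//  mulrC.
  apply: (le_trans Kn); apply: le_trans (expR_ge1Dx _).
  by rewrite lerDr.
by apply: (le_trans (xy n n0)); rewrite leeD2l// lee_fin.
Qed.

Definition natlike (x : \bar R) := x = +oo \/ exists m : nat, x = m%:R%:E.

Definition lev d (T : measurableType d) (N : T -> \bar R) (m : nat) : set T :=
  [set t | N t = m%:R%:E].

Definition gev d (T : measurableType d) (N : T -> \bar R) (m : nat) : set T :=
  [set t | m%:R%:E <= N t].

Lemma measurable_lev d (T : measurableType d) (N : T -> \bar R) m :
  measurable_fun setT N -> measurable (lev N m).
Proof.
move=> mN; rewrite -[X in measurable X]setTI.
exact: (mN measurableT [set m%:R%:E]).
Qed.

Lemma measurable_gev d (T : measurableType d) (N : T -> \bar R) m :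
  measurable_fun setT N -> measurable (gev N m).
Proof. by move=> mN; rewrite -[X in measurable X]setTI; exact: measurable_lee. Qed.

End exponential.

(** * Levels of a count from its Laplace transform *)

Section laplace_unique.
Context {R : realType}.

Section one_side.
Context d (T : measurableType d) (mu : {measure set T -> \bar R}).
Variables (W N : T -> \bar R).
Hypotheses (nW : nnmf W) (mN : measurable_fun setT N) (NN : forall t, natlike (N t)).

Let tailpart m (c : nat) := \int[mu]_t (W t * (ind (gev N m) t * lap (c%:R%:E * N t))).

Lemma gev0 : gev N 0 = setT.
Proof.
apply/seteqP; split => // t _; rewrite /gev /=.
by case: (NN t) => [->|[m ->]]; rewrite ?leey// lee_fin ler0n.
Qed.

Lemma natlike_ge0 t : 0 <= N t.
Proof. by case: (NN t) => [->|[m ->]]; rewrite ?leey// lee_fin ler0n. Qed.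

(** Peels off the lowest level. The hypothesis 0 < c makes the transform vanish at an infinite
    count, whereas c = 0 would give it the value 1 there. *)
Lemma ind_gev_split m c t : (0 < c)%N ->
  ind (gev N m) t * lap (c%:R%:E * N t) =
  ind (lev N m) t * (expR (- (c%:R * m%:R)))%:E +
  ind (gev N m.+1) t * lap (c%:R%:E * N t).
Proof.
move=> c0; case: (NN t) => [Nt|[k Nt]].
  rewrite (ind0 (A := lev N m)); last by rewrite /lev /= Nt.
  by rewrite Nt gt0_muley ?lte_fin ?ltr0n// lapy !mule0 mul0e adde0.
have [km|mk|km] := ltngtP k m.
- rewrite (ind0 (A := gev N m)); last by rewrite /gev /= Nt lee_fin ler_nat leqNgt km.
  rewrite (ind0 (A := lev N m)); last first.
    by rewrite /lev /= Nt => -[] /eqP; rewrite eqr_nat ltn_eqF.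
  rewrite (ind0 (A := gev N m.+1)) ?mul0e ?adde0//.
  by rewrite /gev /= Nt lee_fin ler_nat leqNgt ltnS ltnW.
- rewrite (ind1 (A := gev N m)); last by rewrite /gev /= Nt lee_fin ler_nat ltnW.
  rewrite (ind0 (A := lev N m)); last first.
    by rewrite /lev /= Nt => -[] /eqP; rewrite eqr_nat gtn_eqF.
  rewrite (ind1 (A := gev N m.+1)) ?mul0e ?add0e//.
  by rewrite /gev /= Nt lee_fin ler_nat.
- rewrite (ind1 (A := gev N m)); last by rewrite /gev /= Nt km.
  rewrite (ind1 (A := lev N m)); last by rewrite /lev /= Nt km.
  rewrite (ind0 (A := gev N m.+1)); last by rewrite /gev /= Nt km lee_fin ler_nat ltnn.
  by rewrite !mul1e mul0e adde0 Nt km -EFinM lapE.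
Qed.

(** Above level m the count is at least m + 1, hence a gain of exp (- c) over the weight exp (- c m)
    of level m. This gain is what lets c tend to infinity. *)
Lemma ind_gev_bound m c t : (0 < c)%N ->
  ind (gev N m.+1) t * lap (c%:R%:E * N t) <=
  (expR (- (c%:R * m%:R)) * expR (- c%:R))%:E.
Proof.
move=> c0; case: (NN t) => [Nt|[k Nt]].
  by rewrite Nt gt0_muley ?lte_fin ?ltr0n// lapy mule0 lee_fin mulr_ge0 ?expR_ge0.
have [mk|km] := ltnP m k; last first.
  rewrite (ind0 (A := gev N m.+1)) ?mul0e ?lee_fin ?mulr_ge0 ?expR_ge0//.
  by rewrite /gev /= Nt lee_fin ler_nat leqNgt ltnS km.
rewrite (ind1 (A := gev N m.+1)); last by rewrite /gev /= Nt lee_fin ler_nat.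
rewrite mul1e Nt -EFinM lapE lee_fin -expRD ler_expR -opprD lerN2.
by rewrite -!natrM -natrD ler_nat -mulnSr leq_mul2l mk orbT.
Qed.

Lemma nnmf_tail m c : nnmf (fun t => ind (gev N m) t * lap (c%:R%:E * N t)).
Proof.
apply: nnmfM; first by apply: nnmf_ind; exact: measurable_gev.
by apply: nnmf_lap; exact: measurable_funeM.
Qed.

Lemma tailpart_split m c : (0 < c)%N ->
  tailpart m c = (\int[mu]_t (W t * ind (lev N m) t)) * (expR (- (c%:R * m%:R)))%:E
    + tailpart m.+1 c.
Proof.
move=> c0; rewrite /tailpart.
have nl : nnmf (fun t => W t * ind (lev N m) t).
  by apply: nnmfM => //; apply: nnmf_ind; exact: measurable_lev.
have e0 : 0 <= (expR (- (c%:R * m%:R)))%:E :> \bar R by rewrite lee_fin expR_ge0.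
rewrite -nnmf_integralZr// -(ilD (integral_like_int mu)).
- apply: eq_integral => t _; rewrite ind_gev_split// ge0_muleDr ?muleA//.
    by rewrite mule_ge0// ind_ge0.
  by rewrite mule_ge0 ?ind_ge0 ?lap_ge0.
- by apply: nnmfM => //; exact: nnmf_cst.
- by apply: nnmfM => //; exact: nnmf_tail.
Qed.

Lemma tailpart_bound m c : (0 < c)%N ->
  tailpart m.+1 c <= (\int[mu]_t W t) * (expR (- (c%:R * m%:R)) * expR (- c%:R))%:E.
Proof.
move=> c0; rewrite -nnmf_integralZr//.
apply: (il_le (integral_like_int mu)).
- by apply: nnmfM => //; exact: nnmf_tail.
- by apply: nnmfM => //; apply: nnmf_cst; rewrite lee_fin mulr_ge0 ?expR_ge0.
- by move=> t; rewrite lee_wpmul2l ?ind_gev_bound//; case: nW.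
Qed.

Lemma tailpart_ge0 m c : 0 <= tailpart m c.
Proof. by apply: nnmf_integral_ge0; apply: nnmfM => //; exact: nnmf_tail. Qed.

End one_side.

Definition tailpart d (T : measurableType d) (mu : {measure set T -> \bar R})
  (W N : T -> \bar R) m (c : nat) :=
  \int[mu]_t (W t * (ind (gev N m) t * lap (c%:R%:E * N t))).

(** Dividing the tail from level m by exp (- c m) leaves the mass of level m plus an error of at
    most exp (- c) times the total mass, and c is arbitrary. *)
Lemma lev_le d (T : measurableType d) (mu : {measure set T -> \bar R})
    d' (T' : measurableType d') (mu' : {measure set T' -> \bar R})
    (W N : T -> \bar R) (W' N' : T' -> \bar R) m :
  nnmf W -> nnmf W' -> measurable_fun setT N -> measurable_fun setT N' ->
  (forall t, natlike (N t)) -> (forall t, natlike (N' t)) ->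
  \int[mu]_t W t < +oo -> \int[mu']_t W' t < +oo ->
  (forall c, (0 < c)%N -> tailpart mu W N m c = tailpart mu' W' N' m c) ->
  \int[mu]_t (W t * ind (lev N m) t) <= \int[mu']_t (W' t * ind (lev N' m) t).
Proof.
move=> nW nW' mN mN' NN NN' Woo W'oo eqt.
have K'fin : \int[mu']_t W' t \is a fin_num.
  by rewrite ge0_fin_numE//; exact: nnmf_integral_ge0.
apply: (@lee_expR_decay _ _ _ (fine (\int[mu']_t W' t))) => c c0.
have e0 : (0 < expR (- (c%:R * m%:R)) :> R)%R by rewrite expR_gt0.
rewrite -(@lee_pmul2r _ (expR (- (c%:R * m%:R)))%:E)//.
set q := \int[mu]_t _; set q' := \int[mu']_t (_ * _).
have q'0 : 0 <= q'.
  apply: nnmf_integral_ge0; apply: nnmfM => //; apply: nnmf_ind.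
  exact: measurable_lev.
have K0 : (0 <= fine (\int[mu']_t W' t))%R.
  by rewrite fine_ge0//; exact: nnmf_integral_ge0.
rewrite [leRHS](ge0_muleDl _ q'0); last by rewrite lee_fin mulr_ge0 ?expR_ge0.
apply: (@le_trans _ _ (tailpart mu W N m c)).
  by rewrite /tailpart tailpart_split// leeDl// tailpart_ge0.
rewrite eqt// /tailpart tailpart_split//; apply: leeD2l.
apply: (le_trans (tailpart_bound mu' nW' mN' NN' m c0)).
rewrite -[X in X * _ <= _](fineK K'fin) -!EFinM lee_fin.
by rewrite mulrCA [leRHS]mulrC [(fine _ * _)%R]mulrC.
Qed.

(** Induction on the level: equality of the tails from m for all c gives equal masses at m, and
    subtracting these finite masses gives equal tails from m + 1. The weights carry the other counts
    when the lemma is iterated. *)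
Lemma lev_eq d (T : measurableType d) (mu : {measure set T -> \bar R})
    d' (T' : measurableType d') (mu' : {measure set T' -> \bar R})
    (W N : T -> \bar R) (W' N' : T' -> \bar R) :
  nnmf W -> nnmf W' -> measurable_fun setT N -> measurable_fun setT N' ->
  (forall t, natlike (N t)) -> (forall t, natlike (N' t)) ->
  \int[mu]_t W t < +oo -> \int[mu']_t W' t < +oo ->
  (forall c, (0 < c)%N -> \int[mu]_t (W t * lap (c%:R%:E * N t)) =
                          \int[mu']_t (W' t * lap (c%:R%:E * N' t))) ->
  forall m, \int[mu]_t (W t * ind (lev N m) t) = \int[mu']_t (W' t * ind (lev N' m) t).
Proof.
move=> nW nW' mN mN' NN NN' Woo W'oo eqL.
suff H m : (forall c, (0 < c)%N -> tailpart mu W N m c = tailpart mu' W' N' m c) ->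
    \int[mu]_t (W t * ind (lev N m) t) = \int[mu']_t (W' t * ind (lev N' m) t).
  move=> m; apply: (H m); elim: m => [c c0|m IH c c0].
    rewrite /tailpart !gev0//.
    under eq_integral do rewrite ind1// mul1e.
    under [RHS]eq_integral do rewrite ind1// mul1e.
    exact: eqL.
  have := IH c c0; rewrite /tailpart (tailpart_split mu nW mN NN _ c0).
  rewrite (tailpart_split mu' nW' mN' NN' _ c0) (H _ IH).
  apply: adde_injl; rewrite fin_numM// ge0_fin_numE//; last first.
    by apply: nnmf_integral_ge0; apply: nnmfM => //; apply: nnmf_ind; exact: measurable_lev.
  apply: le_lt_trans W'oo; apply: (il_le (integral_like_int mu')) => //.
    by apply: nnmfM => //; apply: nnmf_ind; exact: measurable_lev.
  move=> t; rewrite -[leRHS]mule1 lee_wpmul2l ?ind_le1//; by case: nW'.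
move=> eqt; apply/eqP; rewrite eq_le; apply/andP; split.
  exact: lev_le.
by apply: lev_le => // c c0; rewrite eqt.
Qed.
End laplace_unique.

Section poisson_laplace.
Context {R : realType}.

Lemma integral_nat (mu : {measure set nat -> \bar R}) (f : nat -> \bar R) :
  (forall k, 0 <= f k) -> \int[mu]_k f k = \sum_(k <oo) f k * mu [set k].
Proof.
move=> f0; transitivity (\int[mu]_x \sum_(k <oo) (f k * ind [set k] x)).
  apply: eq_integral => x _; rewrite (@nneseriesD1 _ _ x) => [|k _|//]; last first.
    by rewrite mule_ge0 ?ind_ge0.
  rewrite ind1// mule1 eseries0 ?adde0// => k _ /= kx.
  by rewrite ind0 ?mule0// => /= xk; rewrite xk eqxx in kx.
rewrite integral_nneseries//; last by move=> k x _; rewrite mule_ge0 ?ind_ge0.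
apply: eq_eseriesr => k _; rewrite nnmf_integralZl//; last exact: nnmf_ind.
by rewrite integral_ind.
Qed.

(** For r > 0 this is the exponential series in r exp (- c); at r = 0 the law is the Dirac mass at 0
    and both sides are 1. *)
Lemma poisson_laplace (r : R) (c : R) : (0 <= r)%R -> (0 <= c)%R ->
  \int[poisson_prob r 0%N]_k lap (c%:E * k%:R%:E) = lap ((1 - expR (- c)) * r)%:E.
Proof.
move=> r0 c0; rewrite integral_nat; last by move=> k; exact: lap_ge0.
rewrite lapE; case: (ltgtP 0%R r) r0 => // [r0 _|<- _]; last first.
  rewrite mulr0 oppr0 expR0 (@nneseriesD1 _ _ 0%N) => [|k _|//]; last first.
    by rewrite mule_ge0 ?lap_ge0.
  rewrite mule0 lap0 mul1e eseries0 ?adde0; last first.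
    by move=> k _ /= k0; rewrite /= /poisson_prob ltxx diracE memNset ?mule0//= => k0'; rewrite -k0' eqxx in k0.
  by rewrite /= /poisson_prob ltxx diracE mem_set.
transitivity ((expR (- r))%:E * (expR (r * expR (- c)))%:E); last first.
  rewrite -EFinM -expRD; congr (expR _)%:E.
  by rewrite mulrBl mul1r opprB addrC mulrC.
have termE k : (expR (- (c * k%:R)) * (r ^+ k * k`!%:R^-1 * expR (- r)) =
    expR (- r) * ((r * expR (- c)) ^+ k * k`!%:R^-1))%R.
  by rewrite exprMn -mulNr expRM_natr; ring.
under eq_eseriesr.
  move=> k _; rewrite /= /poisson_prob r0 esum_set1 ?lee_fin ?poisson_pmf_ge0//.
  rewrite (_ : lap _ = (expR (- (c * k%:R)))%:E)// -EFinM /poisson_pmf r0.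
  rewrite termE EFinM; over.
rewrite /= nneseriesZl/=; last first.
  by move=> n _; rewrite lee_fin divr_ge0// exprn_ge0// mulr_ge0 ?expR_ge0// ltW.
congr *%E; move: (r * expR (- c))%R => q; rewrite expRE -EFin_lim; last first.
  rewrite /pseries/=; under eq_fun do rewrite mulrC.
  exact: is_cvg_series_exp_coeff.
apply/congr_lim/funext => n/=; rewrite /pseries/= /series/= -sumEFin//.
by apply: eq_bigr => i _; rewrite mulrC.
Qed.

End poisson_laplace.

(** * Laplace functionals of point processes *)

Section level_lists.
Context {R : realType} d (T : measurableType d) (mu : {measure set T -> \bar R}).

Definition lap_list (l : seq ((T -> \bar R) * nat)) t : \bar R :=
  \prod_(p <- l) lap (p.2%:R%:E * p.1 t).

Definition lev_list (l : seq ((T -> \bar R) * nat)) t : \bar R :=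
  \prod_(p <- l) ind (lev p.1 p.2) t.

Definition cntfun (N : T -> \bar R) :=
  measurable_fun setT N /\ forall t, natlike (N t).

Lemma nnmf_lap_list l :
  List.Forall (fun p => cntfun p.1) l -> nnmf (lap_list l).
Proof.
elim => [|p l' [mN _] _ IH]; rewrite /lap_list.
  rewrite [X in nnmf X](_ : _ = fun=> 1); first exact: nnmf_cst.
  by apply/funext => t; rewrite big_nil.
rewrite [X in nnmf X](_ : _ = fun t => lap (p.2%:R%:E * p.1 t) * lap_list l' t).
  by apply: nnmfM => //; apply: nnmf_lap; exact: measurable_funeM.
by apply/funext => t; rewrite big_cons.
Qed.

Lemma lap_list_le1 l t : List.Forall (fun p => cntfun p.1) l -> lap_list l t <= 1.
Proof.
elim => [|p l' [_ NN] _ IH]; rewrite /lap_list; first by rewrite big_nil.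
rewrite big_cons -[leRHS]mule1; apply: lee_pmul => //.
- exact: lap_ge0.
- by apply: prode_ge0 => i _; exact: lap_ge0.
- by apply: lap_le1; rewrite mule_ge0// natlike_ge0.
Qed.

Lemma nnmf_lev_list l :
  List.Forall (fun p => cntfun p.1) l -> nnmf (lev_list l).
Proof.
elim => [|p l' [mN _] _ IH]; rewrite /lev_list.
  rewrite [X in nnmf X](_ : _ = fun=> 1); first exact: nnmf_cst.
  by apply/funext => t; rewrite big_nil.
rewrite [X in nnmf X](_ : _ = fun t => ind (lev p.1 p.2) t * lev_list l' t).
  by apply: nnmfM => //; apply: nnmf_ind; exact: measurable_lev.
by apply/funext => t; rewrite big_cons.
Qed.

Lemma lev_list_le1 l t : lev_list l t <= 1.
Proof.
rewrite /lev_list; elim: l => [|p l IH]; first by rewrite big_nil.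
rewrite big_cons -[leRHS]mule1; apply: lee_pmul => //; [exact: ind_ge0| |exact: ind_le1].
by apply: prode_ge0 => i _; exact: ind_ge0.
Qed.

Definition lev_set (l : seq ((T -> \bar R) * nat)) : set T :=
  \big[setI/setT]_(p <- l) lev p.1 p.2.

Lemma ind_lev_set l t : ind (lev_set l) t = lev_list l t.
Proof.
rewrite /lev_set /lev_list; elim: l => [|p l IH]; first by rewrite !big_nil indT.
by rewrite !big_cons indI IH.
Qed.

Lemma lev_set_cat l1 l2 : lev_set (l1 ++ l2) = lev_set l1 `&` lev_set l2.
Proof. by rewrite /lev_set big_cat. Qed.

Lemma measurable_lev_set l :
  List.Forall (fun p => cntfun p.1) l -> measurable (lev_set l).
Proof.
elim => [|p l' [mN _] _ IH]; rewrite /lev_set ?big_nil// big_cons.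
by apply: measurableI => //; exact: measurable_lev.
Qed.

(** Transforms are converted into levels one count at a time: the remaining Laplace factors are
    absorbed into the weight for [lev_eq], and the level just obtained joins [W] and [W'] for the
    induction. *)
Lemma lev_list_eq (Ns : seq (T -> \bar R)) (W W' : T -> \bar R) :
  nnmf W -> nnmf W' -> \int[mu]_t W t < +oo -> \int[mu]_t W' t < +oo ->
  List.Forall cntfun Ns ->
  (forall l, map fst l = Ns -> all (fun p => 0 < p.2)%N l ->
    \int[mu]_t (W t * lap_list l t) = \int[mu]_t (W' t * lap_list l t)) ->
  forall l, map fst l = Ns ->
    \int[mu]_t (W t * lev_list l t) = \int[mu]_t (W' t * lev_list l t).
Proof.
move=> + + + + cNs; elim: cNs W W' => [|N Ns' [mN NN] cNs IH] W W' nW nW' Woo W'oo eqL l.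
  case: l => // _.
  have E (V : T -> \bar R) : \int[mu]_t (V t * lev_list [::] t) =
      \int[mu]_t (V t * lap_list [::] t).
    by apply: eq_integral => t _; rewrite /lap_list /lev_list !big_nil.
  by rewrite !E; exact: eqL.
case: l => // -[_ m] l [-> lNs].
have small (V h : T -> \bar R) : nnmf V -> \int[mu]_t V t < +oo -> nnmf h ->
    (forall t, h t <= 1) -> \int[mu]_t (V t * h t) < +oo.
  move=> nV Voo nh h1; apply: le_lt_trans Voo.
  apply: (il_le (integral_like_int mu)) => //; first exact: nnmfM.
  by move=> t; rewrite -[leRHS]mule1 lee_wpmul2l//; case: nV.
have nlev : nnmf (ind (lev N m) : T -> \bar R).
  by apply: nnmf_ind; exact: measurable_lev.
have key (V : T -> \bar R) : \int[mu]_t (V t * lev_list ((N, m) :: l) t) =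
    \int[mu]_t (V t * ind (lev N m) t * lev_list l t).
  by apply: eq_integral => t _; rewrite /lev_list big_cons muleA.
rewrite !key; apply: IH => //; [exact: nnmfM|exact: nnmfM| | |].
- by apply: small => // t; exact: ind_le1.
- by apply: small => // t; exact: ind_le1.
- move=> l' l'Ns l'0.
  have cl' : List.Forall (fun p => cntfun p.1) l'.
    by apply/List.Forall_map; rewrite -[List.map _ _]/(map fst l') l'Ns.
  have nl' := nnmf_lap_list cl'.
  have l'1 t := lap_list_le1 t cl'.
  under eq_integral do rewrite muleAC.
  under [RHS]eq_integral do rewrite muleAC.
  apply: lev_eq => //; [exact: nnmfM|exact: nnmfM|exact: small|exact: small|].
  move=> c c0; have := eqL ((N, c) :: l'); rewrite /= l'Ns c0 l'0 => /(_ erefl isT).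
  rewrite /lap_list; under eq_integral do rewrite big_cons muleCA muleC.
  move=> ->; by apply: eq_integral => t _; rewrite big_cons muleCA muleC.
Qed.

End level_lists.

(** * Independence and laws of the counts of a point process *)

Section point_process.
Context {R : realType} d (T : measurableType d) (P : probability T R).
Context dS (S : measurableType dS) (xi : nat -> T -> S).
Hypothesis mxi : forall k, measurable_fun setT (xi k).

Definition psum (f : S -> \bar R) (t : T) : \bar R := \sum_(k <oo) f (xi k t).

Definition cnt (U : set S) : T -> \bar R := psum (ind U).

(** Summation over the points is integration against a sum of Dirac masses, which transfers the
    properties of integrals to [psum]. *)
Lemma psum_measure f t : nnmf f ->
  psum f t = \int[mseries (fun k => dirac (xi k t)) 0]_x f x.
Proof.
move=> [mf f0]; rewrite ge0_integral_measure_series//.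
by apply: eq_eseriesr => k _; rewrite integral_dirac// diracT mul1e.
Qed.

Lemma psum_il t : integral_like (fun f => psum f t).
Proof.
have iL := integral_like_int (mseries (fun k => dirac (xi k t)) 0 : {measure set S -> \bar R}).
split.
- by move=> f nf; rewrite psum_measure//; exact: (il_ge0 iL).
- by move=> f g nf ng fg; rewrite !psum_measure//; exact: (il_le iL).
- by move=> f g nf ng; rewrite !psum_measure//; [exact: (ilD iL)|exact: nnmfD].
- move=> c f c0 nf; rewrite !psum_measure//; first exact: (ilZ iL).
  by apply: nnmfM => //; exact: nnmf_cst.
- move=> f nf ndf; rewrite psum_measure; last exact: nnmf_lim.
  rewrite (il_lim iL)//; congr (limn _); apply/funext => n /=.
  by rewrite psum_measure.
Qed.

Lemma kop_psum : kernel_op psum.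
Proof.
split; last exact: psum_il.
move=> f [mf f0]; apply: ge0_emeasurable_sum => [k t _ _|k _]; first exact: f0.
exact: measurableT_comp.
Qed.

Lemma nnmf_psum f : nnmf f -> nnmf (psum f).
Proof. by move=> nf; exact: (kop_nnmf kop_psum). Qed.

(** The tails of a convergent series of zeros and ones are eventually below 1, hence contain no term
    1. *)
Lemma cnt_tail U t : cnt U t < +oo -> exists N, forall k, (N <= k)%N -> ~ U (xi k t).
Proof.
move=> foo; have i0 k : 0 <= ind U (xi k t) :> \bar R by exact: ind_ge0.
have := nneseries_tail_cvg foo (fun k _ => i0 k).
move=> /(_ _ (open_ereal_lt' lte01)) [N _ /(_ N (leqnn N))] /= N1.
exists N => k Nk Uk; have : (ind U (xi k t) : \bar R) < 1.
  apply: le_lt_trans N1; rewrite (nneseries_split _ (k - N).+1)//.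
  rewrite addnS subnKC// big_nat_recr//=.
  apply: le_trans (leeDl _ _); last exact: nneseries_ge0.
  by rewrite leeDr// sume_ge0.
by rewrite ind1// ltxx.
Qed.

Lemma natlike_cnt U t : natlike (cnt U t).
Proof.
have [->|] := eqVneq (cnt U t) +oo; [by left|right].
have [N hN] : exists N, forall k, (N <= k)%N -> ~ U (xi k t) by apply: cnt_tail; rewrite ltey.
have i0 k : 0 <= ind U (xi k t) :> \bar R by exact: ind_ge0.
exists (\sum_(0 <= k < N) (xi k t \in U))%N.
rewrite /cnt /psum (nneseries_split 0%N N)// add0n [X in _ + X]eseries0; last first.
  by move=> k Nk _; rewrite ind0//; exact: hN.
by rewrite adde0 natr_sum -sumEFin; apply: eq_bigr => k _; rewrite indE.
Qed.

Lemma cntfun_cnt U : measurable U -> cntfun (cnt U).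
Proof.
move=> mU; split => [|t]; last exact: natlike_cnt.
by apply: kop_meas; [exact: kop_psum|exact: nnmf_ind].
Qed.

Variables (L : (S -> \bar R) -> \bar R) (X0 : set S).
Hypothesis iL : integral_like L.

(* L is the intensity of the point process restricted to the region X0. *)
Definition laplace_functional := forall f : S -> R,
  measurable_fun setT f -> (forall x, 0 <= f x)%R -> (forall x, ~ X0 x -> f x = 0%R) ->
  \int[P]_t lap (psum (fun x => (f x)%:E) t) = lap (L (fun x => (1 - expR (- f x))%:E)).

Hypothesis LF : laplace_functional.

Let reg (A : set S) (p : set S * nat) := measurable p.1 /\ p.1 `<=` A.

Definition cnts (l : seq (set S * nat)) := [seq (cnt p.1, p.2) | p <- l].

(** The step function at which the Laplace functional becomes the joint transform of the counts in
    [l]. *)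
Let wgt (l : seq (set S * nat)) (x : S) : R :=
  (\sum_(p <- l) p.2%:R * \1_(p.1) x)%R.

Let wgt_measurable A l : List.Forall (reg A) l -> measurable_fun setT (wgt l).
Proof.
elim => [|p l' [mp _] _ IH]; rewrite /wgt.
  rewrite [X in measurable_fun _ X](_ : _ = fun=> 0%R)//.
  by apply/funext => x; rewrite big_nil.
rewrite [X in measurable_fun _ X](_ : _ = fun x => (p.2%:R * \1_(p.1) x + wgt l' x)%R).
  by apply: measurable_funD => //; exact: measurable_funM.
by apply/funext => x; rewrite big_cons.
Qed.

Let wgt_ge0 l x : (0 <= wgt l x)%R.
Proof. by apply: sumr_ge0 => p _; rewrite mulr_ge0// indicE. Qed.

Let wgt_out A l x : List.Forall (reg A) l -> ~ A x -> wgt l x = 0%R.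
Proof.
move=> + nAx; elim => [|p l' [_ pA] _ IH]; rewrite /wgt ?big_nil// big_cons.
by rewrite indicE memNset ?mulr0 ?add0r// => /pA.
Qed.

Let lap_list_psum A l t : List.Forall (reg A) l ->
  lap_list (cnts l) t = lap (psum (fun x => (wgt l x)%:E) t).
Proof.
elim => [|p l' [mp pA] rl IH].
  rewrite /lap_list big_nil /psum eseries0 ?lap0// => k _ _.
  by rewrite /wgt big_nil.
rewrite /lap_list /= big_cons -/(lap_list (cnts l') t) IH.
rewrite -lapD; last 2 first.
- by rewrite mule_ge0//; apply: nneseries_ge0 => k _ _; exact: ind_ge0.
- by apply: nneseries_ge0 => k _ _; rewrite lee_fin.
have nw : nnmf (fun x => (wgt l' x)%:E).
  by apply: nnmf_EFin => //; exact: wgt_measurable rl.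
congr lap; rewrite -(ilZ (psum_il t))//; last exact: nnmf_ind.
rewrite -(ilD (psum_il t))//; last first.
  by apply: nnmfM; [exact: nnmf_cst|exact: nnmf_ind].
by apply: eq_eseriesr => k _; rewrite /wgt big_cons EFinD EFinM.
Qed.

Let cnts_cntfun A l : List.Forall (reg A) l -> List.Forall (fun p => cntfun p.1) (cnts l).
Proof.
by elim => [|p l' [mp pA] _ IH]; constructor => //=; exact: cntfun_cnt.
Qed.

Let nnmf_1expR (f : S -> R) : measurable_fun setT f -> (forall x, 0 <= f x)%R ->
  nnmf (fun x => (1 - expR (- f x))%:E).
Proof.
move=> mf f0; apply: nnmf_EFin => [|x].
  apply: measurable_funB => //; apply: measurableT_comp => //.
  exact: measurableT_comp.
by rewrite subr_ge0 -expR0 ler_expR oppr_le0.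
Qed.

(** For functions f and g with disjoint supports, 1 - exp (- (f + g)) is the sum of 1 - exp (- f)
    and 1 - exp (- g), so additivity of [L] factorises the functional. *)
Let lap_list_indep R1 R2 l1 l2 : R1 `<=` X0 -> R2 `<=` X0 -> R1 `&` R2 = set0 ->
  List.Forall (reg R1) l1 -> List.Forall (reg R2) l2 ->
  \int[P]_t (lap_list (cnts l1) t * lap_list (cnts l2) t) =
  (\int[P]_t lap_list (cnts l1) t) * (\int[P]_t lap_list (cnts l2) t).
Proof.
move=> R1X R2X R12 r1 r2.
have mw1 := wgt_measurable r1; have mw2 := wgt_measurable r2.
under eq_integral do rewrite (lap_list_psum _ r1) (lap_list_psum _ r2).
under [X in _ = X * _]eq_integral do rewrite (lap_list_psum _ r1).
under [X in _ = _ * X]eq_integral do rewrite (lap_list_psum _ r2).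
rewrite [X in _ = X * _]LF//; last by move=> x /(contra_not (R1X x)); exact: wgt_out.
rewrite [X in _ = _ * X]LF//; last by move=> x /(contra_not (R2X x)); exact: wgt_out.
have n1 := nnmf_EFin mw1 (wgt_ge0 l1); have n2 := nnmf_EFin mw2 (wgt_ge0 l2).
rewrite -lapD; [|exact/(il_ge0 iL)/nnmf_1expR..].
rewrite -(ilD iL); [|exact: nnmf_1expR..].
have -> : (fun x => (1 - expR (- wgt l1 x))%:E + (1 - expR (- wgt l2 x))%:E) =
    (fun x => (1 - expR (- (wgt l1 x + wgt l2 x)))%:E).
  apply/funext => x; rewrite -EFinD; congr EFin.
  have [x1|x1] := pselect (R1 x).
    rewrite (wgt_out r2) ?oppr0 ?addr0 ?expR0 ?subrr ?addr0// => x2.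
    by have : (R1 `&` R2) x by []; rewrite R12.
  by rewrite (wgt_out r1)// oppr0 expR0 subrr !add0r.
rewrite -LF.
- apply: eq_integral => t _; rewrite -lapD.
  + by congr lap; rewrite -(ilD (psum_il t)).
  + by case: (nnmf_psum n1).
  + by case: (nnmf_psum n2).
- exact: measurable_funD.
- by move=> x; rewrite addr_ge0.
- move=> x nx; rewrite (wgt_out r1) ?(wgt_out r2) ?addr0//.
  + by move=> /R2X.
  + by move=> /R1X.
Qed.

Let cnts_lift A l1 : List.Forall (reg A) l1 ->
  forall l : seq ((T -> \bar R) * nat),
  map fst l = [seq p.1 | p <- cnts l1] ->
  exists2 l', List.Forall (reg A) l' & l = cnts l'.
Proof.
elim => [|[U m] l1' rU _ IH] [|[N k] l]//=; first by exists [::].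
move=> [-> /IH [l' rl' ->]]; exists ((U, k) :: l') => //.
by constructor.
Qed.

(** The factorisation of transforms becomes one of levels in two rounds, first for [l1] with a
    transform over [R2] as weight, then for [l2] with the levels of [l1] as weight. The product of
    expectations enters as a constant weight. *)
Let lev_list_indep R1 R2 l1 l2 : R1 `<=` X0 -> R2 `<=` X0 -> R1 `&` R2 = set0 ->
  List.Forall (reg R1) l1 -> List.Forall (reg R2) l2 ->
  \int[P]_t (lev_list (cnts l1) t * lev_list (cnts l2) t) =
  (\int[P]_t lev_list (cnts l1) t) * (\int[P]_t lev_list (cnts l2) t).
Proof.
move=> R1X R2X R12 r1 r2.
have nl A l : List.Forall (reg A) l -> nnmf (lap_list (cnts l)).
  by move=> rl; apply: nnmf_lap_list; exact: cnts_cntfun rl.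
have nv A l : List.Forall (reg A) l -> nnmf (lev_list (cnts l)).
  by move=> rl; apply: nnmf_lev_list; exact: cnts_cntfun rl.
have oo (f : T -> \bar R) : nnmf f -> (forall t, f t <= 1) -> \int[P]_t f t < +oo.
  move=> nf f1; apply: (@le_lt_trans _ _ (\int[P]_t (fun=> 1) t)).
    by apply: (il_le (integral_like_int P)) => //; exact: nnmf_cst.
  by rewrite integral_prob_cst ltry.
have cF A l : List.Forall (reg A) l -> List.Forall (@cntfun R d T) [seq p.1 | p <- cnts l].
  by move=> rl; apply/List.Forall_map; exact: cnts_cntfun rl.
have step1 l : List.Forall (reg R2) l ->
    \int[P]_t (lap_list (cnts l) t * lev_list (cnts l1) t) =
    \int[P]_t ((\int[P]_t lap_list (cnts l) t) * lev_list (cnts l1) t).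
  move=> rl; have ll1 t : lap_list (cnts l) t <= 1.
    by apply: lap_list_le1; exact: cnts_cntfun rl.
  have l0 : 0 <= \int[P]_t lap_list (cnts l) t.
    by apply: nnmf_integral_ge0; exact: nl rl.
  apply: (@lev_list_eq _ _ _ _ [seq p.1 | p <- cnts l1]).
  - exact: nl rl.
  - exact: nnmf_cst.
  - by apply: oo => //; exact: nl rl.
  - rewrite integral_prob_cst; apply: oo => //; exact: nl rl.
  - exact: cF r1.
  - move=> l' /(cnts_lift r1)[l'' rl'' ->] _.
    rewrite nnmf_integralZl//; last exact: nl rl''.
    by rewrite -(lap_list_indep _ _ _ rl rl'')// setIC.
  - by [].
have v0 : 0 <= \int[P]_t lev_list (cnts l1) t.
  by apply: nnmf_integral_ge0; exact: nv r1.
rewrite -(nnmf_integralZl P (nv _ _ r2) v0).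
have v1 t : lev_list (cnts l1) t <= 1 by exact: lev_list_le1.
apply: (@lev_list_eq _ _ _ _ [seq p.1 | p <- cnts l2]).
- exact: nv r1.
- exact: nnmf_cst.
- by apply: oo => //; exact: nv r1.
- rewrite integral_prob_cst; apply: oo => //; exact: nv r1.
- exact: cF r2.
- move=> l' /(cnts_lift r2)[l'' rl'' ->] _.
  under eq_integral do rewrite muleC.
  rewrite step1// (nnmf_integralZl P (nv _ _ r1) (nnmf_integral_ge0 P (nl _ _ rl''))).
  by rewrite (nnmf_integralZl P (nl _ _ rl'') v0) muleC.
- by [].
Qed.

(** Lists keep the class closed under intersection, since concatenating them intersects the
    events. *)
Definition cnt_pi (A : set S) : set (set T) :=
  [set E | exists2 l, List.Forall (reg A) l & E = lev_set (cnts l)].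

Definition cnt_sigma (A : set S) := <<s cnt_pi A >>.

Lemma cnt_pi_measurable A : cnt_pi A `<=` measurable.
Proof.
move=> _ [l rl ->]; apply: measurable_lev_set; exact: cnts_cntfun rl.
Qed.

Lemma cnt_pi_setI A : setI_closed (cnt_pi A).
Proof.
move=> _ _ [l1 r1 ->] [l2 r2 ->]; exists (l1 ++ l2).
  by apply/List.Forall_app.
by rewrite /cnts map_cat lev_set_cat.
Qed.

Lemma cnt_sigma_measurable A : cnt_sigma A `<=` measurable.
Proof.
apply: smallest_sub; first exact: sigma_algebra_measurable.
exact: cnt_pi_measurable.
Qed.

Lemma cnt_sigma_sub A B : A `<=` B -> cnt_sigma A `<=` cnt_sigma B.
Proof.
move=> AB; apply: sub_smallest2r; first exact: smallest_sigma_algebra.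
move=> _ [l rl ->]; exists l => //.
by elim: rl => [|p l' [mp pA] _ IH]; constructor => //; split => //; exact: subset_trans AB.
Qed.

Lemma cnt_sigma_lev A U m : measurable U -> U `<=` A -> cnt_sigma A (lev (cnt U) m).
Proof.
move=> mU UA; apply: sub_sigma_algebra; exists [:: (U, m)].
  by constructor => //; constructor.
by rewrite /lev_set /= big_seq1.
Qed.

(** Dynkin's argument is applied to each of the two sigma-algebras in turn, starting from lists of
    levels. *)
Theorem cnt_sigma_indep R1 R2 E1 E2 : R1 `<=` X0 -> R2 `<=` X0 -> R1 `&` R2 = set0 ->
  cnt_sigma R1 E1 -> cnt_sigma R2 E2 -> P (E1 `&` E2) = P E1 * P E2.
Proof.
move=> R1X R2X R12 sE1 sE2.
have gen (B : set T) A : measurable B ->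
    (forall E, cnt_pi A E -> P (E `&` B) = P E * P B) ->
    forall E, cnt_sigma A E -> P (E `&` B) = P E * P B.
  move=> mB h E sE; have mE := cnt_sigma_measurable sE.
  have nB : nnmf (ind B : T -> \bar R) by exact: nnmf_ind.
  pose L1 (f : T -> \bar R) := \int[P]_t (ind B t * f t).
  pose L2 (f : T -> \bar R) := \int[P]_t (P B * f t).
  have L1E F : measurable F -> L1 (ind F) = P (F `&` B).
    move=> mF; rewrite -integral_ind//; last exact: measurableI.
    by apply: eq_integral => t _; rewrite setIC indI.
  have L2E F : measurable F -> L2 (ind F) = P F * P B.
    move=> mF; rewrite /L2 nnmf_integralZl//; last exact: nnmf_ind.
    by rewrite integral_ind// muleC.
  rewrite -L1E// -L2E//; apply: (integral_like_sigma _ _ (@cnt_pi_measurable A) (@cnt_pi_setI A)) => //.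
  - exact: (integral_like_kop (integral_like_int P) (kop_mul nB)).
  - by apply: (integral_like_kop (integral_like_int P) (kop_mul _)); exact: nnmf_cst.
  - by move=> F pF; have mF := cnt_pi_measurable pF; rewrite L1E// L2E// h.
  - by rewrite -(@indT R) L1E// L2E// setTI probability_setT mul1e.
  - by rewrite -(@indT R) L1E// setTI; exact: (le_lt_trans (probability_le1 P mB) (ltry _)).
apply: (gen _ R1) => //; first exact: cnt_sigma_measurable sE2.
move=> F1 pF1; have mF1 := cnt_pi_measurable pF1.
rewrite setIC muleC; apply: (gen _ R2) => //.
case: pF1 => l1 r1 -> F2 [l2 r2 ->].
have m1 := measurable_lev_set (cnts_cntfun r1).
have m2 := measurable_lev_set (cnts_cntfun r2).
rewrite -!integral_ind//; last exact: measurableI.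
under eq_integral do rewrite indI !ind_lev_set muleC.
rewrite (lev_list_indep R1X R2X R12 r1 r2) muleC.
by congr (_ * _); apply: eq_integral => t _; rewrite ind_lev_set.
Qed.

Lemma cnt_laplace U (c : R) : measurable U -> U `<=` X0 -> (0 <= c)%R ->
  \int[P]_t lap (c%:E * cnt U t) = lap ((1 - expR (- c))%:E * L (ind U)).
Proof.
move=> mU UX c0; have nU : nnmf (ind U : S -> \bar R) by exact: nnmf_ind.
have c1 : (0 <= 1 - expR (- c))%R by rewrite subr_ge0 -expR0 ler_expR oppr_le0.
rewrite -(ilZ iL)//.
rewrite (_ : (fun x => _) = fun x => (1 - expR (- (c * \1_U x)))%:E); last first.
  apply/funext => x; rewrite indE indicE; case: (x \in U).
    by rewrite mule1 mulr1.
  by rewrite mule0 mulr0 oppr0 expR0 subrr.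
rewrite -LF; last 3 first.
- by apply: measurable_funM.
- by move=> x; rewrite mulr_ge0// indicE.
- by move=> x Xx; rewrite indicE memNset ?mulr0// => /UX.
by apply: eq_integral => t _; rewrite -(ilZ (psum_il t)).
Qed.

Lemma cnt_poisson U m : measurable U -> U `<=` X0 -> L (ind U) < +oo ->
  P (lev (cnt U) m) = poisson_prob (fine (L (ind U))) 0%N [set m].
Proof.
move=> mU UX Loo; have [mN NN] := cntfun_cnt mU.
have L0 : 0 <= L (ind U) by apply: (il_ge0 iL); exact: nnmf_ind.
pose r := fine (L (ind U)); have r0 : (0 <= r)%R by exact: fine_ge0.
have rE : L (ind U) = r%:E by rewrite fineK// ge0_fin_numE.
pose N' (k : nat) : \bar R := k%:R%:E.
have mN' : measurable_fun setT N' by [].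
have NN' k : natlike (N' k) by right; exists k.
have nlev (k : nat) : nnmf (ind (lev (cnt U) k) : T -> \bar R).
  by apply: nnmf_ind; exact: measurable_lev.
have -> : P (lev (cnt U) m) = \int[P]_t (1 * ind (lev (cnt U) m) t).
  by rewrite nnmf_integralZl// mul1e integral_ind//; exact: measurable_lev.
have -> : poisson_prob r 0%N [set m] =
    \int[poisson_prob r 0%N]_k (1 * ind (lev N' m) k).
  rewrite nnmf_integralZl//; last exact: nnmf_ind.
  rewrite mul1e integral_ind//=; congr (poisson_prob _ _ _); apply/seteqP; split => k /=.
    by move=> ->.
  by rewrite /lev /= /N' => -[] /eqP; rewrite eqr_nat => /eqP.
apply: (@lev_eq R _ _ P _ _ (poisson_prob r 0%N) (fun=> 1) (cnt U) (fun=> 1) N'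
  (nnmf_cst _ lee01) (nnmf_cst _ lee01) mN mN' NN NN').
- by rewrite integral_prob_cst ltry.
- by rewrite integral_prob_cst ltry.
- move=> c c0; under eq_integral do rewrite mul1e.
  under [RHS]eq_integral do rewrite mul1e.
  by rewrite cnt_laplace// poisson_laplace// rE.
Qed.

(** The transform at c = 1 is 0, and it bounds exp (- m) times the probability of each finite level
    m. *)
Lemma cnt_infinite U : measurable U -> U `<=` X0 -> L (ind U) = +oo ->
  P [set t | cnt U t = +oo] = 1.
Proof.
move=> mU UX Loo; have [mN NN] := cntfun_cnt mU.
have lev0 m : P (lev (cnt U) m) = 0.
  apply/eqP; rewrite eq_le measure_ge0 andbT.
  have e0 : (0 < expR (- m%:R) :> R)%R by exact: expR_gt0.
  rewrite -(@lee_pmul2l _ (expR (- m%:R))%:E)// mule0.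
  have nl : nnmf (ind (lev (cnt U) m) : T -> \bar R).
    by apply: nnmf_ind; exact: measurable_lev.
  rewrite -integral_ind; last exact: measurable_lev.
  have e0' : 0 <= (expR (- m%:R))%:E :> \bar R by rewrite lee_fin ltW.
  rewrite -(nnmf_integralZl P nl e0').
  have := cnt_laplace mU UX ler01; rewrite Loo gt0_muley; last first.
    by rewrite lte_fin subr_gt0 -expR0 ltr_expR oppr_lt0.
  rewrite lapy => h; rewrite -[leRHS]h; apply: (il_le (integral_like_int P)).
  - by apply: nnmfM => //; exact: nnmf_cst.
  - by apply: nnmf_lap; exact: measurable_funeM.
  - move=> t; have [lt|lt] := pselect (lev (cnt U) m t).
      by rewrite ind1// mule1 lt mul1e lapE.
    by rewrite ind0// mule0 lap_ge0.
have -> : [set t | cnt U t = +oo] = ~` \bigcup_m lev (cnt U) m.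
  apply/seteqP; split => t /=; first by move=> ct [m _]; rewrite /lev /= ct.
  by case: (NN t) => [//|[m ct] nt]; exfalso; apply: nt; exists m.
have mB : measurable (\bigcup_m lev (cnt U) m).
  by apply: bigcupT_measurable => m; exact: measurable_lev.
rewrite probability_setC//.
have -> : P (\bigcup_m lev (cnt U) m) = 0.
  apply/(negligibleP _ mB)/negligible_bigcup => m.
  by apply/negligibleP; [exact: measurable_lev|exact: lev0].
by rewrite sube0.
Qed.

(** Induction on the list: the intersection of the remaining events belongs to the union of the
    remaining regions, which is disjoint from the first one. *)
Lemma cnt_sigma_mutual (I : eqType) (s : seq I) (R_ E : I -> _) : uniq s ->
  (forall i, R_ i `<=` X0) -> (forall i j, i != j -> R_ i `&` R_ j = set0) ->
  (forall i, cnt_sigma (R_ i) (E i)) ->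
  P (\big[setI/setT]_(i <- s) E i) = \prod_(i <- s) P (E i).
Proof.
move=> + RX Rd sE.
suff : uniq s -> cnt_sigma (\bigcup_(i in [set` s]) R_ i) (\big[setI/setT]_(i <- s) E i) /\
    P (\big[setI/setT]_(i <- s) E i) = \prod_(i <- s) P (E i).
  by move=> + us => /(_ us)[].
elim: s => [_|i s IH /= /andP[is_ us]].
  by rewrite !big_nil probability_setT; split => //; exact: gsigmaT.
have [sEs PE] := IH us; rewrite !big_cons; split.
  apply: gsigmaI.
    by apply: cnt_sigma_sub (sE i) => x Rx; exists i => //=; rewrite inE eqxx.
  by apply: cnt_sigma_sub sEs => x [j /= js Rx]; exists j => //=; rewrite inE js orbT.
rewrite (cnt_sigma_indep (RX i) _ _ (sE i) sEs) ?PE//.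
  by apply: bigcup_sub => j _; exact: RX.
rewrite setI_bigcupr bigcup0// => j /= js; apply: Rd.
by apply: contraNneq is_ => ->.
Qed.

End point_process.

Section independent_products.
Context {R : realType} d (T : measurableType d) (P : probability T R).
Context dS (S : measurableType dS).

Lemma prod_upd (phi : nat -> S -> \bar R) (g : nat -> S) q k f : (k < q)%N ->
  \prod_(i < q) upd phi k f i (g i) =
  (\prod_(i < q | val i != k) phi i (g i)) * f (g k).
Proof.
move=> kq; rewrite (bigD1 (Ordinal kq))//= {1}/upd eqxx muleC; congr (_ * _).
by apply: eq_big => [i|i]; rewrite -val_eqE//= => ik; rewrite /upd (negbTE ik).
Qed.

Lemma prod_loc (phi psi : nat -> S -> \bar R) q (g : nat -> S) :
  (forall i, (i < q)%N -> phi i = psi i) ->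
  \prod_(i < q) phi i (g i) = \prod_(i < q) psi i (g i).
Proof. by move=> h; apply: eq_bigr => i _; rewrite h. Qed.

Lemma prod_unit (I : Type) (s : seq I) (p : pred I) (f : I -> \bar R) :
  (forall i, 0 <= f i <= 1) -> \prod_(i <- s | p i) f i <= 1.
Proof.
move=> f01; elim: s => [|i s IH]; first by rewrite big_nil.
rewrite big_cons; case: (p i) => //.
have /andP[fi0 fi1] := f01 i.
rewrite -[leRHS]mule1; apply: lee_pmul => //.
by apply: prode_ge0 => j _; case/andP: (f01 j).
Qed.

Lemma unit_fun_prob_lty (f : T -> \bar R) : unit_fun f -> \int[P]_t f t < +oo.
Proof.
move=> [nf f1]; apply: (@le_lt_trans _ _ (\int[P]_t (fun=> 1) t)).
  by apply: (il_le (integral_like_int P)) => //; exact: nnmf_cst.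
by rewrite integral_prob_cst ltry.
Qed.

Lemma unit_fun_prod q (phi : nat -> S -> \bar R) (g : nat -> T -> S) :
  (forall i, measurable_fun setT (g i)) -> (forall i, unit_fun (phi i)) ->
  unit_fun (fun t => \prod_(i < q) phi i (g i t)).
Proof.
move=> mg u; split.
  by apply: nnmf_prod => i; apply: nnmf_comp => //; case: (u i).
by move=> t; apply: prod_unit => i; case: (u i) => -[_ -> ->].
Qed.

Lemma ind_bigsetI (I : Type) (s : seq I) (p : pred I) (A : I -> set T) t :
  ind (\big[setI/setT]_(i <- s | p i) A i) t = \prod_(i <- s | p i) ind (A i) t :> \bar R.
Proof.
elim: s => [|i s IH]; first by rewrite !big_nil indT.
by rewrite !big_cons; case: (p i) => //; rewrite indI IH.
Qed.

Lemma indep_prod q (g : nat -> T -> S) : (forall i, measurable_fun setT (g i)) ->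
  (forall A : nat -> set S, (forall i, measurable (A i)) ->
    P (\big[setI/setT]_(i < q) (g i @^-1` A i)) = \prod_(i < q) P (g i @^-1` A i)) ->
  forall phi : nat -> S -> \bar R, (forall i, unit_fun (phi i)) ->
  \int[P]_t \prod_(i < q) phi i (g i t) = \prod_(i < q) \int[P]_t phi i (g i t).
Proof.
move=> mg ind_g phi uphi.
have mgA i A : measurable A -> measurable (g i @^-1` A).
  by move=> mA; rewrite -[X in measurable X]setTI; exact: mg.
apply: (@multilinear_unique R _ S q measurable
  (fun phi => \int[P]_t \prod_(i < q) phi i (g i t))
  (fun phi => \prod_(i < q) \int[P]_t phi i (g i t))) => //.
- by rewrite sigma_algebra_id//; exact: sigma_algebra_measurable.
- by move=> A B; exact: measurableI.
- move=> {uphi}phi k kq uphi.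
  have -> : (fun f => \int[P]_t \prod_(i < q) upd phi k f i (g i t)) =
      (fun f => \int[P]_t ((\prod_(i < q | val i != k) phi i (g i t)) * f (g k t))).
    by apply/funext => f; apply: eq_integral => t _; exact: (prod_upd _ (g^~ t)).
  apply: (integral_like_kop (integral_like_int P)
    (K := fun f t => (\prod_(i < q | val i != k) phi i (g i t)) * f (g k t))).
  apply: (kop_comp (kop_mul _) (kop_pull (mg k))).
  by apply: nnmf_prod => i; apply: nnmf_comp => //; case: (uphi i).
- move=> {uphi}phi k kq uphi.
  have -> : (fun f => \prod_(i < q) \int[P]_t upd phi k f i (g i t)) =
      (fun f => (\prod_(i < q | val i != k) \int[P]_t phi i (g i t)) *
        \int[P]_t f (g k t)).
    apply/funext => f.
    rewrite (bigD1 (Ordinal kq))//= {1}/upd eqxx muleC; congr (_ * _).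
    by apply: eq_big => [i|i]; rewrite -val_eqE//= => ik; rewrite /upd (negbTE ik).
  set c := \prod_(i < q | _) _.
  have c0 : 0 <= c.
    apply: prode_ge0 => i _; apply: nnmf_integral_ge0.
    by apply: nnmf_comp => //; case: (uphi i).
  apply: integral_like_scale => //.
  exact: (integral_like_kop (integral_like_int P) (kop_pull (mg k))).
- move=> psi upsi; apply: unit_fun_prob_lty; exact: (unit_fun_prod q mg upsi).
- by move=> psi psi' h; apply: eq_integral => t _; exact: (prod_loc (g^~ t)).
- by move=> psi psi' h; apply: eq_bigr => i _; rewrite h.
- move=> A mA; transitivity (P (\big[setI/setT]_(i < q) (g i @^-1` A i))).
    rewrite -integral_ind; last by apply: bigsetI_measurable => i _; exact: mgA.
    apply: eq_integral => t _.
    by rewrite ind_bigsetI.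
  rewrite ind_g//; apply: eq_bigr => i _; rewrite -integral_ind//; exact: mgA.
Qed.

End independent_products.

Section lap_limits.
Context {R : realType}.

(** Continuity along a monotone sequence follows from order alone, since [lap] reverses the order
    and maps onto [0, +oo]. *)
Lemma lap_cvg (x : (\bar R)^nat) : nondecreasing_seq x ->
  (fun n => lap (x n)) @ \oo --> lap (limn x).
Proof.
move=> ndx; have cx := ereal_nondecreasing_is_cvgn ndx.
have nil : nonincreasing_seq (fun n => lap (x n)).
  by move=> m n mn; rewrite le_lap; exact: ndx.
have cl := ereal_nonincreasing_is_cvgn nil.
suff <- : limn (fun n => lap (x n)) = lap (limn x) by exact: cl.
have xlim n : x n <= limn x.
  by apply: lime_ge => //; exists n => // m /= nm; exact: ndx.
apply/eqP; rewrite eq_le; apply/andP; split; last first.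
  by apply: lime_ge => //; apply: nearW => n; rewrite le_lap.
set c := limn (fun n => lap (x n)).
have c0 : 0 <= c by apply: lime_ge => //; apply: nearW => n; exact: lap_ge0.
have [y yc] := expeR_total c0.
rewrite -yc (_ : expeR y = lap (- y)); last by rewrite /lap oppeK.
rewrite le_lap; apply: lime_le => //; apply: nearW => n.
rewrite -le_lap /lap oppeK yc; apply: lime_le => //.
by exists n => // m /= nm; exact: nil.
Qed.

Lemma unit_fun_cvg d (T : measurableType d) (P : probability T R)
    (f : nat -> T -> \bar R) (g : T -> \bar R) :
  (forall n, unit_fun (f n)) -> (forall t, f ^~ t @ \oo --> g t) ->
  (fun n => \int[P]_t f n t) @ \oo --> \int[P]_t g t.
Proof.
move=> uf fg; apply: (@dominated_cvg _ _ _ P setT measurableT f g (fun=> 1)) => //.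
- by move=> n; case: (uf n) => -[].
- apply/integrableP; split; first exact: measurable_cst.
  by under eq_integral do rewrite gee0_abs//; rewrite integral_prob_cst ltry.
- by move=> n t _; case: (uf n) => -[_ f0] f1; rewrite gee0_abs.
Qed.

End lap_limits.

(** * Laplace functional of a Poisson random measure *)

Section laplace_of_PRM.
Context {R : realType} d (T : measurableType d) (P : probability T R).

Lemma natlike_lap_sum (N : T -> \bar R) (y : R) t : (0 < y)%R -> natlike (N t) ->
  lap (y%:E * N t) = \sum_(m <oo) lap (y%:E * m%:R%:E) * ind (lev N m) t.
Proof.
move=> y0 [Nt|[m Nt]].
  rewrite Nt gt0_muley ?lte_fin// lapy eseries0// => m _ _.
  by rewrite ind0 ?mule0// /lev /= Nt.
rewrite (@nneseriesD1 _ _ m) => [|k _|//]; last by rewrite mule_ge0 ?lap_ge0 ?ind_ge0.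
rewrite ind1// mule1 eseries0 ?adde0 ?Nt// => k _ /= km.
by rewrite ind0 ?mule0// /lev /= Nt => -[] /eqP; rewrite eqr_nat eq_sym (negbTE km).
Qed.

Lemma integral_natlike_lap (N : T -> \bar R) (y : R) : (0 < y)%R -> cntfun N ->
  \int[P]_t lap (y%:E * N t) = \sum_(m <oo) lap (y%:E * m%:R%:E) * P (lev N m).
Proof.
move=> y0 [mN NN]; under eq_integral do rewrite natlike_lap_sum//.
have nl m : nnmf (fun t => lap (y%:E * m%:R%:E) * ind (lev N m) t).
  apply: nnmfM; first by apply: nnmf_cst; exact: lap_ge0.
  by apply: nnmf_ind; exact: measurable_lev.
rewrite integral_nneseries//; last 2 first.
- by move=> m; case: (nl m).
- by move=> m t _; case: (nl m).
apply: eq_eseriesr => m _; rewrite nnmf_integralZl ?integral_ind ?lap_ge0//.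
- exact: measurable_lev.
- by apply: nnmf_ind; exact: measurable_lev.
Qed.

Context dS (S : measurableType dS) (xi : nat -> T -> S).
Hypothesis mxi : forall k, measurable_fun setT (xi k).
Variables (N : T -> set S -> \bar R) (nu : set S -> \bar R) (X0 : set S).
Variable L : (S -> \bar R) -> \bar R.
Hypotheses (iL : integral_like L) (mX0 : measurable X0).
Hypothesis NE : forall t B, measurable B -> N t B = cnt xi (B `&` X0) t.
Hypothesis nuE : forall B, measurable B -> nu B = L (ind (B `&` X0)).
Hypothesis prmN : is_PRM P N nu.

Let cN B : measurable B -> cntfun (N ^~ B).
Proof.
move=> mB; rewrite (_ : N ^~ B = cnt xi (B `&` X0)).
  by apply: cntfun_cnt => //; exact: measurableI.
by apply/funext => t; exact: NE.
Qed.

Let N_laplace B (y : R) : measurable B -> (0 <= y)%R ->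
  \int[P]_t lap (y%:E * N t B) = lap ((1 - expR (- y))%:E * nu B).
Proof.
move=> mB; rewrite le_eqVlt => /predU1P[<-|y0].
  under eq_integral do rewrite mul0e lap0.
  by rewrite integral_prob_cst oppr0 expR0 subrr mul0e lap0.
have [_ Npois Ninf _] := prmN.
have nu0 : 0 <= nu B by rewrite nuE//; apply: (il_ge0 iL); apply: nnmf_ind; exact: measurableI.
have e1 : (0 < 1 - expR (- y))%R by rewrite subr_gt0 -expR0 ltr_expR oppr_lt0.
rewrite (integral_natlike_lap y0 (cN mB)).
have [nuoo|nufin] := eqVneq (nu B) +oo.
  rewrite nuoo gt0_muley ?lte_fin// lapy eseries0// => m _ _.
  rewrite (_ : P _ = 0) ?mule0//; apply/eqP; rewrite eq_le measure_ge0 andbT.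
  have moo : measurable [set t | N t B = +oo].
    by have [mN _] := cN mB; rewrite -[X in measurable X]setTI; exact: (mN measurableT [set +oo]).
  have <- : P (~` [set t | N t B = +oo]) = 0 by rewrite probability_setC// Ninf// subee.
  apply: le_measure; rewrite ?inE; [|exact: measurableC|].
    by apply: measurable_lev; case: (cN mB).
  by move=> t; rewrite /lev /= => ->.
have nulty : nu B < +oo by rewrite ltey.
have r0 : (0 <= fine (nu B))%R by exact: fine_ge0.
rewrite -[in RHS](@fineK _ (nu B)) ?ge0_fin_numE// -EFinM -poisson_laplace//; last exact: ltW.
rewrite integral_nat; last by move=> k; exact: lap_ge0.
by apply: eq_eseriesr => m _; congr (_ * _); exact: Npois.
Qed.

Let simple_laplace (h : {nnsfun S >-> R}) : (forall x, ~ X0 x -> h x = 0%R) ->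
  \int[P]_t lap (psum xi (fun x => (h x)%:E) t) =
  lap (L (fun x => (1 - expR (- h x))%:E)).
Proof.
move=> h0; pose s : seq R := finmap.enum_fset (fset_set (range h)); pose q := size s.
pose y i := (s`_i)%R; pose B i := h @^-1` [set y i].
have mB i : measurable (B i) by exact: measurable_funPTI.
have y0 i : (0 <= y i)%R.
  have [iq|qi] := ltnP i q; last by rewrite /y nth_default.
  have : y i \in s by exact: mem_nth.
  by rewrite in_fset_set// inE => -[x _ <-].
have hE x : (h x)%:E = \sum_(i < q) (y i)%:E * ind (B i) x.
  rewrite fimfunEord -sumEFin; apply: eq_bigr => i _.
  by rewrite EFinM.
(* Where h is nonzero its level sets lie in [X0], so [N] counts them in full. The level set of 0 may
   stick out, but has coefficient 0. *)
have BX i : y i != 0%R -> B i `&` X0 = B i.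
  move=> yi0; apply/setIidl => x; rewrite /B /= => hx; apply: contrapT => /h0 hx0.
  by move: yi0; rewrite -hx hx0 eqxx.
have nB i : nnmf (fun x => (y i)%:E * ind (B i) x).
  by apply: nnmfM; [apply: nnmf_cst; rewrite lee_fin|exact: nnmf_ind].
have psumE t : psum xi (fun x => (h x)%:E) t = \sum_(i < q) (y i)%:E * N t (B i).
  rewrite (_ : (fun x => _) = fun x => \sum_(i < q) (y i)%:E * ind (B i) x); last first.
    by apply/funext => x; rewrite hE.
  rewrite (il_sum _ _ (psum_il xi t))//; apply: eq_bigr => i _.
  rewrite (ilZ (psum_il xi t))//; last exact: nnmf_ind.
  have [->|yi0] := eqVneq (y i) 0%R; first by rewrite !mul0e.
  by rewrite NE// BX.
have N0 t i : 0 <= N t (B i) by exact: (natlike_ge0 (proj2 (cN (mB i))) t).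
(* The absolute value makes the tested functions bounded by 1 on all of the extended reals; counts
   are nonnegative, so it changes no value. *)
transitivity (\int[P]_t \prod_(i < q) lap ((y i)%:E * `|N t (B i)|)).
  apply: eq_integral => t _; rewrite psumE lap_sum; last by move=> i; rewrite mule_ge0 ?lee_fin.
  by apply: eq_bigr => i _; rewrite gee0_abs.
rewrite (@indep_prod R _ T P _ (\bar R) q (fun i t => N t (B i)) _ _
  (fun i v => lap ((y i)%:E * `|v|))).
- transitivity (lap (\sum_(i < q) (1 - expR (- y i))%:E * nu (B i))).
    rewrite lap_sum; last first.
      move=> i; rewrite mule_ge0 ?lee_fin ?subr_ge0 -?expR0 ?ler_expR ?oppr_le0//.
      by rewrite nuE//; apply: (il_ge0 iL); apply: nnmf_ind; exact: measurableI.
    apply: eq_bigr => i _; rewrite -N_laplace//; apply: eq_integral => t _.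
    by rewrite gee0_abs.
  congr lap; have e0 i : (0 <= 1 - expR (- y i))%R.
    by rewrite subr_ge0 -expR0 ler_expR oppr_le0.
  have nBX i : nnmf (ind (B i `&` X0) : S -> \bar R) by apply: nnmf_ind; exact: measurableI.
  under eq_bigr do rewrite nuE// -(ilZ iL)//.
  rewrite -(il_sum _ _ iL); last first.
    by move=> i; apply: nnmfM => //; apply: nnmf_cst; rewrite lee_fin.
  congr L; apply/funext => x.
  have hs : h x \in s by rewrite in_fset_set// inE; exists x.
  pose i0 := Ordinal (etrans (index_mem (h x) s) hs : (index (h x) s < q)%N).
  have yi0 : y i0 = h x by rewrite /y nth_index.
  rewrite (bigD1 i0)//= big1 => [|i ii0].
    rewrite adde0 yi0; have [hx0|hx0] := eqVneq (h x) 0%R.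
      by rewrite hx0 oppr0 expR0 subrr mul0e.
    by rewrite BX ?yi0// ind1 ?mule1// /B /= yi0.
  rewrite ind0 ?mule0// => -[]; rewrite /B /= => hyi _; move/eqP: ii0; apply.
  apply/val_inj => /=; rewrite hyi /y index_uniq//.
  exact: finmap.fset_uniq.
- by move=> i; case: (cN (mB i)).
- move=> A mA; have [_ _ _ indN] := prmN.
  have := indN q (fun j => B j) (fun j => mB j).
  have tB : trivIset [set: 'I_q] (fun j => B j).
    move=> i j _ _ [x []]; rewrite /B /= => -> /eqP yij; apply/val_inj/eqP => /=.
    by move: yij; rewrite /y nth_uniq//; exact: finmap.fset_uniq.
  move=> /(_ tB (fun i => (N ^~ (B i)) @^-1` A i)) => h1.
  rewrite -bigcap_seq.
  rewrite (_ : \bigcap_(i in _) _ = \bigcap_(i : 'I_q) ((N ^~ (B i)) @^-1` A i)); last first.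
    apply/seteqP; split => t ht i _; apply: ht => //=.
    by rewrite mem_index_enum.
  rewrite h1; last by move=> i; exists (A i) => //; rewrite setTI.
  rewrite -prodEFin; apply: eq_bigr => i _; rewrite fineK//.
  apply: fin_num_measure; have [mN _] := cN (mB i).
  by rewrite -[X in measurable X]setTI; exact: mN.
- move=> i; split.
    apply: nnmf_lap; apply: measurable_funeM; exact: abse_measurable.
  by move=> v; apply: lap_le1; rewrite mule_ge0 ?lee_fin.
Qed.

(** Both sides pass to the limit along simple functions increasing to f, the left one by dominated
    convergence, the right one by monotone convergence inside [L]. *)
Lemma laplace_of_PRM : laplace_functional P xi L X0.
Proof.
move=> f mf f0 fX0.
have nf := nnmf_EFin mf f0.
pose a := nnsfun_approx measurableT (proj1 nf).
have aE x : (f x)%:E = limn (fun n => (a n x)%:E).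
  by apply/esym/cvg_lim => //; apply: cvg_nnsfun_approx => // y _; rewrite lee_fin.
have na n : nnmf (fun x => (a n x)%:E).
  by split; [apply/measurable_EFinP; exact: measurable_funPT|move=> x; rewrite lee_fin].
have nda x : nondecreasing_seq (fun n => a n x).
  by move=> m n mn; exact/(lefP _ _ (nd_nnsfun_approx _ _ mn)).
have ndaE x : nondecreasing_seq (fun n => (a n x)%:E).
  by move=> m n mn; rewrite lee_fin; exact: nda.
(* The approximations lie below f and are nonnegative, so they inherit its zeros and stay supported
   in [X0]. *)
have a0 n x : ~ X0 x -> a n x = 0%R.
  move=> /fX0 fx0; apply/eqP; rewrite eq_le; apply/andP; split => //.
  rewrite -lee_fin -fx0 aE; apply: lime_ge; first exact: ereal_nondecreasing_is_cvgn.
  by exists n => // m /= nm; exact: ndaE.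
have ndp t : nondecreasing_seq (fun n => psum xi (fun x => (a n x)%:E) t).
  by move=> m n mn; apply: (il_le (psum_il xi t)) => // x; exact: ndaE.
transitivity (limn (fun n => \int[P]_t lap (psum xi (fun x => (a n x)%:E) t))).
  apply/esym/cvg_lim => //; apply: (unit_fun_cvg (f := fun n t => lap (psum xi (fun x => (a n x)%:E) t))).
    move=> n; split; first by apply: nnmf_lap; exact: (kop_meas (kop_psum mxi)).
    by move=> t; apply: lap_le1; exact: (il_ge0 (psum_il xi t)).
  move=> t; rewrite (_ : (fun x => (f x)%:E) = fun x => limn (fun n => (a n x)%:E)); last exact/funext.
  rewrite (il_lim (psum_il xi t))//; apply: lap_cvg; exact: ndp.
rewrite (_ : (fun n => _) = fun n => lap (L (fun x => (1 - expR (- a n x))%:E))); last first.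
  by apply/funext => n; apply: simple_laplace => x; exact: a0.
have n1 n : nnmf (fun x => (1 - expR (- a n x))%:E).
  apply: nnmf_EFin => [|x].
    apply: measurable_funB => //; apply: measurableT_comp => //.
    exact: measurableT_comp.
  by rewrite subr_ge0 -expR0 ler_expR oppr_le0.
have nd1 x : nondecreasing_seq (fun n => (1 - expR (- a n x))%:E).
  by move=> m n mn; rewrite lee_fin lerD2l lerN2 ler_expR lerN2; exact: nda.
apply/cvg_lim => //.
rewrite (_ : (fun x => (1 - expR (- f x))%:E) = fun x => limn (fun n => (1 - expR (- a n x))%:E)).
  rewrite (il_lim iL)//; apply: lap_cvg => m n mn.
  by apply: (il_le iL) => // x; exact: nd1.
apply/funext => x; apply/esym/cvg_lim => //.
rewrite (_ : (1 - expR (- f x))%:E = 1 - lap (limn (fun n => (a n x)%:E))); last by rewrite -aE.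
rewrite (_ : (fun n => (1 - expR (- a n x))%:E) = (fun n => 1 - lap (a n x)%:E))//.
apply: cvgeB => //; first exact: cvg_cst.
exact: lap_cvg.
Qed.

End laplace_of_PRM.

Lemma ind_congr {R : realType} d d' (S : measurableType d) (S' : measurableType d')
    (A : set S) (B : set S') x y :
  (A x <-> B y) -> ind A x = ind B y :> \bar R.
Proof.
move=> [AB BA]; have [Ax|Ax] := pselect (A x); first by rewrite !ind1//; exact: AB.
by rewrite !ind0// => /BA.
Qed.

(** As [setT] is in both classes, cylinders over one factor are generated first, and a rectangle is
    the intersection of two cylinders. *)
Lemma measurable_prod_rects d1 d2 (X1 : measurableType d1) (X2 : measurableType d2)
    (G1 : set (set X1)) (G2 : set (set X2)) :
  measurable = <<s G1 >> -> G1 setT -> measurable = <<s G2 >> -> G2 setT ->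
  measurable = <<s [set A `*` B | A in G1 & B in G2] >>.
Proof.
move=> E1 T1 E2 T2; set rect := [set _ `*` _ | _ in G1 & _ in G2].
have h1 (A : set X1) : measurable A -> <<s rect >> (A `*` setT).
  rewrite E1; suff : <<s G1 >> `<=` [set A | <<s rect >> (A `*` setT)] by exact.
  apply: smallest_sub => [|C GC]; last by apply: sub_sigma_algebra; exists C => //; exists setT.
  split => [|C hC|F hF]; rewrite /=.
  - by rewrite set0X; exact: sigma_algebra0.
  - rewrite setTD (_ : ~` C `*` setT = ~` (C `*` setT)); first exact: gsigmaC.
    by apply/seteqP; split => -[a b] /= h; [move=> [/h.1]|split => // Ca; exact: h].
  - by rewrite setX_bigcupl; exact: sigma_algebra_bigcup.
have h2 (B : set X2) : measurable B -> <<s rect >> (setT `*` B).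
  rewrite E2; suff : <<s G2 >> `<=` [set B | <<s rect >> (setT `*` B)] by exact.
  apply: smallest_sub => [|C GC]; last by apply: sub_sigma_algebra; exists setT => //; exists C.
  split => [|C hC|F hF]; rewrite /=.
  - by rewrite setX0; exact: sigma_algebra0.
  - rewrite setTD (_ : setT `*` ~` C = ~` (setT `*` C)); first exact: gsigmaC.
    by apply/seteqP; split => -[a b] /= h; [move=> [_]; exact: h.2|split => // Cb; exact: h].
  - by rewrite setX_bigcupr; exact: sigma_algebra_bigcup.
have gm1 A : G1 A -> measurable A by move=> GA; rewrite E1; exact: sub_sigma_algebra.
have gm2 A : G2 A -> measurable A by move=> GA; rewrite E2; exact: sub_sigma_algebra.
apply/seteqP; split.
  rewrite measurable_prod_measurableType.
  apply: smallest_sub; first exact: smallest_sigma_algebra.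
  move=> _ [A mA [B mB <-]].
  rewrite -[A `*` B](_ : (A `*` setT) `&` (setT `*` B) = _); last first.
    by apply/seteqP; split => -[a b] /=; [move=> [[? _] [_ ?]]|move=> [? ?]].
  by apply: gsigmaI; [exact: h1|exact: h2].
apply: smallest_sub; first exact: sigma_algebra_measurable.
by move=> _ [A GA [B GB <-]]; apply: measurableX; [exact: gm1|exact: gm2].
Qed.

Lemma prod_rectsI (X1 X2 : Type) (G1 : set (set X1)) (G2 : set (set X2)) :
  setI_closed G1 -> setI_closed G2 -> setI_closed [set A `*` B | A in G1 & B in G2].
Proof.
move=> I1 I2 _ _ [A GA [B GB <-]] [A' GA' [B' GB' <-]].
exists (A `&` A'); first exact: I1.
by exists (B `&` B'); [exact: I2|rewrite setXI].
Qed.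

Lemma ind_prod {R : realType} d1 d2 (X1 : measurableType d1) (X2 : measurableType d2)
    (A : set X1) (B : set X2) p : ind (A `*` B) p = ind A p.1 * ind B p.2 :> \bar R.
Proof.
have [a|a] := pselect (A p.1); last by rewrite (ind0 a) mul0e ind0// => -[].
by rewrite (ind1 a) mul1e; apply: ind_congr; split => [[]|].
Qed.

(** * Marking *)

Section marking.
Context {R : realType} d (T : measurableType d) (P : probability T R).
Context dX (X : measurableType dX) dY (Y : measurableType dY).
Variables (x : nat -> T -> X) (y : nat -> T -> Y) (k : R.-pker X ~> Y).
Hypotheses (mx : forall i, measurable_fun setT (x i))
  (my : forall i, measurable_fun setT (y i)).

Definition mark_hat (f : X * Y -> \bar R) (a : X) : \bar R := \int[k a]_b f (a, b).

Lemma kop_hat : kernel_op mark_hat.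
Proof. exact: (kop_ker2 k (h := fun p : X * Y => p) (@measurable_id _ _ _)). Qed.

Lemma unit_fun_hat f : unit_fun f -> unit_fun (mark_hat f).
Proof.
move=> [nf f1]; split; first exact: kop_nnmf kop_hat nf.
move=> a; have /= := il_le (kop_il kop_hat a) nf (nnmf_cst _ lee01) f1.
by rewrite /mark_hat integral_cst// mul1e prob_kernel.
Qed.

Definition marked i t := (x i t, y i t).

Lemma measurable_marked i : measurable_fun setT (marked i).
Proof. exact: measurable_fun_pair. Qed.

Variable G : set (set Y).
Hypotheses (GE : measurable = <<s G >>) (GI : setI_closed G) (GT : G setT).

Hypothesis marks : forall r (A : nat -> set X) (B : nat -> set Y),
  (forall i, measurable (A i)) -> (forall i, G (B i)) ->
  P (\big[setI/setT]_(i < r) ((x i @^-1` A i) `&` (y i @^-1` B i))) =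
  \int[P]_t \prod_(i < r) (ind (A i) (x i t) * k (x i t) (B i)).

Let rect : set (set (X * Y)) := [set A `*` B | A in measurable & B in G].

Let GM B : G B -> measurable B.
Proof. by move=> GB; rewrite GE; exact: sub_sigma_algebra. Qed.

Let rectE : measurable = <<s rect >>.
Proof.
apply: measurable_prod_rects => //.
by rewrite sigma_algebra_id//; exact: sigma_algebra_measurable.
Qed.

Let rectI : setI_closed rect.
Proof. by apply: prod_rectsI => //; exact: measurableI. Qed.

(** On rectangles this is the hypothesis [marks]; multilinearity extends it to arbitrary factors. *)
Lemma marking_prod r (phi : nat -> X * Y -> \bar R) : (forall i, unit_fun (phi i)) ->
  \int[P]_t \prod_(i < r) phi i (marked i t) =
  \int[P]_t \prod_(i < r) mark_hat (phi i) (x i t).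
Proof.
move=> uphi.
apply: (@multilinear_unique R _ _ r rect
  (fun phi => \int[P]_t \prod_(i < r) phi i (marked i t))
  (fun phi => \int[P]_t \prod_(i < r) mark_hat (phi i) (x i t))) => //.
- by exists setT => //; exists setT => //; rewrite setXTT.
- move=> {uphi}phi j jr uphi.
  have -> : (fun f => \int[P]_t \prod_(i < r) upd phi j f i (marked i t)) =
      (fun f => \int[P]_t ((\prod_(i < r | val i != j) phi i (marked i t)) * f (marked j t))).
    by apply/funext => f; apply: eq_integral => t _; exact: (prod_upd _ (marked^~ t)).
  apply: (integral_like_kop (integral_like_int P)
    (K := fun f t => (\prod_(i < r | val i != j) phi i (marked i t)) * f (marked j t))).
  apply: (kop_comp (kop_mul _) (kop_pull (measurable_marked j))).
  apply: nnmf_prod => i; apply: nnmf_comp; first exact: measurable_marked.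
  by case: (uphi i).
- move=> {uphi}phi j jr uphi.
  have -> : (fun f => \int[P]_t \prod_(i < r) mark_hat (upd phi j f i) (x i t)) =
      (fun f => \int[P]_t ((\prod_(i < r | val i != j) mark_hat (phi i) (x i t)) *
        mark_hat f (x j t))).
    apply/funext => f; apply: eq_integral => t _.
    rewrite -(prod_upd (fun i => mark_hat (phi i)) (x^~ t) _ jr).
    by apply: eq_bigr => i _; rewrite /upd; case: ifP.
  apply: (integral_like_kop (integral_like_int P)
    (K := fun f t => (\prod_(i < r | val i != j) mark_hat (phi i) (x i t)) * mark_hat f (x j t))).
  apply: (kop_comp (kop_mul _) (kop_comp (kop_pull (mx j)) kop_hat)).
  apply: nnmf_prod => i; apply: nnmf_comp => //.
  by case: (unit_fun_hat (uphi i)).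
- move=> psi upsi; apply: unit_fun_prob_lty.
  exact: (unit_fun_prod r measurable_marked upsi).
- by move=> psi psi' h; apply: eq_integral => t _; exact: (prod_loc (marked^~ t)).
- by move=> psi psi' h; apply: eq_integral => t _; apply: eq_bigr => i _; rewrite h.
- move=> C hC.
  have /choice[AB hAB] : forall i, exists AB : set X * set Y,
      [/\ measurable AB.1, G AB.2 & C i = AB.1 `*` AB.2].
    by move=> i; have [A mA [B GB <-]] := hC i; exists (A, B).
  have mA i : measurable (AB i).1 by case: (hAB i).
  have GB i : G (AB i).2 by case: (hAB i).
  have CE i : C i = (AB i).1 `*` (AB i).2 by case: (hAB i).
  have := marks r mA GB; rewrite -integral_ind; last first.
    apply: bigsetI_measurable => i _; apply: measurableI.
      by rewrite -[X in measurable X]setTI; exact: mx.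
    by rewrite -[X in measurable X]setTI; apply: my => //; exact: GM.
  move=> h; transitivity (\int[P]_t \prod_(i < r) (ind (AB i).1 (x i t) * k (x i t) (AB i).2)).
    rewrite -h; apply: eq_integral => t _; rewrite ind_bigsetI.
    by apply: eq_bigr => i _; rewrite CE !indE; congr (_%:R%:E); apply/idP/idP; rewrite !inE.
  apply: eq_integral => t _; apply: eq_bigr => i _.
  rewrite /mark_hat -integral_ind; last exact: GM.
  rewrite -nnmf_integralZl ?ind_ge0//; last by apply: nnmf_ind; exact: GM.
  apply: eq_integral => b _; rewrite CE.
  have [a1|a1] := pselect ((AB i).1 (x i t)); last by rewrite (ind0 a1) mul0e ind0// => -[].
  rewrite (ind1 a1) mul1e.
  have [b1|b1] := pselect ((AB i).2 b); first by rewrite !ind1.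
  by rewrite !ind0// => -[].
Qed.

Variables (L0 : (X -> \bar R) -> \bar R) (X0 : set X).
Hypothesis LF0 : laplace_functional P x L0 X0.

Let lap_psum_cvg dS (S : measurableType dS) (xi : nat -> T -> S) (f : S -> R) t :
  (forall z, 0 <= f z)%R ->
  (fun r => \prod_(i < r) lap (f (xi i t))%:E) @ \oo --> lap (psum xi (fun z => (f z)%:E) t).
Proof.
move=> f0; rewrite /psum.
rewrite (_ : (fun r => _) = fun r => lap (\sum_(0 <= i < r) (f (xi i t))%:E)); last first.
  by apply/funext => r; rewrite big_mkord lap_sum// => i; rewrite lee_fin.
apply: lap_cvg; apply/ereal_nondecreasing_series => n _ _; by rewrite lee_fin.
Qed.

(** Positivity keeps the logarithm in [laplace_marked] finite: exp (- f) is positive everywhere and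
    the kernel has mass 1. *)
Let hat_lap_gt0 (f : X * Y -> R) a : measurable_fun setT f -> (forall z, 0 <= f z)%R ->
  0 < mark_hat (fun z => lap (f z)%:E) a.
Proof.
move=> mf f0.
have nl : nnmf (fun b => lap (f (a, b))%:E).
  by apply: nnmf_lap; apply/measurable_EFinP; apply: measurableT_comp => //; exact: pair1_measurable.
rewrite lt_neqAle nnmf_integral_ge0// andbT eq_sym; apply/eqP => h0.
have : (k a).-negligible setT.
  have := ae_eq_integral_abs (k a) measurableT (proj1 nl).
  move=> [+ _]; under eq_integral do rewrite gee0_abs ?lap_ge0//.
  move=> /(_ h0)[N [mN N0 sN]]; exists N; split => // b _; apply: sN => /= /(_ I).
  by rewrite lapE => /eqP; rewrite eqe expR_eq0.
move/(negligibleP (k a) measurableT) => kT0; have := @prob_kernel _ _ _ _ _ k a.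
by rewrite [LHS]kT0 => /esym/eqP; rewrite onee_eq0.
Qed.

(** Integrating out the marks turns f into g with exp (- g a) = \int exp (- f (a, b)) k a (db).
    Finite products over the indices agree, dominated convergence passes to all points, and 1 - exp
    (- g) is the average of 1 - exp (- f) over the mark. *)
Lemma laplace_marked :
  laplace_functional P marked (fun f => L0 (mark_hat f)) (X0 `*` setT).
Proof.
move=> f mf f0 fX0.
have ul : unit_fun (fun z => lap (f z)%:E).
  split; first by apply: nnmf_lap; exact/measurable_EFinP.
  by move=> z; apply: lap_le1; rewrite lee_fin.
have [[mh h0] h1] := unit_fun_hat ul.
pose g a : R := (- ln (fine (mark_hat (fun z => lap (f z)%:E) a)))%R.
have hfin a : mark_hat (fun z => lap (f z)%:E) a \is a fin_num.
  by rewrite ge0_fin_numE// (le_lt_trans (h1 a))// ltry.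
have hgt0 a : (0 < fine (mark_hat (fun z => lap (f z)%:E) a))%R.
  by rewrite fine_gt0// hat_lap_gt0//= (le_lt_trans (h1 a))// ltry.
have lapg a : lap (g a)%:E = mark_hat (fun z => lap (f z)%:E) a.
  by rewrite lapE /g opprK lnK ?fineK// posrE.
have g0 a : (0 <= g a)%R.
  rewrite /g oppr_ge0 ln_le0// -lee_fin fineK//; exact: h1.
have mg : measurable_fun setT g.
  apply: measurableT_comp => //; apply: measurableT_comp => //.
  exact: measurableT_comp.
have gX0 a : ~ X0 a -> g a = 0%R.
  move=> Xa; rewrite /g (_ : mark_hat _ a = 1) ?ln1 ?oppr0//.
  rewrite /mark_hat -[RHS](@prob_kernel _ _ _ _ _ k a) -[RHS]mul1e -integral_cst//.
  apply: eq_integral => b _; rewrite fX0 ?lap0//.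
  by move=> -[].
transitivity (\int[P]_t lap (psum x (fun a => (g a)%:E) t)).
  have c1 := unit_fun_cvg (P := P) (f := fun r t => \prod_(i < r) lap (f (marked i t))%:E)
    (fun r => unit_fun_prod r measurable_marked (fun=> ul)) (fun t => @lap_psum_cvg _ _ marked f t f0).
  have ug : unit_fun (fun a => lap (g a)%:E).
    split; first by apply: nnmf_lap; exact/measurable_EFinP.
    by move=> z; apply: lap_le1; rewrite lee_fin.
  have c2 := unit_fun_cvg (P := P) (f := fun r t => \prod_(i < r) lap (g (x i t))%:E)
    (fun r => unit_fun_prod r mx (fun=> ug)) (fun t => @lap_psum_cvg _ _ x g t g0).
  apply: etrans (esym (cvg_lim (@ereal_hausdorff R) c1)) _.
  apply: etrans _ (cvg_lim (@ereal_hausdorff R) c2); congr (limn _); apply/funext => r.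
  rewrite (marking_prod r (phi := fun=> fun z => lap (f z)%:E))//.
  by apply: eq_integral => t _; apply: eq_bigr => i _; rewrite lapg.
rewrite LF0//; congr (lap (L0 _)); apply/funext => a.
rewrite EFinB -[(expR _)%:E]/(lap (g a)%:E) lapg.
have n1 : nnmf (fun b => (1 - expR (- f (a, b)))%:E).
  apply: nnmf_EFin => [|b].
    apply: measurable_funB => //; apply: measurableT_comp => //.
    by apply: measurableT_comp => //; apply: measurableT_comp => //; exact: pair1_measurable.
  by rewrite subr_ge0 -expR0 ler_expR oppr_le0.
have nl : nnmf (fun b => lap (f (a, b))%:E).
  by apply: nnmf_lap; apply/measurable_EFinP; apply: measurableT_comp => //; exact: pair1_measurable.
apply/eqP; rewrite sube_eq//; last first.
  by apply: ge0_adde_def; rewrite inE; exact: nnmf_integral_ge0.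
rewrite -(ilD (integral_like_int (k a)))//.
rewrite (_ : (fun b => _) = fun=> 1); first by rewrite integral_cst// mul1e prob_kernel.
by apply/funext => b; rewrite lapE -EFinD subrK.
Qed.

End marking.

(** * Borel vectors and second countable spaces *)

Section borel_vectors.
Context {R : realType} {n : nat}.

Lemma measurable_coord j :
  measurable_fun [set: vec R n] (fun v : vec R n => (v : 'rV[R]_n) ord0 j).
Proof.
apply: (measurability _ (RGenOInfty.measurableE R)) => _ [_ [x ->] <-].
rewrite setTI; apply: sub_sigma_algebra.
apply: (@open_comp 'rV[R]_n R (fun M : 'rV[R]_n => M ord0 j)).
  by move=> M _; exact: coord_continuous.
exact: interval_open.
Qed.

Let near_rat (x e : R) : (0 < e)%R -> exists q : rat, (`|ratr q - x| < e)%R.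
Proof.
move=> e0; have /rat_in_itvoo[q] : (x - e < x + e)%R.
  by rewrite ltrBlDr -addrA ltrDl addr_gt0.
by rewrite in_itv /= => qxe; exists q; rewrite ltr_distl.
Qed.

(** Every open set is a countable union of boxes with rational centres and radii 1 / (k + 1), and
    the preimage of a box involves the coordinates only. *)
Lemma measurable_vec d (T : measurableType d) (f : T -> vec R n) :
  (forall j, measurable_fun setT (fun t => (f t : 'rV[R]_n) ord0 j)) ->
  measurable_fun setT f.
Proof.
move=> mf; apply: (@measurability _ _ T (vec R n) setT f (@open 'rV[R]_n)) => // _ [U oU <-]; rewrite setTI.
pose bq (p : 'rV[rat]_n * nat) : set 'rV[R]_n :=
  [set v | forall j, (`|ratr (p.1 ord0 j) - v ord0 j| < p.2.+1%:R^-1)%R].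
have mb p : measurable (f @^-1` bq p).
  rewrite (_ : _ @^-1` _ = \bigcap_(j in [set: 'I_n])
    ((fun t => `|ratr (p.1 ord0 j) - (f t : 'rV[R]_n) ord0 j|%R) @^-1` `]-oo, (p.2.+1%:R^-1)%R[)); last first.
    by apply/seteqP; split => t /= h j; have := h j; rewrite /= in_itv//=; apply.
  apply: fin_bigcap_measurable => // j _.
  rewrite -[X in measurable X]setTI.
  have mg : measurable_fun setT (fun t => `|ratr (p.1 ord0 j) - (f t : 'rV[R]_n) ord0 j|%R).
    by apply: measurableT_comp => //; exact: measurable_funB.
  exact: mg.
have -> : f @^-1` U = \bigcup_(p : 'rV[rat]_n * nat)
    (if `[< bq p `<=` U >] then f @^-1` bq p else set0).
  apply/seteqP; split => t /=; last first.
    by move=> [p _]; case: asboolP => // bU; exact: bU.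
  move=> Uft; have /nbhs_ballP[e /= e0 eU] : nbhs (f t : 'rV[R]_n) U by exact: open_nbhs_nbhs.
  (* Half of e, because the box is centred at a rational point near f t rather than at f t, and the
     two distances add up. *)
  have [k ke] : exists k, (k.+1%:R^-1 < e / 2 :> R)%R.
    exists (Num.truncn (e / 2)^-1).
    by rewrite invf_plt ?posrE ?divr_gt0// truncnS_gt.
  have /choice[q hq] : forall j, exists q : rat, (`|ratr q - (f t : 'rV[R]_n) ord0 j| < k.+1%:R^-1)%R.
    by move=> j; apply: near_rat; rewrite invr_gt0.
  exists (\row_j q j, k) => //.
  have bft : bq (\row_j q j, k) (f t) by move=> j /=; rewrite mxE.
  case: asboolP => // -[] v bv; apply: eU; split => // i j.
  rewrite (ord1 i) -ball_normE /= (splitr e).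
  have := bft j; have := bv j => /= v1 v2.
  rewrite -[X in `|X|%R](subrKA (ratr ((\row_j q j) ord0 j))).
  apply: (le_lt_trans (ler_normD _ _)); apply: ltrD.
    by rewrite distrC (lt_trans v2).
  exact: lt_trans ke.
apply: countable_bigcupT_measurable => // p.
by case: asboolP => // _; exact: measurable0.
Qed.

Lemma measurable_vecD d (T : measurableType d) (f g : T -> vec R n) :
  measurable_fun setT f -> measurable_fun setT g ->
  measurable_fun setT (fun t => ((f t : 'rV[R]_n) + g t)%R : vec R n).
Proof.
move=> mf mg; apply: measurable_vec => j.
rewrite (_ : (fun t => _) = fun t => ((f t : 'rV[R]_n) ord0 j + (g t : 'rV[R]_n) ord0 j)%R).
  by apply: measurable_funD; exact: (measurableT_comp (measurable_coord j)).
by apply/funext => t; rewrite mxE.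
Qed.

Lemma measurable_vec_sum d (T : measurableType d) (I : Type) (s : seq I) (p : pred I)
    (f : I -> T -> vec R n) : (forall i, measurable_fun setT (f i)) ->
  measurable_fun setT (fun t => (\sum_(i <- s | p i) (f i t : 'rV[R]_n))%R : vec R n).
Proof.
move=> mf; elim: s => [|i s IH].
  rewrite (_ : (fun t => _) = fun=> (0%R : 'rV[R]_n)); first exact: measurable_cst.
  by apply/funext => t; rewrite big_nil.
rewrite (_ : (fun t => _) = fun t => if p i then ((f i t : 'rV[R]_n) +
  (\sum_(i <- s | p i) (f i t : 'rV[R]_n)))%R else (\sum_(i <- s | p i) (f i t : 'rV[R]_n))%R).
  by case: (p i) => //; exact: measurable_vecD.
by apply/funext => t; rewrite big_cons.
Qed.

Lemma measurable_vec1 (a : 'rV[R]_n) : measurable ([set a] : set (vec R n)).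
Proof.
rewrite (_ : [set a] = \bigcap_(j in [set: 'I_n])
  ((fun v : vec R n => (v : 'rV[R]_n) ord0 j) @^-1` [set a ord0 j])).
  apply: fin_bigcap_measurable => // j _; rewrite -[X in measurable X]setTI.
  exact: (measurable_coord j).
apply/seteqP; split => [v -> //|v h]; apply/rowP => j; exact: h.
Qed.

End borel_vectors.

(** * Separation and recovery of points by a countable base *)

Section second_countable_base.
Context {R : realType} (Omega : completePseudoMetricType R).
Hypotheses (hO : hausdorff_space Omega) (scO : @second_countable Omega).

Definition countable_base (B : nat -> set Omega) :=
  (forall j, open (B j)) /\
  (forall x U, open U -> U x -> exists2 j, B j x & B j `<=` U).

(** Indices that name no member of the base are sent to the empty set, which is open and contains no
    point. *)
Lemma countable_base_exists : exists B, countable_base B.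
Proof.
have [C cC [oC bC]] := scO.
have : exists f : nat -> set Omega, forall c, C c -> exists j, f j = c.
  have /pfcard_geP [C0|[f]] := cC.
    by exists (fun=> set0) => c; rewrite C0.
  exists f => c Cc; have [j _ <-] := @surj _ _ _ _ f c Cc.
  by exists j.
move=> [f hf]; exists (fun j => if `[< C (f j) >] then f j else set0); split.
  by move=> j; case: asboolP => [/oC//|_]; exact: open0.
move=> x U oU Ux; have [V [CV Vx] VU] := bC x U (open_nbhs_nbhs (conj oU Ux)).
have [j fj] := hf V CV.
by exists j; rewrite fj; case: asboolP.
Qed.

Variable B : nat -> set Omega.
Hypothesis bB : countable_base B.

Lemma measurable_base j : measurable (B j : set (borel Omega)).
Proof. by apply: sub_sigma_algebra; have [oB _] := bB; exact: oB. Qed.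

Lemma measurable_point (x : Omega) : measurable ([set x] : set (borel Omega)).
Proof.
rewrite -[[set x]]setCK; apply: measurableC.
apply: sub_sigma_algebra; rewrite openC.
exact/accessible_closed_set1/hausdorff_accessible.
Qed.

Lemma ball_sep (x y : Omega) : x <> y -> exists k : nat, ~ ball x (k.+1%:R^-1) y.
Proof.
move=> xy; apply: contrapT => /forallNP h.
apply: xy; apply: hO => U V /nbhs_ballP[e /= e0 eU] nV.
exists y; split; last exact: nbhs_singleton.
have [k ke] : exists k, (k.+1%:R^-1 < e :> R)%R.
  by exists (Num.truncn e^-1); rewrite invf_plt ?posrE// truncnS_gt.
by apply: eU; apply: le_ball (ltW ke) _ _; have /contrapT := h k.
Qed.

(** The points are finitely many, so one radius separates all pairs; base sets inside balls of half
    that radius cannot meet. *)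
Lemma base_sep m (x : 'I_m -> Omega) : injective x ->
  exists v : 'I_m -> nat, (forall l, B (v l) (x l)) /\
    (forall l l', l != l' -> B (v l) `&` B (v l') = set0).
Proof.
move=> xinj.
have /choice[k hk] : forall p : 'I_m * 'I_m, exists k : nat,
    p.1 != p.2 -> ~ ball (x p.1) (k.+1%:R^-1) (x p.2).
  move=> [i j] /=; have [->|ij] := eqVneq i j; first by exists 0%N.
  have [k hk] := @ball_sep (x i) (x j) (fun e => (negP ij) (introT eqP (xinj _ _ e))).
  by exists k.
pose N := (\max_p k p)%N; pose e : R := (N.+1%:R^-1)%R.
have e0 : (0 < e)%R by rewrite invr_gt0.
have sepN i j : i != j -> ~ ball (x i) e (x j).
  move=> ij bij; apply: (hk (i, j)) => //=; apply: le_ball bij.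
  rewrite lef_pV2 ?posrE// ler_nat ltnS.
  exact: (leq_bigmax (F := k) (i, j)).
have [oB hB] := bB.
have /choice[v hv] : forall l, exists j, B j (x l) /\ B j `<=` (ball (x l) (e / 2))^°.
  move=> l; have [||j] := hB (x l) (ball (x l) (e / 2))^°.
  - exact: open_interior.
  - by apply: nbhsx_ballx; rewrite divr_gt0.
  - by exists j.
exists v; split; first by move=> l; case: (hv l).
move=> l l' ll'; apply/seteqP; split => // z [zl zl'].
apply: (sepN l l') => //; apply: (@ball_splitl _ _ z).
  by apply: interior_subset; exact: (hv l).2.
by apply: interior_subset; exact: (hv l').2.
Qed.

Definition base_code p (x : Omega) : p.-tuple bool := [tuple `[< B i x >] | i < p].

(** The cells of depth p form a finite Borel partition, which refines as p grows and separates
    points in the limit. *)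
Definition base_cell p (b : p.-tuple bool) : set Omega := [set x | base_code p x = b].

Lemma measurable_base_cell p b : measurable (@base_cell p b : set (borel Omega)).
Proof.
rewrite (_ : base_cell b = \bigcap_(i in [set: 'I_p])
  (if tnth b i then B i else ~` B i)); last first.
  apply/seteqP; split => [x <- i _|x h].
    by rewrite tnth_mktuple; case: asboolP.
  apply: eq_from_tnth => i; rewrite tnth_mktuple; have := h i I.
  by case: (tnth b i) => [Bx|Bx]; apply/asboolP.
apply: fin_bigcap_measurable => // i _.
by case: (tnth b i); [|apply: measurableC]; exact: measurable_base.
Qed.

Lemma base_code_inj x y : (forall p, base_code p x = base_code p y) -> x = y.
Proof.
move=> xy; apply: hO => U V nU nV.
have [oB hB] := bB.
have [j Bjx jU] := hB x U^° (open_interior _) nU.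
exists y; split; last exact: nbhs_singleton.
apply: interior_subset; apply: jU.
have := congr1 (fun b => tnth b (Ordinal (ltnSn j))) (xy j.+1).
by rewrite !tnth_mktuple /= (asboolT Bjx) => /esym/asboolP.
Qed.

(* The extension uses completeness: off the trace [D], the approximations
   [y (J p t)] need not converge, and the set where they are Cauchy at a
   prescribed rate is measurable. *)
Lemma measurable_extension d (T : measurableType d) (D : set T) (g : T -> Omega) :
  (forall U, open U -> exists2 S, measurable S & forall t, D t -> (U (g t) <-> S t)) ->
  exists2 h : T -> borel Omega, measurable_fun setT h & forall t, D t -> h t = g t.
Proof.
move=> gS; have [oB hB] := bB.
have /choice[y hy] : forall j, exists y : Omega, B j !=set0 -> B j y.
  by move=> j; have [[y By]|nB] := pselect (B j !=set0); [exists y|exists point].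
pose r p : R := (2 ^- p)%R.
have r0 p : (0 < r p)%R by rewrite invr_gt0 exprn_gt0.
have rS p : (r p = r p.+1 + r p.+1)%R.
  by rewrite /r exprS; field; rewrite expf_neq0.
have /choice[S hS] : forall pj : nat * nat, exists S, measurable S /\
    forall t, D t -> ((ball (y pj.2) (r pj.1))^° (g t) <-> S t).
  move=> [p j]; have [|S mS h] := gS ((ball (y j) (r p))^°); first exact: open_interior.
  by exists S.
have mS p j : measurable (S (p, j)) by case: (hS (p, j)).
have SE p j t : D t -> ((ball (y j) (r p))^° (g t) <-> S (p, j) t).
  by move=> Dt; case: (hS (p, j)) => _; exact.
have exS p t : D t -> exists j, S (p, j) t.
  move=> Dt; have [j Bjg Bj] := hB (g t) _ (open_interior (ball (g t) (r p.+1)))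
    (nbhsx_ballx _ _ (r0 p.+1)).
  have yj : ball (g t) (r p.+1) (y j).
    by apply: interior_subset; apply: Bj; apply: hy; exists (g t).
  exists j; apply/SE => //; apply: filterS (nbhsx_ballx (g t) _ (r0 p.+1)) => z gz.
  by rewrite rS; apply: ball_triangle gz; exact: ball_sym.
(* The first index whose centre is within 2 ^- p of g t, read off the sets [S]. Off [D] it need not
   approximate anything, and it is 0 when no index qualifies. *)
pose J p t : nat := match pselect (exists j, `[< S (p, j) t >]) with
  | left e => ex_minn e | right _ => 0%N end.
have mJ p j : measurable [set t | J p t = j].
  rewrite (_ : [set t | _] = (S (p, j) `\` \bigcup_(i < j) S (p, i)) `|`
      (if j == 0%N then ~` \bigcup_i S (p, i) else set0)).
    apply: measurableU.
      by apply: measurableD => //; apply: bigcup_measurable => i _; exact: mS.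
    case: ifP => _ //; apply: measurableC; exact: bigcupT_measurable.
  apply/seteqP; split => t /=.
    rewrite /J; case: pselect => [e|ne] <-.
      case: ex_minnP => i /asboolP Si mini; left; split => // -[l /= li Sl].
      by have := mini l (asboolT Sl); rewrite leqNgt li.
    by right => /= -[i _ Si]; apply: ne; exists i; exact/asboolP.
  rewrite /J => -[[Sj nSj]|].
    case: pselect => [e|]; last by case; exists j; exact/asboolP.
    case: ex_minnP => i /asboolP Si mini; apply/eqP; rewrite eqn_leq mini ?andbT//; last exact/asboolP.
    by rewrite leqNgt; apply/negP => ij; apply: nSj; exists i.
  case: eqP => // -> /= nS; case: pselect => // -[i Si].
  by exfalso; apply: nS; exists i => //; apply/asboolP.
have JS p t : (exists j, S (p, j) t) -> S (p, J p t) t.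
  move=> [j Sj]; rewrite /J; case: pselect => [e|]; last first.
    by case; exists j; exact/asboolP.
  by case: ex_minnP => i /asboolP.
have mQ p (Q : nat -> nat -> Prop) : measurable [set t | Q (J p t) (J p.+1 t)].
  rewrite (_ : [set t | _] = \bigcup_(ij : nat * nat)
    (if `[< Q ij.1 ij.2 >] then [set t | J p t = ij.1] `&` [set t | J p.+1 t = ij.2] else set0)).
    apply: countable_bigcupT_measurable => // -[i j] /=.
    by case: asboolP => _ //; exact: measurableI.
  apply/seteqP; split => t /=.
    by move=> q; exists (J p t, J p.+1 t) => //=; rewrite asboolT.
  by move=> [[i j] _ /=]; case: asboolP => // q [-> ->].
(* On [D] consecutive centres are both close to g t, whence this bound on their distance; the
   condition itself no longer mentions g. *)
pose E : set T := \bigcap_p [set t | ball (y (J p t)) (r p + r p)%R (y (J p.+1 t))].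
have mE : measurable E.
  by apply: bigcapT_measurable => p; exact: (mQ p (fun i j => ball (y i) (r p + r p)%R (y j))).
have gball p t : D t -> ball (y (J p t)) (r p) (g t).
  by move=> Dt; apply: interior_subset; apply/SE => //; apply: JS; exact: exS.
have DE : D `<=` E.
  move=> t Dt p _ /=; apply: ball_triangle (gball p t Dt) _.
  apply: le_ball (ball_sym (gball p.+1 t Dt)).
  by rewrite [leRHS]rS lerDl ltW.
(* The radius is chosen to telescope: it is r p at k = 0, and adding the step 2 r (p + k) = 4 r (p +
   k + 1) keeps its form. It stays below 5 r p. *)
have ballE t p k : E t -> ball (y (J p t)) (5 * r p - 4 * r (p + k)%N)%R (y (J (p + k)%N t)).
  move=> Et; elim: k => [|k IH].
    by rewrite addn0; apply: ballxx; have := r0 p; lra.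
  rewrite addnS; apply: le_ball (ball_triangle IH (Et (p + k)%N I)).
  by rewrite (rS (p + k)%N); lra.
have rlt (c e : R) : (0 < c)%R -> (0 < e)%R -> exists p, (c * r p < e)%R.
  move=> c0 e0; pose p := Num.truncn (c / e); exists p.
  rewrite -ltr_pdivlMl// mulrC /r invf_plt ?posrE ?exprn_gt0 ?divr_gt0// invf_div.
  apply: (lt_le_trans (truncnS_gt _)).
  by rewrite -natrX ler_nat ltn_expl.
have cvE t : E t -> cvg ((fun p => y (J p t)) @ \oo).
  move=> Et; apply/cauchy_cvgP/cauchy_exP => e e0.
  have [p pe] := rlt 5%R e ltac:(by []) e0; exists (y (J p t)), p => // q /= pq.
  rewrite -(subnKC pq); apply: le_ball (ballE t p (q - p)%N Et).
  by have := r0 (p + (q - p))%N; lra.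
have limE t p : E t -> ball (y (J p t)) (6 * r p)%R (lim ((fun p => y (J p t)) @ \oo)).
  move=> /[dup] Et /cvE /cvg_ballP/(_ _ (r0 p)) [q _ hq].
  have := hq (p + q)%N (leq_addl _ _) => /= /ball_sym.
  move=> /(ball_triangle (ballE t p q Et)); apply: le_ball.
  by have := r0 (p + q)%N; lra.
pose h t : borel Omega := if t \in E then lim ((fun p => y (J p t)) @ \oo) else point.
exists h; last first.
  move=> t Dt; rewrite /h mem_set; last exact: DE.
  apply: cvg_lim => //; apply/cvg_ballP => e e0.
  have [p pe] := rlt 1%R e ltr01 e0; exists p => // q /= pq.
  apply: le_ball (ball_sym (gball q t Dt)).
  apply: le_trans (ltW pe); rewrite mul1r /r lef_pV2 ?posrE ?exprn_gt0//.
  by rewrite ler_eXn2l// ltr1n.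
apply: (@measurability _ _ T (borel Omega) setT h (@open Omega)) => // _ [U oU <-].
(* The limit is within 6 r p of the p-th centre, so it lies in the open set [U] exactly when some
   such ball is contained in [U]: for large p the ball of radius 12 r p around the limit, which
   covers it, lies in [U]. *)
rewrite setTI (_ : h @^-1` U =
  (E `&` \bigcup_p [set t | ball (y (J p t)) (6 * r p)%R `<=` U]) `|`
  (if `[< U point >] then ~` E else set0)).
  apply: measurableU.
    apply: measurableI => //; apply: bigcupT_measurable => p.
    exact: (mQ p (fun i j => ball (y i) (6 * r p)%R `<=` U)).
  by case: asboolP => // _; exact: measurableC.
apply/seteqP; split => t; rewrite /h /=.
  case: ifPn => [/set_mem Et Ul|/negP Et Up]; last first.
    by right; rewrite asboolT// => /mem_set.
  left; split => //; have /nbhs_ballP[e /= e0 eU] := open_nbhs_nbhs (conj oU Ul).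
  have [p pe] := rlt 12%R e ltac:(by []) e0; exists p => // z yz; apply: eU.
  apply: le_ball (ball_triangle (ball_sym (limE t p Et)) yz).
  by lra.
case=> [[Et [p _ pU]]|]; first by rewrite mem_set//; apply: pU; exact: limE.
by case: asboolP => // Up nE; rewrite memNset.
Qed.

End second_countable_base.

(** * The marked point process of features *)

Section gate_kernel.
Context {R : realType} {n : nat} (G : R.-pker R ~> vec R n).

Definition vec0 : vec R n := (0%R : 'rV[R]_n).

(* The mark law attached to an index: [G s] at an actual point, and the
   Dirac mass at 0 when [s <= 0], i.e. when the index is unused. *)
Definition gate (s : R) : {measure set (vec R n) -> \bar R} :=
  if (0 < s)%R then G s else dirac vec0.

Let measurable_gate U : measurable U -> measurable_fun [set: R] (gate ^~ U).
Proof.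
move=> mU; rewrite (_ : gate ^~ U = fun s => if (0 < s)%R then G s U else
  dirac vec0 U); last by apply/funext => s; rewrite /gate; case: ifP.
apply: measurable_fun_ifT; first exact: measurable_fun_ltr.
  exact: measurable_kernel.
exact: measurable_cst.
Qed.

HB.instance Definition _ := isKernel.Build _ _ _ _ _ gate measurable_gate.

Let gate_prob s : gate s [set: vec R n] = 1.
Proof. by rewrite /gate; case: ifP => _; [exact: prob_kernel|exact: diracT]. Qed.

HB.instance Definition _ := Kernel_isProbability.Build _ _ _ _ _ gate gate_prob.

Lemma gate_pos s : (0 < s)%R -> gate s = G s.
Proof. by rewrite /gate => ->. Qed.

Lemma gate_neg s U : ~~ (0 < s)%R -> gate s U = (vec0 \in U)%:R%:E.
Proof. by move=> s0; rewrite /gate (negbTE s0). Qed.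

End gate_kernel.

Lemma measurable_nseq_tuple d d' (T : measurableType d) (A : measurableType d') m
    (h : T -> A) : measurable_fun setT h ->
  measurable_fun setT (fun t => nseq_tuple m (h t)).
Proof.
move=> mh; apply/measurable_fun_tnthP => i.
rewrite (_ : _ \o _ = h)//; apply/funext => t /=; exact: tnth_nseq.
Qed.

Section tuple_rectangles.
Context {R : realType} d (A : measurableType d) (m : nat).

Definition tuple_rect (D : 'I_m -> set A) : set (m.-tuple A) :=
  [set y | forall i, D i (tnth y i)].

Definition tuple_rects : set (set (m.-tuple A)) :=
  [set E | exists2 D, (forall i, measurable (D i)) & E = tuple_rect D].

Lemma measurable_tuple_rect D : (forall i, measurable (D i)) -> measurable (tuple_rect D).
Proof.
move=> mD; rewrite (_ : tuple_rect D = \bigcap_(i in [set: 'I_m]) ((@tnth _ A ^~ i) @^-1` D i)).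
  apply: fin_bigcap_measurable => // i _; rewrite -[X in measurable X]setTI.
  exact: measurable_tnth.
by apply/seteqP; split => y h i; [move=> _; exact: h|exact: h].
Qed.

Lemma tuple_rectsE : measurable = <<s tuple_rects >>.
Proof.
apply/seteqP; split; last first.
  apply: smallest_sub; first exact: sigma_algebra_measurable.
  by move=> _ [D mD ->]; exact: measurable_tuple_rect.
apply: sub_smallest2r; first exact: smallest_sigma_algebra.
move=> E; rewrite -bigcup_seq => -[i _ [B mB <-]].
exists (fun j => if j == i then B else setT); first by move=> j; case: ifP.
apply/seteqP; split => y /=.
  by move=> [_ By] j; case: eqP => // ->.
by move=> /(_ i); rewrite eqxx.
Qed.

Lemma tuple_rectsI : setI_closed tuple_rects.
Proof.
move=> _ _ [D mD ->] [D' mD' ->]; exists (fun i => D i `&` D' i).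
  by move=> i; exact: measurableI.
apply/seteqP; split => y /=; first by move=> [h h'] i; split.
by move=> h; split => i; case: (h i).
Qed.

Lemma tuple_rectsT : tuple_rects setT.
Proof. by exists (fun=> setT) => //; apply/seteqP; split. Qed.

Lemma ind_tuple_rect D y : ind (tuple_rect D) y = \prod_(i < m) ind (D i) (tnth y i) :> \bar R.
Proof.
have [h|h] := pselect (tuple_rect D y).
  by rewrite ind1// big1// => i _; rewrite ind1.
rewrite ind0//; move: h => /existsNP[i Di].
by rewrite (bigD1 i)//= ind0// mul0e.
Qed.

Lemma kprodt_rect d' (B : measurableType d') (k : R.-pker B ~> A) x D :
  (forall i, measurable (D i)) ->
  kprodt k m x (tuple_rect D) = \prod_(i < m) k (tnth x i) (D i).
Proof.
move=> mD; rewrite -integral_ind; last exact: measurable_tuple_rect.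
under eq_integral do rewrite ind_tuple_rect.
rewrite (integral_kprodt_prod k x (f := fun i => ind (D i))).
  by apply: eq_bigr => i _; rewrite integral_ind.
by move=> i; exact: nnmf_ind.
Qed.

End tuple_rectangles.

Lemma gsigma_bigsetI (T : Type) (G : set (set T)) (I : Type) (s : seq I) (p : pred I)
    (F : I -> set T) : (forall i, p i -> <<s G >> (F i)) ->
  <<s G >> (\big[setI/setT]_(i <- s | p i) F i).
Proof.
move=> GF; elim: s => [|i s IH]; first by rewrite big_nil; exact: gsigmaT.
by rewrite big_cons; case: ifPn => // pi; apply: gsigmaI => //; exact: GF.
Qed.

Section marked_setting.
Context {R : realType} {n m : nat} {Omega : completePseudoMetricType R}.
Variables (B0 : probability (borel Omega) R) (rho : R -> Omega -> R).
Hypothesis rho_measurable : measurable_fun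
  ([set x | (0 < x.1)%R] : set (R * borel Omega)%type) (fun x => rho x.1 x.2).
Hypothesis rho_ge0 : forall (s : R) w, (0 < s)%R -> (0 <= rho s w)%R.
Variable G : R.-pker R ~> vec R n.

Definition pos_points : set (R * borel Omega) := [set x | (0 < x.1)%R].

Lemma measurable_pos_points : measurable pos_points.
Proof.
rewrite -[X in measurable X]setTI.
rewrite (_ : pos_points = fst @^-1` `]0%R, +oo[); last first.
  by apply/seteqP; split => x; rewrite /pos_points /= in_itv/= andbT.
exact: (@measurable_fst _ _ R (borel Omega)).
Qed.

(** The density is assumed measurable and nonnegative on s > 0 only; extended by 0 it can be
    integrated over the whole line with Tonelli's theorem. *)
Definition rho0 (x : R * borel Omega) : \bar R :=
  if (0 < x.1)%R then (rho x.1 x.2)%:E else 0.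

Lemma nnmf_rho0 : nnmf rho0.
Proof.
split; last by move=> x; rewrite /rho0; case: ifP => // x0; rewrite lee_fin rho_ge0.
rewrite (_ : rho0 = (fun x => (rho x.1 x.2)%:E) \_ pos_points).
  apply/(measurable_restrictT _ measurable_pos_points).
  exact/measurable_EFinP.
apply/funext => x; rewrite /rho0 patchE; case: ifPn => x0.
  by rewrite mem_set.
by rewrite memNset//; exact/negP.
Qed.

Definition point_intensity (f : R * borel Omega -> \bar R) : \bar R :=
  \int[B0]_w \int[lebesgue_measure]_s (rho0 (s, w) * f (s, w)).

Lemma point_intensity_il : integral_like point_intensity.
Proof.
have k1 := kop_comp (kop_lebesgue (borel Omega)) (kop_mul nnmf_rho0).
exact: (integral_like_kop (integral_like_int B0) k1).
Qed.

Lemma levy_intensityE D : levy_intensity rho B0 D = point_intensity (ind (D `&` pos_points)).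
Proof.
apply: eq_integral => w _; rewrite integral_mkcond; apply: eq_integral => s _.
rewrite patchE /rho0 /=; have [s0|s0] := boolP (0 < s)%R; last first.
  by rewrite memNset ?mul0e//= => -[]; rewrite (negbTE s0).
have [Dsw|nD] := pselect (D (s, w)).
  by rewrite mem_set// ind1// mule1.
by rewrite memNset ?ind0 ?mule0// => -[].
Qed.

Context d (T : measurableType d) (P : probability T R).
Variables (tau : nat -> {RV P >-> R}) (w : nat -> {RV P >-> borel Omega}).
Hypothesis prm : is_PRM P (point_measure tau w) (levy_intensity rho B0).

Definition pts k t : R * borel Omega := (tau k t, w k t).

Lemma measurable_pts k : measurable_fun setT (pts k).
Proof. by apply: measurable_fun_pair; exact: measurable_funPT. Qed.

Lemma point_measureE t B : measurable B ->
  point_measure tau w t B = cnt pts (B `&` pos_points) t.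
Proof.
move=> mB; rewrite /point_measure /cnt /psum.
rewrite -(nneseries_esum (P := fun k => (0 < tau k t)%R))//.
rewrite eseries_mkcond; apply: eq_eseriesr => k _.
rewrite diracE indE; case: ifPn => tk.
  have [Bx|nB] := pselect (B (pts k t)); first by rewrite !mem_set.
  by rewrite !memNset// => -[].
by rewrite memNset// => -[_]; exact/negP.
Qed.

Lemma pts_laplace : laplace_functional P pts point_intensity pos_points.
Proof.
apply: (laplace_of_PRM measurable_pts point_intensity_il measurable_pos_points
  (N := point_measure tau w) (nu := levy_intensity rho B0)) => //.
- by move=> t B mB; exact: point_measureE.
- by move=> B mB; exact: levy_intensityE.
Qed.

Variable A : 'I_m -> nat -> {RV P >-> vec R n}.
Hypothesis A_marks : forall (H : set T) (r : nat) (D : 'I_m -> nat -> set (vec R n)),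
  points_sigma tau w H -> (forall i k, measurable (D i k)) ->
  P (H `&` [set t | forall i k, (k < r)%N -> present tau t k -> D i k (A i k t)]) =
  \int[P]_(t in H) (\prod_(k < r | (0 < tau k t)%R) \prod_(i < m)
     fine (G (tau k t) (D i k)))%:E.

Definition mks k t : m.-tuple (vec R n) :=
  [tuple if (0 < tau k t)%R then A i k t else vec0 | i < m].

Lemma measurable_mks k : measurable_fun setT (mks k).
Proof.
apply/measurable_fun_tnthP => i.
rewrite (_ : _ \o _ = fun t => if (0 < tau k t)%R then A i k t else vec0); last first.
  by apply/funext => t /=; rewrite tnth_mktuple.
by apply: measurable_fun_ifT; [exact: measurable_fun_ltr|exact: measurable_funPT|exact: measurable_cst].
Qed.

Lemma measurable_nseq_pts :
  measurable_fun [set: R * borel Omega] (fun x => nseq_tuple m x.1).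
Proof. exact: measurable_nseq_tuple. Qed.

Definition mark_kernel : R.-pker (R * borel Omega) ~> (m.-tuple (vec R n)) :=
  kpull (kprodt (gate G) m) measurable_nseq_pts.

Lemma mark_kernel_rect x D : (forall i, measurable (D i)) ->
  mark_kernel x (tuple_rect D) = \prod_(i < m) gate G x.1 (D i).
Proof.
move=> mD; rewrite /= /kpull kprodt_rect//; apply: eq_bigr => i _.
by rewrite [tnth _ _]tnth_nseq.
Qed.

Lemma mks_marks r (S_ : nat -> set (R * borel Omega)) (B : nat -> set (m.-tuple (vec R n))) :
  (forall i, measurable (S_ i)) -> (forall i, tuple_rects (B i)) ->
  P (\big[setI/setT]_(i < r) ((pts i @^-1` S_ i) `&` (mks i @^-1` B i))) =
  \int[P]_t \prod_(i < r) (ind (S_ i) (pts i t) * mark_kernel (pts i t) (B i)).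
Proof.
move=> mS rB; have /choice[D hD] : forall k, exists D : 'I_m -> set (vec R n),
    (forall i, measurable (D i)) /\ B k = tuple_rect D.
  by move=> k; have [D mD ->] := rB k; exists D.
have mD k i : measurable (D k i) by case: (hD k).
have BE k : B k = tuple_rect (D k) by case: (hD k).
pose S' k := S_ k `&` (if `[< forall i, D k i vec0 >] then setT else pos_points).
have mS' k : measurable (S' k).
  by apply: measurableI => //; case: asboolP => // _; exact: measurable_pos_points.
pose H := \big[setI/setT]_(i < r) (pts i @^-1` S' i).
have mH : measurable H.
  apply: bigsetI_measurable => i _; rewrite -[X in measurable X]setTI.
  exact: measurable_pts.
have sH : points_sigma tau w H.
  apply: gsigma_bigsetI => i _; apply: sub_sigma_algebra; exists i => //.
  by exists (S' i) => //; rewrite setTI.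
have HP t : H t <-> forall i, (i < r)%N -> S' i (pts i t).
  rewrite /H -(bigcap_mkord r (fun i => pts i @^-1` S' i)); split => h i ir; exact: h.
have E : \big[setI/setT]_(i < r) ((pts i @^-1` S_ i) `&` (mks i @^-1` B i)) =
    H `&` [set t | forall i k, (k < r)%N -> present tau t k -> D k i (A i k t)].
  rewrite -(bigcap_mkord r (fun i => (pts i @^-1` S_ i) `&` (mks i @^-1` B i))).
  apply/seteqP; split => t.
    move=> h; split.
      apply/HP => k kr; have [Sk] := h k kr; rewrite BE /= => Dk; split => //.
      case: asboolP => // nD; rewrite /pos_points /=; apply: contrapT => /negP tk.
      by apply: nD => i; have := Dk i; rewrite tnth_mktuple (negbTE tk).
    move=> i k kr pk; have [_] := h k kr; rewrite BE /= => /(_ i).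
    by rewrite tnth_mktuple; rewrite /present /= in pk; rewrite pk.
  move=> [/HP h1 h2] k kr; have [Sk h] := h1 k kr; split => //; rewrite BE /= => i.
  rewrite tnth_mktuple; case: ifPn => tk; first exact: h2.
  by move: h; case: asboolP => // _; rewrite /pos_points /= (negbTE tk).
rewrite E (@A_marks H r (fun i k => D k i) sH) => [|//].
rewrite -integral_ind_mul//; apply: eq_integral => t _.
have KE k : mark_kernel (pts k t) (B k) = \prod_(i < m) gate G (tau k t) (D k i).
  by rewrite BE mark_kernel_rect.
have [/[dup] Ht /HP h|/HP/existsNP[k /not_implyP[kr nS]]] := pselect (H t).
  rewrite ind1// mul1e -prodEFin big_mkcond; apply: eq_bigr => k _.
  have [Sk h'] := h k (ltn_ord k); rewrite ind1// mul1e KE; case: ifPn => tk.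
    rewrite -prodEFin; apply: eq_bigr => i _; rewrite gate_pos// fineK//.
    exact: pker_fin.
  rewrite big1// => i _; rewrite gate_neg// mem_set//.
  by move: h'; case: asboolP => // _; rewrite /pos_points /= (negbTE tk).
have nH : ~ H t by move=> /HP/(_ k kr).
rewrite (ind0 nH) mul0e; apply/esym.
rewrite (bigD1 (Ordinal kr))//=.
have [Sk|nSk] := pselect (S_ k (pts k t)); last by rewrite ind0// !mul0e.
rewrite KE; move: nS; rewrite /S'; case: asboolP => nD nS; first by exfalso; apply: nS.
have tk : ~~ (0 < tau k t)%R by apply/negP => tk; apply: nS.
move/existsNP: nD => [i Di].
rewrite (bigD1 i)//= gate_neg// memNset//.
by rewrite !(mul0e, mule0).
Qed.

Definition marked_intensity (f : (R * borel Omega) * m.-tuple (vec R n) -> \bar R) :=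
  point_intensity (mark_hat mark_kernel f).

Lemma marked_intensity_il : integral_like marked_intensity.
Proof. exact: (integral_like_kop point_intensity_il (kop_hat _)). Qed.

Lemma marked_laplace : laplace_functional P (marked pts mks) marked_intensity
  (pos_points `*` setT).
Proof.
exact: (laplace_marked measurable_pts measurable_mks (tuple_rectsE _ _)
  (@tuple_rectsI _ _ _) (tuple_rectsT _ _) mks_marks pts_laplace).
Qed.

End marked_setting.

(** [Y] may be any set: a count takes countably many values, so the preimage is a countable union of
    levels, together with the complement of all levels if [Y] contains +oo. *)
Lemma cnt_sigma_preimage {R : realType} d (T : measurableType d)
    dS (S : measurableType dS) (xi : nat -> T -> S) (A U : set S) (Y : set (\bar R)) :
  measurable U -> U `<=` A -> cnt_sigma (R := R) xi A (cnt xi U @^-1` Y).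
Proof.
move=> mU UA.
pose N : T -> \bar R := cnt xi U.
have NN t : natlike (N t) := natlike_cnt xi U t.
have lv m : cnt_sigma (R := R) xi A (lev N m) by exact: cnt_sigma_lev.
rewrite [X in cnt_sigma _ _ X](_ : _ =
  (\bigcup_m (if `[< Y m%:R%:E >] then lev N m else set0)) `|`
  (if `[< Y +oo >] then ~` \bigcup_m lev N m else set0)); last first.
  apply/seteqP; split => t /=.
    move=> Yt; have [ct|[m ct]] := NN t.
      by right; rewrite -ct asboolT// => -[m _]; rewrite /lev /= ct.
    by left; exists m => //; rewrite asboolT -?ct//.
  move=> [[m _]|]; case: asboolP => // Ym; first by rewrite /lev /= => Nm; rewrite -/(N t) Nm.
  by move=> nl; have [ct|[m ct]] := NN t; [rewrite -/(N t) ct|exfalso; apply: nl; exists m].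
apply: gsigmaU.
  by apply: sigma_algebra_bigcup => m; case: asboolP => _; [exact: lv|exact: sigma_algebra0].
case: asboolP => _; last exact: sigma_algebra0.
by apply: gsigmaC; apply: sigma_algebra_bigcup.
Qed.

Section split_marks.
Context {R : realType} {n M : nat}.
Local Notation E := (vec R n).

Definition last_mark (y : M.+1.-tuple E) : E := tnth y ord_max.

Definition first_marks (y : M.+1.-tuple E) : M.-tuple E :=
  [tuple tnth y (lift ord_max i) | i < M].

Definition no_marks : M.-tuple E := nseq_tuple M vec0.

Lemma measurable_last_mark : measurable_fun setT last_mark.
Proof. exact: measurable_tnth. Qed.

Lemma measurable_first_marks : measurable_fun setT first_marks.
Proof.
apply/measurable_fun_tnthP => i.
rewrite (_ : _ \o _ = fun y => tnth y (lift ord_max i)); first exact: measurable_tnth.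
by apply/funext => y /=; rewrite tnth_mktuple.
Qed.

Lemma no_marksE (a : M.-tuple E) : a = no_marks <-> forall i, tnth a i = vec0.
Proof.
split => [-> i|h]; first exact: tnth_nseq.
by apply: eq_from_tnth => i; rewrite h [RHS]tnth_nseq.
Qed.

Lemma measurable_no_marks : measurable [set no_marks].
Proof.
rewrite (_ : [set no_marks] = tuple_rect (fun=> [set vec0])).
  by apply: measurable_tuple_rect => i; exact: measurable_vec1.
by apply/seteqP; split => a /=; rewrite no_marksE.
Qed.

Variable k : R.-pker R ~> E.

(** Under the product law the first M marks are independent of the last one. Rectangles are settled
    first, then the factor in the first marks becomes arbitrary, then the factor in the last
    mark. *)
Lemma integral_split_marks s (f : M.-tuple E -> \bar R) (g : E -> \bar R) :
  nnmf f -> nnmf g ->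
  \int[kprodt k M.+1 (nseq_tuple M.+1 s)]_y (f (first_marks y) * g (last_mark y)) =
  (\int[kprodt k M (nseq_tuple M s)]_a f a) * \int[k s]_a g a.
Proof.
move=> nf ng; pose mu := kprodt k M.+1 (nseq_tuple M.+1 s).
have nF (h : M.-tuple E -> \bar R) : nnmf h -> nnmf (fun y => h (first_marks y)).
  by move=> nh; exact: nnmf_comp measurable_first_marks nh.
have nL (h : E -> \bar R) : nnmf h -> nnmf (fun y => h (last_mark y)).
  by move=> nh; exact: nnmf_comp measurable_last_mark nh.
have step1 (D : set E) : measurable D -> forall h, nnmf h ->
    \int[mu]_y (h (first_marks y) * ind D (last_mark y)) =
    (\int[kprodt k M (nseq_tuple M s)]_a h a) * k s D.
  move=> mD h nh.
  pose L1 (h : M.-tuple E -> \bar R) := \int[mu]_y (ind D (last_mark y) * h (first_marks y)).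
  pose L2 (h : M.-tuple E -> \bar R) := k s D * \int[kprodt k M (nseq_tuple M s)]_a h a.
  have nD : nnmf (ind D : E -> \bar R) by exact: nnmf_ind.
  under eq_integral do rewrite muleC.
  rewrite muleC -/(L1 h) -/(L2 h).
  have iL1 : integral_like L1.
    apply: (integral_like_kop (integral_like_int mu)
      (K := fun h y => ind D (last_mark y) * h (first_marks y))).
    exact: (kop_comp (kop_mul (nL _ nD)) (kop_pull measurable_first_marks)).
  have iL2 : integral_like L2 by apply: integral_like_scale => //; exact: integral_like_int.
  have L12 D1 : (forall i, measurable (D1 i)) -> L1 (ind (tuple_rect D1)) = L2 (ind (tuple_rect D1)).
    move=> mD1; pose D2 i := if unlift ord_max i is Some j then D1 j else D.
    have mD2 i : measurable (D2 i) by rewrite /D2; case: unlift.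
    rewrite /L1 /L2 integral_ind; last exact: measurable_tuple_rect.
    rewrite kprodt_rect//.
    transitivity (mu (tuple_rect D2)).
      rewrite -integral_ind; last exact: measurable_tuple_rect.
      apply: eq_integral => y _; rewrite !ind_tuple_rect (bigD1_ord ord_max)//=.
      rewrite {1}/D2 unlift_none; congr (_ * _); apply: eq_bigr => i _.
      by rewrite /D2 liftK tnth_mktuple.
    rewrite kprodt_rect// (bigD1_ord ord_max)//= {1}/D2 unlift_none.
    rewrite [X in k X]tnth_nseq; congr (_ * _); apply: eq_bigr => i _.
    by rewrite /D2 liftK [X in k X]tnth_nseq [X in _ = k X _]tnth_nseq.
  apply: (integral_like_unique iL1 iL2 (tuple_rectsE _ _) (@tuple_rectsI _ _ _)) => //.
  - by move=> _ [D1 mD1 ->]; exact: L12.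
  - have [D1 mD1 D1E] := tuple_rectsT E M.
    by rewrite -(@indT R) D1E; exact: L12.
  - apply: (@le_lt_trans _ _ (\int[mu]_y 1)); last first.
      by rewrite integral_cst// mul1e prob_kernel ltry.
    apply: (il_le (integral_like_int mu)).
    + by apply: nnmfM; [exact: nL|exact: nnmf_cst].
    + exact: nnmf_cst.
    + by move=> y; rewrite mule1; exact: ind_le1.
pose L1 (g : E -> \bar R) := \int[mu]_y (f (first_marks y) * g (last_mark y)).
pose L2 (g : E -> \bar R) := (\int[kprodt k M (nseq_tuple M s)]_a f a) * \int[k s]_a g a.
apply: (@integral_like_eq R _ _ L1 L2) => //.
- apply: (integral_like_kop (integral_like_int mu)
    (K := fun g y => f (first_marks y) * g (last_mark y))).
  exact: (kop_comp (kop_mul (nF _ nf)) (kop_pull measurable_last_mark)).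
- by apply: integral_like_scale; [exact: nnmf_integral_ge0|exact: integral_like_int].
- by move=> D mD; rewrite /L1 /L2 step1// integral_ind.
Qed.

End split_marks.

(** * Poisson property from the Laplace functional *)

Section PRM_of_laplace.
Context {R : realType} d (T : measurableType d) (P : probability T R).
Context dS (S : measurableType dS) dX (X : measurableType dX).
Variables (xi : nat -> T -> S) (L : (S -> \bar R) -> \bar R) (X0 : set S).
Hypotheses (mxi : forall k, measurable_fun setT (xi k)) (iL : integral_like L)
  (LF : laplace_functional P xi L X0).
Variables (N : T -> set X -> \bar R) (nu : set X -> \bar R) (U : set X -> set S).
Hypotheses (mU : forall B, measurable B -> measurable (U B))
  (UX : forall B, U B `<=` X0)
  (UI : forall B B', B `&` B' = set0 -> U B `&` U B' = set0)
  (NE : forall t B, measurable B -> N t B = cnt xi (U B) t)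
  (nuE : forall B, measurable B -> nu B = L (ind (U B))).

(** A converse of [laplace_of_PRM]. The map [U] sends a set to a region of the space of [xi], so
    that the thinned process can be seen as a part of the marked one. *)
Lemma PRM_of_laplace : is_PRM P N nu.
Proof.
have NE' B : measurable B -> N ^~ B = cnt xi (U B) :> (T -> \bar R).
  by move=> mB; apply/funext => t; exact: NE.
split.
- by move=> B mB; rewrite NE'//; case: (@cntfun_cnt R _ _ _ _ _ mxi _ (mU mB)).
- move=> B m mB; rewrite nuE// => Loo.
  rewrite -(cnt_poisson mxi iL LF m (mU mB) (@UX B) Loo).
  by congr (P _); apply/seteqP; split => t; rewrite /lev /= NE.
- move=> B mB; rewrite nuE// => Loo.
  rewrite -(cnt_infinite mxi iL LF (mU mB) (@UX B) Loo).
  by congr (P _); apply/seteqP; split => t; rewrite /= NE.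
- move=> k B mB tB H HH.
  have HE i : cnt_sigma (R := R) xi (U (B i)) (H i).
    have [Y mY <-] := HH i; rewrite setTI NE'//; apply: cnt_sigma_preimage => //.
    exact: mU.
  have mH i : measurable (H i) by exact: (cnt_sigma_measurable mxi (HE i)).
  rewrite (_ : \bigcap_i H i = \big[setI/setT]_(i <- index_enum 'I_k) H i); last first.
    rewrite -bigcap_seq; apply/seteqP; split => t h i _; apply: h => //=.
    by rewrite mem_index_enum.
  rewrite (cnt_sigma_mutual mxi iL LF (R_ := fun i => U (B i)))//.
  + rewrite -prodEFin; apply: eq_bigr => i _; rewrite fineK//.
    by rewrite fin_num_measure.
  + exact: index_enum_uniq.
  + move=> i j ij; apply: UI; apply/seteqP; split => // x [Bi Bj].
    by move/eqP: ij; apply; apply: (tB i j) => //; exists x.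
Qed.

End PRM_of_laplace.

(** The finite-support sum is 0 by convention when infinitely many terms are nonzero. The events
    [F r], where all terms from [r] on vanish, reduce the remaining case to ordinary finite sums. *)
Lemma measurable_vec_fsum {R : realType} {n : nat} d (T : measurableType d)
    (a : nat -> T -> vec R n) (S : T -> set nat) :
  (forall k, measurable_fun setT (a k)) -> (forall k, measurable [set t | S t k]) ->
  measurable_fun setT
    (fun t => (\sum_(k \in S t) (a k t : 'rV[R]_n))%R : vec R n).
Proof.
move=> ma mS; pose b k t : vec R n := if `[< S t k >] then a k t else vec0.
have mb k : measurable_fun setT (b k).
  apply: measurable_fun_ifT => //.
  apply: (measurable_fun_bool true); rewrite setTI.
  rewrite (_ : _ @^-1` _ = [set t | S t k])//.
  by apply/seteqP; split => t /=; [move=> /asboolP|move=> ?; apply/asboolP].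
pose s r t : vec R n := (\sum_(k < r) (b k t : 'rV[R]_n))%R.
have ms r : measurable_fun setT (s r) by exact: measurable_vec_sum.
pose F r : set T := \bigcap_(k in [set k | (r <= k)%N]) [set t | b k t = vec0].
have mF r : measurable (F r).
  apply: bigcap_measurable => [|k _]; first by exists r => /=.
  by rewrite -[X in measurable X]setTI; exact: (mb k measurableT _ (measurable_vec1 _)).
have aE t : (\sum_(k \in S t) (a k t : 'rV[R]_n))%R = (\sum_(k \in setT) (b k t : 'rV[R]_n))%R.
  by rewrite fsbig_mkcond /=.
have sF r t : F r t -> (\sum_(k \in S t) (a k t : 'rV[R]_n))%R = s r t.
  move=> Frt; rewrite aE; transitivity (\sum_(k \in `I_r) (b k t : 'rV[R]_n))%R; last first.
    by rewrite -fsbig_ord.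
  apply/esym/fsbig_widen => // k [_ rk].
  by apply: Frt; rewrite /= leqNgt; exact/negP.
have nF t : ~ (exists r, F r t) -> (\sum_(k \in S t) (a k t : 'rV[R]_n))%R = 0%R.
  move=> nF; rewrite aE; apply: fsbig_dflt => /finite_seqP[q qE]; apply: nF.
  exists (\max_(k <- q) k).+1 => k /= qk; apply: contrapT => bk.
  have : k \in q by have : [set` q] k by rewrite -qE.
  by move=> kq; have := leq_trans qk (@leq_bigmax_seq nat q xpredT id k kq isT); rewrite ltnn.
move=> _ D mD; rewrite setTI.
rewrite (_ : _ @^-1` _ = (\bigcup_r (F r `&` (s r @^-1` D))) `|`
  (if `[< D vec0 >] then ~` \bigcup_r F r else set0)); last first.
  apply/seteqP; split => t /=.
    move=> Dt; have [[r Fr]|nFt] := pselect (exists r, F r t).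
      by left; exists r => //; split => //=; rewrite -(sF r).
    right; rewrite nF// in Dt; rewrite asboolT//= => -[r _ Fr]; apply: nFt.
    by exists r.
  move=> [[r _ [Fr]]|]; first by rewrite /= -(sF r).
  case: asboolP => // D0 nFt; rewrite nF// => -[r Fr]; apply: nFt.
  by exists r.
apply: measurableU.
  apply: bigcupT_measurable => r; apply: measurableI => //.
  by rewrite -[X in measurable X]setTI; exact: ms.
case: ifP => _ //; apply: measurableC; exact: bigcupT_measurable.
Qed.

(** * Thinning *)

Lemma bigsetI_finP (T : Type) (I : finType) (F : I -> set T) t :
  (\big[setI/setT]_i F i) t <-> forall i, F i t.
Proof.
rewrite -bigcap_seq; split => h i; first by apply: h => /=; rewrite mem_index_enum.
by move=> _; exact: h.
Qed.

Lemma measurable_pos {R : realType} d (T : measurableType d) (f : T -> R) :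
  measurable_fun setT f -> measurable [set t | (0 < f t)%R].
Proof.
move=> mf; rewrite (_ : [set t | _] = f @^-1` `]0%R, +oo[).
  by rewrite -[X in measurable X]setTI; exact: mf.
by apply/seteqP; split => t /=; rewrite in_itv/= andbT.
Qed.

Lemma integral_prob_kernel_cst {R : realType} d d' (X : measurableType d) (Y : measurableType d')
    (k : R.-pker X ~> Y) x (c : \bar R) : \int[k x]_y c = c.
Proof. by rewrite integral_cst// [X in _ * X](@prob_kernel _ _ _ _ _ k x) mule1. Qed.

Section thinning.
Context {R : realType} {n M : nat} {Omega : completePseudoMetricType R}.
Variables (B0 : probability (borel Omega) R) (rho : R -> Omega -> R).
Hypothesis rho_measurable : measurable_fun
  ([set x | (0 < x.1)%R] : set (R * borel Omega)%type) (fun x => rho x.1 x.2).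
Hypothesis rho_ge0 : forall (s : R) w, (0 < s)%R -> (0 <= rho s w)%R.
Variable G : R.-pker R ~> vec R n.
Context d (T : measurableType d) (P : probability T R).
Variables (tau : nat -> {RV P >-> R}) (w : nat -> {RV P >-> borel Omega}).
Hypothesis prm : is_PRM P (point_measure tau w) (levy_intensity rho B0).
Variable A : 'I_M.+1 -> nat -> {RV P >-> vec R n}.
Hypothesis A_marks : forall (H : set T) (r : nat) (D : 'I_M.+1 -> nat -> set (vec R n)),
  points_sigma tau w H -> (forall i k, measurable (D i k)) ->
  P (H `&` [set t | forall i k, (k < r)%N -> present tau t k -> D i k (A i k t)]) =
  \int[P]_(t in H) (\prod_(k < r | (0 < tau k t)%R) \prod_(i < M.+1)
     fine (G (tau k t) (D i k)))%:E.

Local Notation E := (vec R n).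
Local Notation X := (R * borel Omega)%type.
Local Notation S := (X * M.+1.-tuple E)%type.

Definition mpts := marked (pts tau w) (mks tau A).

Lemma measurable_mpts k : measurable_fun setT (mpts k).
Proof. apply: measurable_marked => i; [exact: measurable_pts|exact: measurable_mks]. Qed.

(** An observed point keeps its index but gets height 0 and thereby counts as absent, so the thinned
    process is enumerated by the original sequence. *)
Definition thin_height (z : S) : R := (\1_[set no_marks] (first_marks z.2) * z.1.1)%R.

Lemma measurable_thin_height : measurable_fun setT thin_height.
Proof.
apply: measurable_funM; last exact: measurableT_comp.
apply: measurableT_comp => //; first by apply: measurable_indic; exact: measurable_no_marks.
apply: measurableT_comp => //; exact: measurable_first_marks.
Qed.

Definition thin_tau_fun k t : R := thin_height (mpts k t).

Lemma measurable_thin_tau k : measurable_fun setT (thin_tau_fun k).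
Proof. exact: measurableT_comp measurable_thin_height (measurable_mpts k). Qed.

HB.instance Definition _ k := isMeasurableFun.Build _ _ _ _ (thin_tau_fun k) (measurable_thin_tau k).

Definition thin_tau k : {RV P >-> R} := thin_tau_fun k.

Definition new_fun t (B : set Omega) : 'rV[R]_n :=
  (\sum_(k \in [set k | present thin_tau t k /\ B (w k t)]) (A ord_max k t : 'rV[R]_n))%R.

Lemma measurable_new_fun : measurable_fun setT (new_fun : T -> vmeas n Omega).
Proof.
apply: (@measurability _ _ T (vmeas n Omega) setT new_fun (@eval_cylinders R n Omega)) => //.
move=> _ [_ [B [D [mB mD ->]]] <-]; rewrite setTI.
have mS k : measurable [set t | present thin_tau t k /\ B (w k t)].
  apply: measurableI.
    exact: (measurable_pos (measurable_thin_tau k)).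
  by rewrite -[X in measurable X]setTI; exact: measurable_funPT.
have mA k : measurable_fun setT (A ord_max k) by exact: measurable_funPT.
have := measurable_vec_fsum mA mS.
by move=> /(_ measurableT D mD); rewrite setTI.
Qed.

HB.instance Definition _ := isMeasurableFun.Build _ _ _ _ (new_fun : T -> vmeas n Omega) measurable_new_fun.

Definition new_part : {RV P >-> vmeas n Omega} := new_fun : T -> vmeas n Omega.

Lemma pker_zero s : (0 < s)%R -> G s [set vec0] = (1 - pi_A G s)%:E.
Proof.
move=> s0; have m0 : measurable ([set vec0] : set (vec R n)) by exact: measurable_vec1.
rewrite /pi_A (_ : [set a | _] = ~` [set vec0]); last first.
  by apply/seteqP; split => a /=; [move=> /eqP|move=> /eqP].
have := @prob_kernel _ _ _ _ _ G s; rewrite -(setvU [set vec0]) measureU//; last 2 first.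
- exact: measurableC.
- exact: setICl.
have f0 : G s [set vec0] \is a fin_num by exact: pker_fin.
have f1 : G s (~` [set vec0]) \is a fin_num by apply: pker_fin; exact: measurableC.
move: f0 f1; rewrite /=; set a := G s [set vec0]; set b := G s (~` [set vec0]).
by case: a => // a _; case: b => // b _ -[<-] /=; rewrite addrC addrK.
Qed.

Lemma kprodt_no_marks s :
  kprodt (gate G) M (nseq_tuple M s) [set no_marks] =
  if (0 < s)%R then ((1 - pi_A G s) ^+ M)%:E else 1.
Proof.
rewrite (_ : [set no_marks] = tuple_rect (fun=> [set vec0])); last first.
  by apply/seteqP; split => a /=; rewrite no_marksE.
rewrite kprodt_rect; last by move=> i; exact: measurable_vec1.
rewrite (eq_bigr (fun=> gate G s [set vec0])); last by move=> i _ /=; rewrite [tnth _ _]tnth_nseq.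
case: ifPn => s0; last by rewrite big1// => i _; rewrite gate_neg// mem_set.
under eq_bigr do rewrite gate_pos// pker_zero//.
by rewrite prodEFin prodr_const card_ord.
Qed.

Definition thinned (B : set X) : set S :=
  [set z | (B `&` @pos_points R Omega) z.1 /\ first_marks z.2 = no_marks].

Lemma measurable_thinned B : measurable B -> measurable (thinned B).
Proof.
move=> mB; apply: measurableI.
  rewrite -[X in measurable X]setTI; apply: measurable_fst => //.
  by apply: measurableI => //; exact: measurable_pos_points.
have mf : measurable_fun setT (fun z : S => first_marks z.2).
  by apply: measurableT_comp => //; exact: measurable_first_marks.
by rewrite -[X in measurable X]setTI; exact: (mf measurableT _ measurable_no_marks).
Qed.

(** The factor is the probability that M independent marks vanish; it is the one that turns [rho]
    into [rho_upd]. *)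
Lemma hat_thinned B x : measurable B ->
  mark_hat (mark_kernel G) (ind (thinned B)) x =
  ind (B `&` @pos_points R Omega) x * ((1 - pi_A G x.1) ^+ M)%:E.
Proof.
move=> mB; have nn : nnmf (ind [set no_marks] : M.-tuple E -> \bar R).
  by apply: nnmf_ind; exact: measurable_no_marks.
transitivity (ind (B `&` @pos_points R Omega) x *
    kprodt (gate G) M (nseq_tuple M x.1) [set no_marks]).
  rewrite -(integral_ind _ measurable_no_marks).
  have := integral_split_marks (gate G) x.1 nn (nnmf_cst E lee01).
  rewrite integral_cst// mul1e prob_kernel mule1 => <-.
  rewrite -nnmf_integralZl; last 2 first.
  - apply: nnmfM; last exact: nnmf_cst.
    by apply: nnmf_comp nn; exact: measurable_first_marks.
  - exact: ind_ge0.
  apply: eq_integral => y _; rewrite mule1.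
  have [h|h] := pselect ((B `&` @pos_points R Omega) x); last first.
    by rewrite (ind0 h) mul0e ind0// => -[].
  rewrite (ind1 h) mul1e.
  have [h'|h'] := pselect (first_marks y = no_marks); first by rewrite !ind1.
  by rewrite !ind0// => -[].
rewrite kprodt_no_marks; case: ifPn => // x0.
by rewrite ind0 ?mul0e// => -[_]; exact/negP.
Qed.

Lemma levy_intensity_thinned B : measurable B ->
  levy_intensity (rho_upd G rho M) B0 B =
  marked_intensity B0 rho G (m := M.+1) (ind (thinned B)).
Proof.
move=> mB; rewrite levy_intensityE; apply: eq_integral => w' _.
apply: eq_integral => s _; rewrite hat_thinned// /rho0 /rho_upd /=.
by case: ifP => _; rewrite ?mul0e// EFinM [X in X * _]muleC -muleA [X in _ * X]muleC.
Qed.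

Lemma point_measure_thinned t B : measurable B ->
  point_measure thin_tau w t B = cnt mpts (thinned B) t.
Proof.
move=> mB; rewrite point_measureE//; apply: eq_eseriesr => k _.
apply: ind_congr; split.
  move=> [Bk]; rewrite /pos_points /= /thin_tau /thin_tau_fun /thin_height => h.
  move: h Bk; rewrite indicE /pts /= /thin_tau /thin_tau_fun /thin_height indicE.
  have [/set_mem h|_] := boolP (_ \in _); last by rewrite mul0r ltxx.
  by rewrite mul1r => ? ?; split.
move=> [[Bk p0] h]; rewrite /pts /= /thin_tau /thin_tau_fun /thin_height indicE.
by rewrite mem_set// mul1r.
Qed.

Lemma thinned_PRM : is_PRM P (point_measure thin_tau w) (levy_intensity (rho_upd G rho M) B0).
Proof.
apply: (PRM_of_laplace measurable_mpts
  (marked_intensity_il (m := M.+1) B0 rho_measurable rho_ge0 G)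
  (marked_laplace rho_measurable rho_ge0 prm A_marks) (U := thinned)).
- exact: measurable_thinned.
- by move=> B z [[_ h] _]; split.
- move=> B B' BB; apply/seteqP; split => // z [[[Bz _] _] [[Bz' _] _]].
  by have : (B `&` B') z.1 by []; rewrite BB.
- exact: point_measure_thinned.
- exact: levy_intensity_thinned.
Qed.

Lemma hat_split (x : X) (c1 c2 : \bar R) (g : E -> \bar R) : 0 <= c1 -> 0 <= c2 -> nnmf g ->
  \int[mark_kernel G (m := M.+1) x]_y (if first_marks y == no_marks then c1 * g (last_mark y) else c2) =
  c1 * (kprodt (gate G) M (nseq_tuple M x.1) [set no_marks] * \int[gate G x.1]_a g a) +
  c2 * kprodt (gate G) M (nseq_tuple M x.1) (~` [set no_marks]).
Proof.
move=> c10 c20 ng; have m0 := @measurable_no_marks R n M.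
have nn : nnmf (ind [set no_marks] : M.-tuple E -> \bar R) by exact: nnmf_ind.
have nc : nnmf (ind (~` [set no_marks]) : M.-tuple E -> \bar R).
  by apply: nnmf_ind; exact: measurableC.
have E1 := integral_split_marks (gate G) x.1 nn ng.
have E2 := integral_split_marks (gate G) x.1 nc (nnmf_cst E lee01).
rewrite integral_ind// in E1; rewrite integral_ind in E2; last exact: measurableC.
rewrite integral_cst// mul1e prob_kernel mule1 in E2.
have n1 : nnmf (fun y : M.+1.-tuple E => ind [set no_marks] (first_marks y) * g (last_mark y)).
  apply: nnmfM; first by apply: nnmf_comp nn; exact: measurable_first_marks.
  by apply: nnmf_comp ng; exact: measurable_last_mark.
have n2 : nnmf (fun y : M.+1.-tuple E => ind (~` [set no_marks]) (first_marks y) * (1 : \bar R)).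
  apply: nnmfM; last exact: nnmf_cst.
  by apply: nnmf_comp nc; exact: measurable_first_marks.
rewrite -E1 -E2 -(nnmf_integralZl _ n1 c10) -(nnmf_integralZl _ n2 c20).
rewrite -(ilD (integral_like_int _)); last 2 first.
- by apply: nnmfM => //; exact: nnmf_cst.
- by apply: nnmfM => //; exact: nnmf_cst.
apply: eq_integral => y _; case: eqP => h.
  by rewrite (ind1 (A := [set no_marks]))// mul1e ind0 ?mul0e ?mule0 ?adde0// => /(_ h).
by rewrite (ind0 (A := [set no_marks]))// mul0e mule0 add0e ind1// mule1 mule1.
Qed.

Definition thin_pt (z : S) : X := (thin_height z, z.1.2).

Lemma measurable_thin_pt : measurable_fun setT thin_pt.
Proof.
apply: measurable_fun_pair; first exact: measurable_thin_height.
by apply: measurableT_comp.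
Qed.

(** The flag [b] tells whether the index carries a mark condition; f then acts only at a point that
    survives thinning. *)
Definition thin_weight (f : S -> \bar R) (b : bool) (z : S) : \bar R :=
  if b && (0 < thin_height z)%R then f z else 1.

Lemma unit_fun_thin_weight f b : unit_fun f -> unit_fun (thin_weight f b).
Proof.
move=> [[mf f0] f1]; split; last by move=> z; rewrite /thin_weight; case: ifP.
split; last by move=> z; rewrite /thin_weight; case: ifP.
apply: measurable_fun_ifT => //; apply: measurable_and => //.
by apply: measurable_fun_ltr => //; exact: measurable_thin_height.
Qed.

(** Thinning is decided by the first M marks, of which the last one is independent. Hence at a
    surviving point the indicator of [D] may be replaced by its probability under [G]. *)
Lemma hat_thin_weight (B : set X) (D : set E) b x : measurable B -> measurable D ->
  mark_hat (mark_kernel G) (fun z => ind B (thin_pt z) * thin_weight (fun z => ind D (last_mark z.2)) b z) x =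
  mark_hat (mark_kernel G) (fun z => ind B (thin_pt z) * thin_weight (fun z => G (thin_height z) D) b z) x.
Proof.
move=> mB mD; have [/andP[/= -> x0]|nbx] := boolP (b && (0 < x.1)%R); last first.
  apply: eq_integral => y _; congr (_ * _); rewrite /thin_weight.
  case: ifPn => // /andP[/= bb h]; exfalso; move: nbx; rewrite bb /=.
  move: h; rewrite /thin_height indicE; case: (_ \in _); last by rewrite mul0r ltxx.
  by rewrite mul1r => ->.
have c1 : 0 <= ind B x :> \bar R by exact: ind_ge0.
have c2 : 0 <= ind B (0%R, x.2) :> \bar R by exact: ind_ge0.
(* The thinned point is x itself when the first marks vanish and has height 0 otherwise; only the
   first case involves f. *)
have key f g : (forall y, first_marks y = no_marks -> f (x, y) = g (last_mark y)) -> nnmf g ->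
   mark_hat (mark_kernel G (m := M.+1)) (fun z => ind B (thin_pt z) * thin_weight f true z) x =
   ind B x * (kprodt (gate G) M (nseq_tuple M x.1) [set no_marks] * \int[gate G x.1]_a g a) +
   ind B (0%R, x.2) * kprodt (gate G) M (nseq_tuple M x.1) (~` [set no_marks]).
  move=> fg ng; rewrite -hat_split//; apply: eq_integral => y _.
  rewrite /thin_weight /thin_pt /= /thin_height /= indicE.
  case: eqP => h; last by rewrite memNset// mul0r ltxx mule1.
  by rewrite mem_set// mul1r x0 fg// -surjective_pairing.
have n1 : nnmf (ind D : E -> \bar R) by exact: nnmf_ind.
have n2 : nnmf (fun _ : E => G x.1 D) by apply: nnmf_cst; exact: measure_ge0.
rewrite (key _ (ind D) _ n1)// (key _ (fun=> G x.1 D) _ n2).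
  by rewrite integral_ind// integral_prob_kernel_cst gate_pos.
by move=> y h; rewrite /thin_height /= indicE mem_set// mul1r.
Qed.

(** The bound r <= q lets r mark conditions share one product over q indices with the conditions on
    points. *)
Definition thin_cylinders (r : nat) : set (set T) :=
  [set H | exists q (B : nat -> set X), [/\ (r <= q)%N, (forall k, measurable (B k)) &
    H = \big[setI/setT]_(k < q) (pts thin_tau w k @^-1` B k)]].

Lemma measurable_thin_pts k : measurable_fun setT (pts thin_tau w k).
Proof. exact: measurable_pts. Qed.

Lemma thin_cylinders_measurable r : thin_cylinders r `<=` measurable.
Proof.
move=> _ [q [B [_ mB ->]]]; apply: bigsetI_measurable => k _.
by rewrite -[X in measurable X]setTI; exact: measurable_thin_pts.
Qed.

Lemma thin_cylindersI r : setI_closed (thin_cylinders r).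
Proof.
move=> _ _ [q [B [rq mB ->]]] [q' [B' [rq' mB' ->]]].
exists (maxn q q'), (fun k => (if (k < q)%N then B k else setT) `&` (if (k < q')%N then B' k else setT)).
split; first by rewrite leq_max rq.
  by move=> k; apply: measurableI; case: ifP.
apply/seteqP; split => t.
  move=> [/bigsetI_finP h /bigsetI_finP h']; apply/bigsetI_finP => k.
  by split; case: ifP => // kq; [exact: (h (Ordinal kq))|exact: (h' (Ordinal kq))].
move=> /bigsetI_finP h; split; apply/bigsetI_finP => k.
  have kq := leq_trans (ltn_ord k) (leq_maxl q q').
  by have [] := h (Ordinal kq); rewrite /= ltn_ord.
have kq := leq_trans (ltn_ord k) (leq_maxr q q').
by have [_] := h (Ordinal kq); rewrite /= ltn_ord.
Qed.

Lemma points_sigma_thin r : points_sigma thin_tau w `<=` <<s thin_cylinders r >>.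
Proof.
apply: smallest_sub; first exact: smallest_sigma_algebra.
move=> H [k _ [B mB <-]]; rewrite setTI; apply: sub_sigma_algebra.
exists (maxn r k.+1), (fun i => if i == k then B else setT); split.
- exact: leq_maxl.
- by move=> i; case: ifP.
- apply/seteqP; split => t.
    by move=> Bt; apply/bigsetI_finP => i /=; case: eqP => // ->.
  by move=> /bigsetI_finP/(_ (Ordinal (leq_maxr _ _ : (k < maxn r k.+1)%N))); rewrite /= eqxx.
Qed.

Lemma thin_tau_gt0 k t : (0 < thin_tau k t)%R -> (0 < tau k t)%R.
Proof.
rewrite /thin_tau /= /thin_tau_fun /thin_height indicE; case: (_ \in _).
  by rewrite mul1r.
by rewrite mul0r ltxx.
Qed.

Lemma new_part_cylinder q (B : nat -> set X) (D : nat -> set E) r :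
  (forall k, measurable (B k)) -> (forall k, measurable (D k)) -> (r <= q)%N ->
  \int[P]_t (ind (\big[setI/setT]_(k < q) (pts thin_tau w k @^-1` B k)) t *
    ind [set t | forall k, (k < r)%N -> present thin_tau t k -> D k (A ord_max k t)] t) =
  \int[P]_t (ind (\big[setI/setT]_(k < q) (pts thin_tau w k @^-1` B k)) t *
    \prod_(k < r | (0 < thin_tau k t)%R) G (thin_tau k t) (D k)).
Proof.
move=> mB mD rq.
pose phi k z := ind (B k) (thin_pt z) * thin_weight (fun z => ind (D k) (last_mark z.2)) (k < r)%N z.
pose psi k z := ind (B k) (thin_pt z) * thin_weight (fun z => G (thin_height z) (D k)) (k < r)%N z.
have uB k : unit_fun (fun z => ind (B k) (thin_pt z)).
  split; last by move=> z; exact: ind_le1.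
  by apply: nnmf_comp; [exact: measurable_thin_pt|exact: nnmf_ind].
have uM f g : unit_fun f -> unit_fun g -> unit_fun (fun z : S => f z * g z).
  move=> [nf f1] [ng g1]; split; first exact: nnmfM.
  by move=> z; rewrite -[leRHS]mule1; apply: lee_pmul => //; [case: nf|case: ng].
have uphi k : unit_fun (phi k).
  apply: uM => //; apply: unit_fun_thin_weight; split; last by move=> z; exact: ind_le1.
  apply: nnmf_comp (nnmf_ind (mD k)).
  by apply: measurableT_comp => //; exact: measurable_last_mark.
have upsi k : unit_fun (psi k).
  apply: uM => //; apply: unit_fun_thin_weight; split; last by move=> z; exact: pker_le1.
  split; last by move=> z; exact: measure_ge0.
  exact: measurableT_comp (measurable_kernel G _ (mD k)) measurable_thin_height.
have mp := marking_prod (measurable_pts (P := P) tau w) (measurable_mks tau A)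
  (tuple_rectsE _ _) (@tuple_rectsI _ _ _) (tuple_rectsT _ _) (mks_marks A_marks).
have inB t : ind (\big[setI/setT]_(k < q) (pts thin_tau w k @^-1` B k)) t =
    \prod_(k < q) ind (B k) (thin_pt (mpts k t)) :> \bar R.
  by rewrite ind_bigsetI; apply: eq_bigr => k _; apply: ind_congr.
have prodE (f : nat -> S -> \bar R) t :
    \prod_(k < q) (ind (B k) (thin_pt (mpts k t)) * thin_weight (f k) (k < r)%N (mpts k t)) =
    ind (\big[setI/setT]_(k < q) (pts thin_tau w k @^-1` B k)) t *
    \prod_(k < r | (0 < thin_tau k t)%R) f k (mpts k t).
  rewrite big_split inB; congr (_ * _).
  rewrite (big_ord_widen_cond q (fun k => (0 < thin_tau k t)%R) (fun k => f k (mpts k t)))//.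
  rewrite [RHS]big_mkcond; apply: eq_bigr => k _.
  by rewrite /thin_weight andbC.
transitivity (\int[P]_t \prod_(k < q) phi k (mpts k t)).
  apply: eq_integral => t _; rewrite (prodE (fun k z => ind (D k) (last_mark z.2))); congr (_ * _).
  have [h|/existsNP[k /not_implyP[kr /not_implyP[pk nD]]]] := pselect
      (forall k, (k < r)%N -> present thin_tau t k -> D k (A ord_max k t)).
    rewrite ind1// big1// => k pk; rewrite ind1// /last_mark tnth_mktuple.
    by rewrite (thin_tau_gt0 pk); exact: h.
  rewrite ind0; last by move=> /(_ k kr pk).
  rewrite (bigD1 (Ordinal kr))//= ind0 ?mul0e// /last_mark tnth_mktuple.
  by rewrite (thin_tau_gt0 pk).
apply: etrans (mp q phi uphi) _.
transitivity (\int[P]_t \prod_(k < q) psi k (mpts k t)); last first.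
  by apply: eq_integral => t _; rewrite (prodE (fun k z => G (thin_height z) (D k))).
apply: etrans _ (esym (mp q psi upsi)); apply: eq_integral => t _; apply: eq_bigr => k _.
exact: hat_thin_weight.
Qed.

(** Cylinders in the thinned points form a pi-system whose sigma-algebra contains
    [points_sigma thin_tau w], so the identity for cylinders extends to every event H of the thinned
    points. *)
Lemma new_part_IBP : iid_IBP G thin_tau w (fun _ : 'I_1 => new_part).
Proof.
exists (fun _ k => A ord_max k); split; last by move=> i; apply: aeW => t B mB.
move=> H r D sH mD; pose D0 := D ord0.
pose Ev := [set t | forall k, (k < r)%N -> present thin_tau t k -> D0 k (A ord_max k t)].
have mEv : measurable Ev.
  rewrite (_ : Ev = \big[setI/setT]_(k < r) (~` [set t | (0 < thin_tau k t)%R] `|` (A ord_max k @^-1` D0 k))).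
    apply: bigsetI_measurable => k _; apply: measurableU.
      by apply: measurableC; exact: (measurable_pos (measurable_thin_tau k)).
    by rewrite -[X in measurable X]setTI; apply: measurable_funPT => //; exact: mD.
  apply/seteqP; split => t.
    move=> h; apply/bigsetI_finP => k.
    by have [pk|pk] := pselect (0 < thin_tau k t)%R; [right; exact: h|left].
  by move=> /bigsetI_finP h k kr pk; have [] := h (Ordinal kr).
pose W t := \prod_(k < r | (0 < thin_tau k t)%R) G (thin_tau k t) (D0 k).
have nW : nnmf W.
  rewrite (_ : W = fun t => \prod_(k < r) thin_weight (fun z => G (thin_height z) (D0 k)) true (mpts k t)).
    apply: nnmf_prod => k; apply: nnmf_comp; first exact: measurable_mpts.
    apply: (proj1 (unit_fun_thin_weight _ _)); split.
      split; last by move=> z; exact: measure_ge0.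
      exact: measurableT_comp (measurable_kernel G _ (mD _ _)) measurable_thin_height.
    by move=> z; apply: pker_le1; exact: mD.
  by apply/funext => t; rewrite /W big_mkcond.
have mH : measurable H.
  suff : points_sigma thin_tau w `<=` measurable by exact.
  apply: smallest_sub; first exact: sigma_algebra_measurable.
  by move=> _ [k _ [B mB <-]]; exact: measurable_thin_pts.
have nE : nnmf (ind Ev : T -> \bar R) by exact: nnmf_ind.
transitivity (\int[P]_t (ind Ev t * ind H t)).
  rewrite (_ : [set t | _] = Ev); last first.
    apply/seteqP; split => t h; first by move=> k kr pk; exact: h.
    by move=> i k kr pk; rewrite (ord1 i); exact: h.
  rewrite -integral_ind; last exact: measurableI.
  by apply: eq_integral => t _; rewrite muleC -indI.
transitivity (\int[P]_t (W t * ind H t)); last first.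
  under eq_integral do rewrite muleC.
  rewrite integral_ind_mul//; apply: eq_integral => t _; rewrite -prodEFin.
  apply: eq_bigr => k _; rewrite big_ord1 fineK//; exact: pker_fin.
have swap (V : T -> \bar R) (H' : set T) :
    \int[P]_t (V t * ind H' t) = \int[P]_t (ind H' t * V t).
  by apply: eq_integral => t _; rewrite muleC.
(* The full space written as a cylinder with r factors; this instance compares the total masses. *)
pose q0 := \big[setI/setT]_(k < r) (pts thin_tau w k @^-1` setT).
have q0E : q0 = setT by rewrite /q0 big1// => k _; rewrite preimage_setT.
apply: (integral_like_sigma (L1 := fun f => \int[P]_t (ind Ev t * f t))
  (L2 := fun f => \int[P]_t (W t * f t)) _ _ (@thin_cylinders_measurable r) (@thin_cylindersI r)).
- exact: (integral_like_kop (integral_like_int P) (kop_mul nE)).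
- exact: (integral_like_kop (integral_like_int P) (kop_mul nW)).
- move=> _ [q [B [rq mB ->]]]; rewrite [LHS]swap [RHS]swap.
  by apply: new_part_cylinder => // k; exact: mD.
- have := @new_part_cylinder r (fun=> setT) D0 r (fun=> measurableT) (mD _) (leqnn _).
  rewrite -/q0 q0E => h; apply: etrans (etrans _ h) _; apply: eq_integral => t _.
    by rewrite indT mul1e mule1.
  by rewrite indT mul1e mule1.
- apply: unit_fun_prob_lty; split; first by apply: nnmfM => //; exact: nnmf_cst.
  by move=> t; rewrite mule1; exact: ind_le1.
- exact: points_sigma_thin.
Qed.

Lemma new_part_law : is_IBP_law G (rho_upd G rho M) B0 (distribution P new_part).
Proof.
exists d, T, P, thin_tau, w.
exists (fun t B => \esum_(k in present thin_tau t) (thin_tau k t)%:E * \d_(w k t : borel Omega) B).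
exists (fun _ => new_part); split => //; last exact: new_part_IBP.
by split => //; exact: thinned_PRM.
Qed.

End thinning.

(** * Counts and simple point processes *)

Section point_process_counts.
Context {R : realType} d (T : measurableType d) (P : probability T R).
Context dS (S : measurableType dS) (xi : nat -> T -> S).
Hypothesis mxi : forall k, measurable_fun setT (xi k).
Variables (L : (S -> \bar R) -> \bar R) (X0 : set S).
Hypotheses (iL : integral_like L) (LF : laplace_functional P xi L X0).

Local Notation cntf U := (cnt xi U : T -> \bar R).

Lemma poisson_prob1 (r : R) m : (0 <= r)%R ->
  poisson_prob r 0%N [set m] = (r ^+ m * m`!%:R^-1 * expR (- r))%:E.
Proof.
rewrite le_eqVlt => /predU1P[<-|r0]; rewrite /= /poisson_prob; last first.
  by rewrite r0 esum_set1 ?lee_fin ?poisson_pmf_ge0// /poisson_pmf r0.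
rewrite ltxx diracE oppr0 expR0 mulr1; case: m => [|m].
  by rewrite mem_set// expr0 mul1r fact0 invr1.
by rewrite memNset// exprS !mul0r.
Qed.

Lemma cnt_lev U m : measurable U -> U `<=` X0 -> L (ind U) < +oo ->
  P (lev (cntf U) m) = ((fine (L (ind U))) ^+ m * m`!%:R^-1)%:E * lap (L (ind U)).
Proof.
move=> mU UX Loo; rewrite (cnt_poisson mxi iL LF)//.
have L0 : 0 <= L (ind U) by apply: (il_ge0 iL); exact: nnmf_ind.
have Lf : L (ind U) \is a fin_num by rewrite ge0_fin_numE.
rewrite poisson_prob1 ?fine_ge0// EFinM; congr (_ * _).
by rewrite -[in RHS](fineK Lf).
Qed.

(** The Poisson probabilities of the finite levels add up to 1. *)
Lemma cnt_lty U : measurable U -> U `<=` X0 -> L (ind U) < +oo ->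
  P.-negligible [set t | cntf U t = +oo].
Proof.
move=> mU UX Loo; have [mN NN] := cntfun_cnt (R := R) mxi mU.
have mlev m : measurable (lev (cntf U) m) by exact: measurable_lev.
rewrite (_ : [set t | _] = ~` \bigcup_m lev (cntf U) m); last first.
  apply/seteqP; split => t /=; first by move=> ct [m _]; rewrite /lev /= ct.
  by case: (NN t) => [//|[m ct] nt]; exfalso; apply: nt; exists m.
have mB : measurable (\bigcup_m lev (cntf U) m).
  exact: bigcupT_measurable.
suff PB : P (~` \bigcup_m lev (cntf U) m) = 0 by apply/negligibleP => //; exact: measurableC.
rewrite probability_setC//.
have -> : P (\bigcup_m lev (cntf U) m) = poisson_prob (fine (L (ind U))) 0%N (\bigcup_m [set m]).
  rewrite !measure_semi_bigcup//; last 2 first.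
  - by move=> i j _ _ [t [-> ->]].
  - by move=> i j _ _ [t []]; rewrite /lev /= => -> [] /eqP; rewrite eqr_nat => /eqP.
  by apply: eq_eseriesr => m _; exact: (cnt_poisson mxi iL LF).
rewrite (_ : \bigcup_m [set m] = setT) ?probability_setT ?subee//.
by apply/seteqP; split => // m _; exists m.
Qed.

Lemma cnt_ge2 U : measurable U -> U `<=` X0 -> L (ind U) < +oo ->
  P [set t | 2%:R%:E <= cntf U t] <= L (ind U) * L (ind U).
Proof.
move=> mU UX Loo; have [mN NN] := cntfun_cnt (R := R) mxi mU.
have mlev m : measurable (lev (cntf U) m) by exact: measurable_lev.
rewrite (_ : [set t | _] = ~` (lev (cntf U) 0 `|` lev (cntf U) 1)); last first.
  apply/seteqP; split => t /=; rewrite /lev /=.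
    by move=> c2; case=> ct; move: c2; rewrite ct lee_fin ler_nat.
  move=> nt; have [->|[m ct]] := NN t; first exact: leey.
  rewrite ct lee_fin ler_nat; move: m ct => [|[|m]]// ct; exfalso; apply: nt; rewrite ct; [left|right] => //.
rewrite probability_setC; last exact: measurableU.
have dj : lev (cntf U) 0 `&` lev (cntf U) 1 = set0.
  by apply/seteqP; split => // t []; rewrite /lev /= => -> [] /eqP; rewrite eqr_nat.
have -> := etrans (measureU P (mlev 0%N) (mlev 1%N) dj)
  (congr2 adde (cnt_lev 0 mU UX Loo) (cnt_lev 1 mU UX Loo)).
have L0 : 0 <= L (ind U) by apply: (il_ge0 iL); exact: nnmf_ind.
have Lf : L (ind U) \is a fin_num by rewrite ge0_fin_numE.
have [r r0 ->] : exists2 r : R, (0 <= r)%R & L (ind U) = r%:E.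
  by exists (fine (L (ind U))); rewrite ?fine_ge0// fineK.
rewrite lapE [fine _]/= -!EFinM -!EFinD lee_fin !fact0 factS fact0 !invr1 expr0 expr1 !mulr1 mul1r.
(* From exp (- r) >= 1 - r follows 1 - (1 + r) exp (- r) <= 1 - (1 + r) (1 - r) = r ^ 2. *)
have := expR_ge1Dx (- r); nra.
Qed.

(** Sums of f over the points are limits of combinations of counts of regions inside [A], hence
    functions of the points in [A] alone. *)
Lemma nnmf_psum_sigma (A : set S) (f : S -> \bar R) : nnmf f -> (forall z, ~ A z -> f z = 0) ->
  nnmf (psum xi f : g_sigma_algebraType (cnt_pi (R := R) xi A) -> \bar R).
Proof.
move=> nf fA; pose a := nnsfun_approx measurableT (proj1 nf).
have f0 := proj2 nf.
have aE x : f x = limn (fun n => (a n x)%:E).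
  by apply/esym/cvg_lim => //; apply: cvg_nnsfun_approx.
have na n : nnmf (fun x => (a n x)%:E).
  by split; [apply/measurable_EFinP; exact: measurable_funPT|move=> x; rewrite lee_fin].
have ndaE x : nondecreasing_seq (fun n => (a n x)%:E).
  by move=> m n mn; rewrite lee_fin; exact/(lefP _ _ (nd_nnsfun_approx _ _ mn)).
have a0 n x : ~ A x -> a n x = 0%R.
  move=> /fA fx0; apply/eqP; rewrite eq_le; apply/andP; split => //.
  rewrite -lee_fin -[leRHS]fx0 aE; apply: lime_ge; first exact: ereal_nondecreasing_is_cvgn.
  by exists n => // m /= nm; exact: ndaE.
rewrite (_ : psum xi f = fun t => limn (fun n => psum xi (fun x => (a n x)%:E) t)); last first.
  apply/funext => t; rewrite (_ : f = fun x => limn (fun n => (a n x)%:E)); last exact/funext.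
  by rewrite (il_lim (psum_il xi t)).
apply: nnmf_lim => [n|t m n mn]; last first.
  by apply: (il_le (psum_il xi t)) => // x; exact: ndaE.
pose s : seq R := finmap.enum_fset (fset_set (range (a n))).
have nn (y : R) : nnmf (fun x => (Num.max 0 y)%:E * ind (a n @^-1` [set y]) x).
  apply: nnmfM; first by apply: nnmf_cst; rewrite lee_fin le_max lexx.
  exact: nnmf_ind.
rewrite (_ : psum xi _ = fun t => \sum_(y <- s) (Num.max 0 y)%:E * cnt xi (a n @^-1` [set y]) t); last first.
  apply/funext => t; rewrite (_ : (fun x => (a n x)%:E) = fun x => \sum_(y <- s)
      (Num.max 0 y)%:E * ind (a n @^-1` [set y]) x); last first.
    apply/funext => x; rewrite fimfunE fsbig_finite//= -sumEFin.
    apply: eq_big_seq => y; rewrite in_fset_set// inE => -[z _ <-].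
    by rewrite max_r// EFinM.
  rewrite (il_sum _ _ (psum_il xi t))//; apply: eq_bigr => y _.
  by rewrite (ilZ (psum_il xi t)) ?le_max ?lexx//; exact: nnmf_ind.
(* Level sets of positive values lie in [A]. The level set of 0 may not, but its coefficient
   vanishes. *)
apply: nnmf_sum => y; have [y0|y0] := ltP 0%R y; last first.
  rewrite (_ : (fun t => _) = fun=> 0); first exact: nnmf_cst.
  by apply/funext => t; rewrite mul0e.
apply: nnmfM; first by apply: nnmf_cst; rewrite lee_fin ltW.
split; last by move=> t; exact: (natlike_ge0 (natlike_cnt xi _)).
move=> _ Y mY; rewrite setTI; apply: cnt_sigma_preimage; first exact: measurable_funPTI.
by move=> x /= axy; apply: contrapT => /(a0 n) h; move: y0; rewrite -axy h ltxx.
Qed.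

Context {Omega : completePseudoMetricType R}.
Hypothesis hO : hausdorff_space Omega.
Variable B : nat -> set Omega.
Hypothesis bB : countable_base B.
Variables (U : set S) (h : S -> borel Omega).
Hypotheses (mh : measurable_fun setT h) (mU : measurable U) (UX : U `<=` X0)
  (Uoo : L (ind U) < +oo) (Uatom : forall x : Omega, L (ind (U `&` h @^-1` [set x])) = 0).

Let cell p b := U `&` h @^-1` (@base_cell R Omega B p b).
Let cocell p b := U `\` h @^-1` (@base_cell R Omega B p b).

Let mhcell p b : measurable (h @^-1` (@base_cell R Omega B p b)).
Proof. by rewrite -[X in measurable X]setTI; apply: mh => //; exact: measurable_base_cell. Qed.

Let mcell p b : measurable (@cell p b). Proof. exact: measurableI. Qed.
Let mcocell p b : measurable (@cocell p b). Proof. exact: measurableD. Qed.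

Let Lfin V : measurable V -> V `<=` U -> L (ind V) < +oo.
Proof.
move=> mV VU; apply: le_lt_trans Uoo; apply: (il_le iL); try exact: nnmf_ind.
by move=> z; apply: le_ind; exact: VU.
Qed.

(* The probability that two points of U share the image x under h is bounded,
   at each depth p, by the sum of the squared cell masses; non-atomicity makes
   this sum tend to 0. *)
Lemma distinct_points : P.-negligible [set t | exists k k' : nat,
  [/\ k <> k', U (xi k t), U (xi k' t) & h (xi k t) = h (xi k' t)]].
Proof.
pose Ev p := \bigcup_(b in [set: p.-tuple bool]) [set t | 2%:R%:E <= cntf (@cell p b) t].
have mge p b : measurable [set t | 2%:R%:E <= cntf (@cell p b) t].
  by have [mN _] := cntfun_cnt (R := R) mxi (@mcell p b); exact: (measurable_gev 2 mN).
have mEv p : measurable (Ev p) by apply: fin_bigcup_measurable.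
pose N := \bigcap_p Ev p.
have mN : measurable N by exact: bigcapT_measurable.
exists N; split => //; last first.
  move=> t [k [k' [kk' Uk Uk' hkk']]] p _; exists (base_code B p (h (xi k t))) => //=.
  set b := base_code _ _ _.
  have ck : @cell p b (xi k t) by split.
  have ck' : @cell p b (xi k' t) by split => //; rewrite /= /base_cell /= -hkk'.
  have i0 j : 0 <= ind (@cell p b) (xi j t) :> \bar R by exact: ind_ge0.
  rewrite /cnt /psum (@nneseriesD1 R _ k)// (ind1 ck).
  rewrite (@nneseriesD1 R _ k')//=; last by apply/eqP => /esym.
  by rewrite (ind1 ck') addeA -EFinD leeDl// nneseries_ge0.
pose l0 := L (ind U).
have l00 : 0 <= l0 by apply: (il_ge0 iL); exact: nnmf_ind.
have lsplit p b : L (ind (@cell p b)) + L (ind (@cocell p b)) = l0.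
  rewrite -(ilD iL); [|exact: nnmf_ind..]; congr L; apply/funext => z.
  have [Uz|Uz] := pselect (U z); last by rewrite !ind0 ?adde0// => -[].
  rewrite (ind1 Uz); have [c|c] := pselect ((h @^-1` (@base_cell R Omega B p b)) z).
    by rewrite ind1// ind0 ?adde0// => -[].
  by rewrite ind0 ?add0e ?ind1// => -[].
(* On [U] this is the mass of the part of [U] outside the depth-p cell of z. The sum of the squared
   cell masses and [L (f p)] is at most l0 * l0, so it is enough that [L (f p)] increases to l0 *
   l0. *)
pose f p z := \sum_(b : p.-tuple bool) L (ind (@cocell p b)) * ind (@cell p b) z.
have c0 p b : 0 <= L (ind (@cocell p b)) by apply: (il_ge0 iL); exact: nnmf_ind.
have nf p : nnmf (f p).
  apply: nnmf_sum => b; apply: nnmfM; last exact: nnmf_ind.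
  exact: nnmf_cst.
have fE p z : U z -> f p z = L (ind (@cocell p (base_code B p (h z)))).
  move=> Uz; rewrite /f (bigD1 (base_code B p (h z)))//= ind1// mule1 big1 ?adde0// => b bz.
  by rewrite ind0 ?mule0// => -[_] /= /esym/eqP; apply/negP.
have f0 p z : ~ U z -> f p z = 0.
  by move=> Uz; rewrite /f big1// => b _; rewrite ind0 ?mule0// => -[].
have code_le p q x y : (p <= q)%N -> base_code B q x = base_code B q y -> base_code B p x = base_code B p y.
  move=> pq xy; apply: eq_from_tnth => i.
  by have := congr1 (fun b => tnth b (widen_ord pq i)) xy; rewrite !tnth_mktuple.
have cocell_le p q z z' : (p <= q)%N -> @cocell p (base_code B p (h z)) z' -> @cocell q (base_code B q (h z)) z'.
  move=> pq [Uz' nz']; split => // qz; apply: nz'; exact: code_le pq qz.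
have ndf z : nondecreasing_seq (f ^~ z).
  move=> p q pq; have [Uz|Uz] := pselect (U z); last by rewrite !f0.
  rewrite !fE//; apply: (il_le iL); [exact: nnmf_ind..|].
  by move=> z'; apply: le_ind; exact: cocell_le.
(* The cells shrink to the fibre of h through z, which has mass 0 by [Uatom]. *)
have limf z : limn (f ^~ z) = l0 * ind U z.
  have [Uz|Uz] := pselect (U z); last first.
    by rewrite ind0// mule0 (_ : (fun p => f p z) = fun=> 0) ?lim_cst//; apply/funext => p; rewrite f0.
  rewrite ind1// mule1.
  rewrite (_ : (fun p => f p z) = fun p => L (ind (@cocell p (base_code B p (h z))))); last first.
    by apply/funext => p; rewrite fE.
  rewrite -(il_lim iL); last 2 first.
  - by move=> p; exact: nnmf_ind.
  - by move=> z' p q pq; apply: le_ind; exact: cocell_le.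
  have mpt : measurable (U `&` h @^-1` [set h z]).
    apply: measurableI => //; rewrite -[X in measurable X]setTI; apply: mh => //.
    exact: measurable_point.
  have nlim : nnmf (fun x => limn (fun p => ind (@cocell p (base_code B p (h z))) x) : \bar R).
    apply: nnmf_lim => [p|z' p q pq]; first exact: nnmf_ind.
    by apply: le_ind; exact: cocell_le.
  rewrite -[LHS]adde0 -(Uatom (h z)) -(ilD iL)//; last exact: nnmf_ind.
  congr L; apply/funext => z'; have [Uz'|Uz'] := pselect (U z'); last first.
    rewrite !(ind0 Uz') (ind0 (A := U `&` _)) ?adde0; last by move=> [].
    rewrite (_ : (fun p => _) = fun=> 0) ?lim_cst//.
    by apply/funext => p; rewrite ind0// => -[].
  rewrite (ind1 Uz'); have [hz|hz] := pselect (h z' = h z).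
    rewrite (ind1 (A := U `&` _))// (_ : (fun p => _) = fun=> 0) ?lim_cst ?add0e//.
    by apply/funext => p; rewrite ind0// => -[_]; apply; rewrite /= hz.
  rewrite (ind0 (A := U `&` _)) ?adde0; last by move=> [].
  have [p0 hp0] : exists p, base_code B p (h z') <> base_code B p (h z).
    by apply: contrapT => /forallNP hp; apply: hz; apply: (base_code_inj hO bB) => p; exact: (contrapT (hp p)).
  apply: lim_near_cst => //; exists p0 => // p /= pp; rewrite ind1//; split => //.
  by move=> /= zp; apply: hp0; exact: code_le pp zp.
have l0f : l0 \is a fin_num by rewrite ge0_fin_numE.
have lcf p b : L (ind (@cocell p b)) \is a fin_num.
  by rewrite ge0_fin_numE//; apply: Lfin => // z [].
have LfE p : P (Ev p) + L (f p) <= l0 * l0.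
  have ng b : nnmf (ind [set t | 2%:R%:E <= cntf (@cell p b) t] : T -> \bar R) by exact: nnmf_ind.
  have ncl b : nnmf (ind (@cell p b) : S -> \bar R) by exact: nnmf_ind.
  have cl0 b : 0 <= L (ind (@cell p b)) by exact: (il_ge0 iL).
  apply: (@le_trans _ _ (\sum_(b : p.-tuple bool) L (ind (@cell p b)) * L (ind (@cell p b)) +
      \sum_(b : p.-tuple bool) L (ind (@cocell p b)) * L (ind (@cell p b)))).
    apply: leeD; last first.
      rewrite /f (il_sum _ _ iL)//; last by move=> b; apply: nnmfM => //; exact: nnmf_cst.
      apply: lee_sum => b _; rewrite -{1 2}(fineK (lcf p b)).
      by rewrite (ilZ iL)// fine_ge0.
    apply: (@le_trans _ _ (\sum_(b : p.-tuple bool) P [set t | 2%:R%:E <= cntf (@cell p b) t])); last first.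
      apply: lee_sum => b _; apply: cnt_ge2 => //; first by move=> z [/UX].
      by apply: Lfin => // z [].
    rewrite -(integral_ind P (mEv p)).
    under eq_bigr do rewrite -(integral_ind P (mge p _)).
    rewrite -(il_sum _ _ (integral_like_int P))//.
    apply: (il_le (integral_like_int P)); [exact: nnmf_ind|exact: nnmf_sum|].
    move=> t; have [[b _ hb]|nb] := pselect (Ev p t); last first.
      by rewrite ind0// sume_ge0// => b _; exact: ind_ge0.
    rewrite (bigD1 b)//= (ind1 hb); apply: (le_trans (ind_le1 _ _)).
    by rewrite leeDl// sume_ge0// => b' _; exact: ind_ge0.
  rewrite -big_split /= (eq_bigr (fun b => l0 * L (ind (@cell p b)))); last first.
    by move=> b _; rewrite -ge0_muleDl// lsplit.
  rewrite -ge0_sume_distrr// -(il_sum _ _ iL)// lee_wpmul2l//.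
  apply: (il_le iL); [exact: nnmf_sum|exact: nnmf_ind|].
  move=> z; have [Uz|Uz] := pselect (U z); last first.
    by rewrite (ind0 Uz) big1// => b _; rewrite ind0// => -[].
  rewrite (ind1 Uz) (bigD1 (base_code B p (h z)))//= ind1// big1 ?adde0// => b bz.
  by rewrite ind0// => -[_] /= /esym/eqP; apply/negP.
have PNf : P N \is a fin_num by exact: fin_num_measure.
have PN : P N + limn (fun p => L (f p)) <= l0 * l0.
  rewrite -leeBrDl//; apply: lime_le.
    by apply: ereal_nondecreasing_is_cvgn => p q pq; apply: (il_le iL) => // z; exact: ndf.
  apply: nearW => p; rewrite leeBrDl//; apply: le_trans (LfE p).
  apply: leeD => //; apply: le_measure; rewrite ?inE//; exact: bigcap_inf.
move: PN; rewrite -(il_lim iL)// (_ : (fun x => _) = fun z => l0 * ind U z); last exact/funext.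
rewrite -{1}(fineK l0f) (ilZ iL) ?fine_ge0//; last exact: nnmf_ind.
rewrite fineK// -/l0 -[leRHS]add0e leeD2rE ?fin_numM// => PN0.
by apply/eqP; rewrite eq_le PN0 measure_ge0.
Qed.

End point_process_counts.

Lemma ae_measure_eq {R : realType} d (T : measurableType d) (P : probability T R)
    (A B : set T) : measurable A -> measurable B ->
  {ae P, forall t, A t <-> B t} -> P A = P B.
Proof.
move=> mA mB AB; rewrite -!(integral_ind P)//.
have nA : nnmf (ind A : T -> \bar R) by exact: nnmf_ind.
have nB : nnmf (ind B : T -> \bar R) by exact: nnmf_ind.
apply: ge0_ae_eq_integral => //; [exact: (proj1 nA)|exact: (proj1 nB)|..].
- by move=> t _; exact: ind_ge0.
- by move=> t _; exact: ind_ge0.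
- by apply: filterS AB => t AB _; exact: ind_congr.
Qed.

(** Elements of [vmeas] are functions of all subsets of Omega, while the identities for Z hold on
    Borel sets only; the sigma-algebra cannot see the difference. *)
Lemma vmeas_ext {R : realType} {n : nat} {Omega : completePseudoMetricType R}
    (C : set (vmeas n Omega)) (z z' : set Omega -> 'rV[R]_n) : measurable C ->
  (forall B : set (borel Omega), measurable B -> z B = z' B) -> C z -> C z'.
Proof.
move=> mC zz'.
suff h : (@eval_cylinders R n Omega).-sigma.-measurable `<=` [set C : set (vmeas n Omega) | C z <-> C z'].
  by have /= := h C mC; tauto.
apply: smallest_sub => [|_ [B [D [mB mD ->]]]]; last by rewrite /= zz'.
split => //=.
- by move=> D [h1 h2]; split=> -[_ nD]; split => //; tauto.
- by move=> F hF; split => -[k _ Fk]; exists k => //; have := hF k; tauto.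
Qed.

Lemma fsum_supp {V : nmodType} (r : seq nat) (D : set nat) (f : nat -> V) :
  uniq r -> (forall k, D k -> k \notin r -> f k = 0%R) ->
  (\sum_(k \in D) f k = \sum_(k <- r | `[< D k >]) f k)%R.
Proof.
move=> ur fr; rewrite fsbig_mkcond [RHS]big_mkcond.
rewrite -(fsbig_widen [set` r] setT)//; last first.
  move=> k [_ /negP kr]; rewrite /preimage /= /patch; case: ifPn => // /set_mem Dk; exact: fr.
by rewrite -fsbig_seq.
Qed.

Section psum_values.
Context {R : realType} d (T : measurableType d) dS (S : measurableType dS).
Variable xi : nat -> T -> S.

Lemma psum_finite (f : S -> \bar R) t N : (forall z, 0 <= f z) ->
  (forall k, (N <= k)%N -> f (xi k t) = 0) -> psum xi f t = \sum_(k < N) f (xi k t).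
Proof.
move=> f0 fN; rewrite /psum (nneseries_split 0%N N)// add0n big_mkord [X in _ + X]eseries0 ?adde0//.
by move=> k Nk _; exact: fN.
Qed.

Lemma cnt_none U t : (forall k, ~ U (xi k t)) -> cnt xi U t = 0 :> \bar R.
Proof. by move=> h; rewrite /cnt /psum eseries0// => k _ _; rewrite ind0. Qed.

Lemma cnt_one U t k : (forall k', U (xi k' t) <-> k' = k) -> cnt xi U t = 1 :> \bar R.
Proof.
move=> h; rewrite /cnt /psum (@nneseriesD1 R _ k)//; last by move=> *; exact: ind_ge0.
rewrite ind1; last exact/h.
by rewrite eseries0 ?adde0// => k' _ /eqP kk'; rewrite ind0// => /h.
Qed.

Lemma ge_cnt1 U t k : U (xi k t) -> 1 <= cnt xi U t :> \bar R.
Proof.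
move=> Uk; rewrite /cnt /psum (@nneseriesD1 R _ k)//; last by move=> *; exact: ind_ge0.
by rewrite ind1// leeDl// nneseries_ge0// => *; exact: ind_ge0.
Qed.

Lemma ge_cnt2 U t k k' : k' <> k -> U (xi k t) -> U (xi k' t) -> 2%:R%:E <= cnt xi U t :> \bar R.
Proof.
move=> /eqP kk' Uk Uk'; rewrite /cnt /psum (@nneseriesD1 R _ k)//; last by move=> *; exact: ind_ge0.
rewrite ind1// (@nneseriesD1 R _ k')//=; last by move=> *; exact: ind_ge0.
by rewrite ind1// addeA -EFinD leeDl// nneseries_ge0// => *; exact: ind_ge0.
Qed.

Lemma cnt0_none U t : cnt xi U t = 0 :> \bar R -> forall k, ~ U (xi k t).
Proof. by move=> c0 k /ge_cnt1; rewrite c0 lee_fin ler10. Qed.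

Lemma cnt1_one U t : cnt xi U t = 1 :> \bar R ->
  exists k, forall k', U (xi k' t) <-> k' = k.
Proof.
move=> c1; have [k Uk] : exists k, U (xi k t).
  apply: contrapT => /forallNP/cnt_none; rewrite c1 => /eqP.
  by rewrite eqe oner_eq0.
exists k => k'; split => [Uk'|->//]; apply: contrapT => kk'.
by have := ge_cnt2 kk' Uk Uk'; rewrite c1 lee_fin leNgt ltr1n.
Qed.

End psum_values.

(** * Regions of the marked space and their masses *)

Section mark_regions.
Context {R : realType} {n M : nat} {Omega : completePseudoMetricType R}.
Local Notation E := (vec R n).
Local Notation X := (R * borel Omega)%type.
Local Notation S := (X * M.+1.-tuple E)%type.
Variables (B0 : probability (borel Omega) R) (rho : R -> Omega -> R).
Hypothesis B0_nonatomic : forall w : Omega, B0 [set w] = 0.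
Hypothesis hO : hausdorff_space Omega.
Hypothesis rho_measurable : measurable_fun
  ([set x | (0 < x.1)%R] : set X) (fun x => rho x.1 x.2).
Hypothesis rho_ge0 : forall (s : R) w, (0 < s)%R -> (0 <= rho s w)%R.
Variable G : R.-pker R ~> vec R n.
Hypothesis finiteness : \int[B0]_w \int[lebesgue_measure]_(s in `]0%R, +oo[)
  (pi_A G s * rho s w)%:E < +oo.

Local Notation I := (marked_intensity B0 rho G (m := M.+1)).

Definition obs : set S := [set z | pos_points z.1 /\ first_marks z.2 <> no_marks].

Definition fresh : set S :=
  [set z | (pos_points z.1 /\ first_marks z.2 = no_marks) /\ last_mark z.2 <> vec0].

Lemma measurable_first_eq : measurable [set z : S | first_marks z.2 = no_marks].
Proof.
have mf : measurable_fun setT (fun z : S => first_marks z.2).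
  by apply: measurableT_comp => //; exact: measurable_first_marks.
by rewrite -[X in measurable X]setTI; exact: (mf measurableT _ measurable_no_marks).
Qed.

Lemma measurable_fst_preimage (B : set X) : measurable B -> measurable [set z : S | B z.1].
Proof. by move=> mB; rewrite -[X in measurable X]setTI; apply: measurable_fst. Qed.

Lemma measurable_obs : measurable obs.
Proof.
apply: measurableI; first by apply: measurable_fst_preimage; exact: measurable_pos_points.
by apply: measurableC; exact: measurable_first_eq.
Qed.

Lemma measurable_fresh : measurable fresh.
Proof.
apply: measurableI.
  apply: measurableI; first by apply: measurable_fst_preimage; exact: measurable_pos_points.
  exact: measurable_first_eq.
have ml : measurable_fun setT (fun z : S => last_mark z.2).
  by apply: measurableT_comp => //; exact: measurable_last_mark.
apply: measurableC; rewrite -[X in measurable X]setTI.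
exact: (ml measurableT _ (measurable_vec1 _)).
Qed.

Definition seen i : set S := [set z | pos_points z.1 /\ tnth z.2 i <> vec0].

Lemma measurable_seen i : measurable (seen i).
Proof.
apply: measurableI; first by apply: measurable_fst_preimage; exact: measurable_pos_points.
have ml : measurable_fun setT (fun z : S => tnth z.2 i).
  exact: (measurableT_comp (measurable_tnth i) measurable_snd).
apply: measurableC; rewrite -[X in measurable X]setTI.
exact: (ml measurableT _ (measurable_vec1 _)).
Qed.

(** This mass is exactly the integral in [finiteness]: mark i is nonzero with probability
    [pi_A G s], and the other marks are free. *)
Lemma intensity_seen i : I (ind (seen i)) < +oo.
Proof.
apply: le_lt_trans finiteness; rewrite le_eqVlt; apply/orP; left; apply/eqP.
apply: eq_integral => w _; rewrite [RHS]integral_mkcond; apply: eq_integral => s _.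
rewrite patchE /rho0 /=; have -> : (s \in `]0%R, +oo[%classic) = (0 < s)%R.
  by apply/idP/idP; rewrite inE /= in_itv/= andbT.
case: ifPn => s0; last by rewrite mul0e.
pose D (j : 'I_M.+1) : set E := if j == i then ~` [set vec0] else setT.
have mD j : measurable (D j).
  by rewrite /D; case: ifP => // _; apply: measurableC; exact: measurable_vec1.
rewrite EFinM muleC; congr (_ * _).
transitivity (mark_kernel G (m := M.+1) (s, w) (tuple_rect D)).
  rewrite -integral_ind; last exact: measurable_tuple_rect.
  apply: eq_integral => y _; apply: ind_congr; split.
    by move=> [_ yi] j; rewrite /D; case: eqP => // ->.
  by move=> h; split => //; have := h i; rewrite /D eqxx.
rewrite mark_kernel_rect// (bigD1 i)//= /D eqxx gate_pos// big1 ?mule1; last first.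
  by move=> j /negbTE ->; rewrite prob_kernel.
rewrite /pi_A fineK; last first.
  apply: pker_fin; rewrite (_ : [set a | _] = ~` [set vec0]).
    by apply: measurableC; exact: measurable_vec1.
  by apply/seteqP; split => a /=; [move=> /eqP|move=> /eqP].
by congr (G s _); apply/seteqP; split => a /=; [move=> /eqP|move=> /eqP].
Qed.

Lemma intensity_fin (U : set S) : measurable U -> U `<=` \bigcup_(i in [set: 'I_M.+1]) seen i ->
  I (ind U) < +oo.
Proof.
move=> mU Us; have iL : integral_like I := marked_intensity_il (m := M.+1) B0 rho_measurable rho_ge0 G.
apply: (@le_lt_trans _ _ (\sum_(i < M.+1) I (ind (seen i)))).
  have ns i : nnmf (ind (seen i) : S -> \bar R) by apply: nnmf_ind; exact: measurable_seen.
  have <- : I (fun z => \sum_(i < M.+1) ind (seen i) z) = \sum_(i < M.+1) I (ind (seen i)).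
    exact: (il_sum (f := fun i => ind (seen i)) _ _ iL ns).
  apply: (il_le iL); [exact: nnmf_ind|exact: nnmf_sum|].
  move=> z; have [Uz|Uz] := pselect (U z); last first.
    by rewrite ind0// sume_ge0// => i _; exact: ind_ge0.
  have [i _ si] := Us z Uz; rewrite (bigD1 i)//= (ind1 si); apply: (le_trans (ind_le1 _ _)).
  by rewrite leeDl// sume_ge0// => b' _; exact: ind_ge0.
by apply/lte_sum_pinfty => i _; exact: intensity_seen.
Qed.

Lemma intensity_obs : I (ind obs) < +oo.
Proof.
apply: intensity_fin; first exact: measurable_obs.
move=> z [z0 /no_marksE/existsNP[i]]; rewrite tnth_mktuple => zi.
by exists (lift ord_max i).
Qed.

Lemma intensity_fresh : I (ind fresh) < +oo.
Proof.
apply: intensity_fin; first exact: measurable_fresh.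
by move=> z [[z0 _] zl]; exists ord_max.
Qed.

Lemma measurable_loc : measurable_fun setT (fun z : S => z.1.2).
Proof. exact: measurableT_comp. Qed.

Definition loc (z : S) : borel Omega := z.1.2.

Lemma measurable_loc_preimage (B : set (borel Omega)) : measurable B -> measurable (loc @^-1` B).
Proof. by move=> mB; rewrite -[X in measurable X]setTI; exact: measurable_loc. Qed.

(** The inner integral vanishes at every location other than x, and x is [B0]-null. *)
Lemma intensity_atom (x : Omega) : I (ind (obs `&` loc @^-1` [set x])) = 0.
Proof.
have mx : measurable ([set x] : set (borel Omega)) by exact: measurable_point.
have nU : nnmf (ind (obs `&` loc @^-1` [set x]) : S -> \bar R).
  apply: nnmf_ind; apply: measurableI; first exact: measurable_obs.
  exact: measurable_loc_preimage.
rewrite /marked_intensity /point_intensity.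
transitivity (\int[B0]_(w in [set x]) \int[lebesgue_measure]_s (rho0 rho (s, w) *
   mark_hat (mark_kernel G (m := M.+1)) (ind (obs `&` loc @^-1` [set x])) (s, w))).
  rewrite -[RHS]integral_ind_mul//; apply: eq_integral => w _.
  have [->|wx] := pselect (w = x); first by rewrite ind1// mul1e.
  rewrite (ind0 (A := [set x] : set (borel Omega)))// mul0e integral0_eq// => s _.
  rewrite [X in _ * X](_ : _ = 0) ?mule0//; apply: integral0_eq => y _.
  by rewrite ind0// => -[].
apply: null_set_integral; [exact: mx| |exact: B0_nonatomic].
apply: measurable_funTS.
have k1 := kop_comp (kop_lebesgue (borel Omega)) (kop_mul (nnmf_rho0 rho_measurable rho_ge0)).
exact: (kop_meas k1 (kop_nnmf (kop_hat (mark_kernel G (m := M.+1))) nU)).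
Qed.

End mark_regions.

(** * Observed points *)

Section good_event.
Context {R : realType} {n M : nat} {Omega : completePseudoMetricType R}.
Local Notation E := (vec R n).
Local Notation X := (R * borel Omega)%type.
Local Notation S := (X * M.+1.-tuple E)%type.
Context d (T : measurableType d) (P : probability T R).
Variables (tau : nat -> {RV P >-> R}) (w : nat -> {RV P >-> borel Omega}).
Variable A : 'I_M.+1 -> nat -> {RV P >-> vec R n}.
Variable Z : 'I_M.+1 -> {RV P >-> vmeas n Omega}.

Local Notation z k t := (mpts tau w A k t).

Definition good t := [/\
  forall i (B : set (borel Omega)), measurable B ->
    Z i t B = (\sum_(k \in [set k | present tau t k /\ B (w k t)]) (A i k t : 'rV[R]_n))%R,
  exists N, forall k, (N <= k)%N -> ~ obs (z k t) /\ ~ fresh (z k t) &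
  forall k k', obs (z k t) -> obs (z k' t) -> w k t = w k' t -> k = k'].

Lemma obs_present k t : obs (z k t) -> (0 < tau k t)%R.
Proof. by case. Qed.

Lemma tnth_first_mks i k t : (0 < tau k t)%R ->
  tnth (first_marks (mks tau A k t)) i = A (lift ord_max i) k t.
Proof. by move=> t0; rewrite !tnth_mktuple t0. Qed.

Lemma last_mks k t : (0 < tau k t)%R -> last_mark (mks tau A k t) = A ord_max k t.
Proof. by move=> t0; rewrite /last_mark tnth_mktuple t0. Qed.

Lemma unobserved k t : (0 < tau k t)%R -> ~ obs (z k t) ->
  first_marks (mks tau A k t) = no_marks.
Proof. by move=> t0 h; apply: contrapT => nm; apply: h. Qed.

Lemma present_thin k t :
  present (thin_tau tau w A) t k <-> (0 < tau k t)%R /\ ~ obs (z k t).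
Proof.
rewrite /present /= /thin_tau /= /thin_tau_fun /thin_height /= indicE.
have [/set_mem h|/negP h] := boolP (_ \in _).
  rewrite mul1r; split => [t0|[]//]; split => // -[_]; exact.
rewrite mul0r ltxx; split => // -[t0 nobs]; exfalso; apply: h; apply: mem_set.
exact: unobserved.
Qed.

Section good_point.
Variables (t : T) (gt : good t).

Lemma first_observed (B : set (borel Omega)) i : measurable B ->
  Z (lift ord_max i) t B = (\sum_(k \in [set k | obs (z k t) /\ B (w k t)])
    (tnth (first_marks (mks tau A k t)) i : 'rV[R]_n))%R.
Proof.
move=> mB; have [-> // _ _] := gt.
transitivity (\sum_(k \in [set k | obs (z k t) /\ B (w k t)])
    (A (lift ord_max i) k t : 'rV[R]_n))%R.
  apply/esym/fsbig_widen; first by move=> k [/obs_present].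
  move=> k [[t0 Bk] nk]; rewrite /preimage /= -(tnth_first_mks _ t0) unobserved//.
    by rewrite [LHS]tnth_nseq.
  by move=> ok; apply: nk.
by apply: eq_fsbigr => k /set_mem[/obs_present t0 _]; rewrite tnth_first_mks.
Qed.

(** A present point either is observed or survives thinning. The bound [N] makes the three
    finite-support sums ordinary ones, so the split can be made term by term. *)
Lemma last_observed (B : set (borel Omega)) : measurable B ->
  Z ord_max t B = (new_part tau w A t B + \sum_(k \in [set k | obs (z k t) /\ B (w k t)])
    (last_mark (mks tau A k t) : 'rV[R]_n))%R.
Proof.
move=> mB; have [-> // [N hN] _] := gt.
have A0 k : (0 < tau k t)%R -> k \notin iota 0 N -> A ord_max k t = vec0.
  rewrite mem_iota add0n /= -leqNgt => t0 /hN[nobs nfresh].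
  apply: contrapT => Ak; apply: nfresh; split; last by rewrite /= last_mks.
  by split => //=; exact: unobserved.
rewrite (fsum_supp (r := iota 0 N)) ?iota_uniq//; last first.
  by move=> k [t0 _]; exact: A0.
rewrite /new_part /= /new_fun (fsum_supp (r := iota 0 N)) ?iota_uniq//; last first.
  by move=> k [/present_thin[t0 _] _]; exact: A0.
rewrite (fsum_supp (r := iota 0 N)) ?iota_uniq//; last first.
  by move=> k [ok _]; rewrite mem_iota add0n /= -leqNgt => /hN[].
rewrite big_mkcond [X in _ = (X + _)%R]big_mkcond [X in _ = (_ + X)%R]big_mkcond -big_split.
apply: eq_bigr => k _ /=; case: asboolP => [[t0 Bk]|nk]; last first.
  rewrite !asboolF ?addr0//; first by move=> [/obs_present t0 Bk]; apply: nk.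
  by move=> [/present_thin[t0 _] Bk]; apply: nk.
have [ok|nok] := pselect (obs (z k t)).
  by rewrite asboolF ?add0r ?asboolT ?last_mks// => -[/present_thin[_]].
rewrite asboolT; last by split => //; exact/present_thin.
by rewrite asboolF ?addr0// => -[].
Qed.

(** For disjoint [V] the map [kap] is a bijection from the cells onto the observed indices. *)
Definition located K (V : 'I_K -> set Omega) (kap : 'I_K -> nat) :=
  (forall l, obs (z (kap l) t) /\ V l (w (kap l) t)) /\
  (forall k, obs (z k t) -> exists l, k = kap l).

Lemma located_inj K (V : 'I_K -> set Omega) kap :
  (forall l l', l != l' -> V l `&` V l' = set0) -> located V kap -> injective kap.
Proof.
move=> Vd [h _] l l' ll'; apply: contrapT => /eqP/Vd; apply/eqP/set0P.
by exists (w (kap l) t); split; [case: (h l)|rewrite ll'; case: (h l')].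
Qed.

Lemma sum_located K (V : 'I_K -> set Omega) kap (B : set Omega) (f : nat -> 'rV[R]_n) :
  (forall l l', l != l' -> V l `&` V l' = set0) -> located V kap ->
  (\sum_(k \in [set k | obs (z k t) /\ B (w k t)]) f k =
   \sum_(l < K | w (kap l) t \in B) f (kap l))%R.
Proof.
move=> Vd /[dup] /(located_inj Vd) kinj [h1 h2].
rewrite (fsum_supp (r := map kap (enum 'I_K))); last 2 first.
- by rewrite map_inj_uniq ?enum_uniq.
- move=> k [/h2[l ->] _] /negP; case; apply: map_f; exact: mem_enum.
rewrite big_map big_enum_cond /=; apply: eq_bigl => l.
by apply/asboolP/idP => [[_ ?]|/set_mem ?]; [exact: mem_set|split => //; case: (h1 l)].
Qed.

(** The cells are given by a list of base indices because such lists are countable, as the final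
    gluing requires. *)
Lemma exists_located (Bs : nat -> set Omega) : hausdorff_space Omega -> countable_base Bs ->
  exists s : seq nat, (forall l l' : 'I_(size s), l != l' ->
    Bs (nth 0%N s l) `&` Bs (nth 0%N s l') = set0) /\
  exists kap, located (fun l : 'I_(size s) => Bs (nth 0%N s l)) kap.
Proof.
move=> hO bB; have [_ [N hN] hd] := gt.
pose s := [seq k <- iota 0 N | `[< obs (z k t) >]].
have sobs k : k \in s -> obs (z k t) by rewrite mem_filter => /andP[/asboolP].
pose kap (l : 'I_(size s)) := nth 0%N s l.
have kobs l : obs (z (kap l) t) by apply: sobs; exact: mem_nth.
have inj : injective (fun l => w (kap l) t : Omega).
  move=> l l' /(hd _ _ (kobs l) (kobs l'))/eqP.
  by rewrite /kap nth_uniq ?filter_uniq ?iota_uniq// => /eqP/val_inj.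
have [v [hv vd]] := base_sep hO bB inj.
pose u := [seq v l | l <- enum 'I_(size s)].
have us : size u = size s by rewrite size_map size_enum_ord.
have ue (l : 'I_(size u)) : nth 0%N u l = v (cast_ord us l).
  rewrite (nth_map (cast_ord us l)) ?size_enum_ord -?us// .
  by rewrite -[X in nth _ _ X]/(nat_of_ord (cast_ord us l)) nth_ord_enum.
exists u; split.
  by move=> l l' ll'; rewrite !ue; apply: vd; rewrite (inj_eq (@cast_ord_inj _ _ us)).
exists (fun l => kap (cast_ord us l)); split.
  by move=> l; split => //; rewrite ue; exact: hv.
move=> k ok; have ks : k \in s.
  rewrite mem_filter asboolT//= mem_iota add0n /= ltnNge; apply/negP => /hN[].
  exact.
have ks' : (index k s < size s)%N by rewrite index_mem.
exists (cast_ord (esym us) (Ordinal ks')).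
by rewrite /kap /= nth_index.
Qed.

End good_point.

(** The new part is a function of the fresh points alone, which will give its independence of the
    observed ones. Finiteness of their count is kept in the event, because it makes the series
    [psum] agree with the finite-support sums. *)
Lemma new_part_sigma (C : set (vmeas n Omega)) : measurable C ->
  cnt_sigma (R := R) (mpts tau w A) fresh
    ([set t | C (new_part tau w A t)] `&` [set t | cnt (mpts tau w A) fresh t < +oo :> \bar R]).
Proof.
move=> mC; set xi := mpts tau w A.
pose T' := g_sigma_algebraType (cnt_pi (R := R) xi fresh).
pose reg (B : set (borel Omega)) (z : S) : R := (\1_fresh z * \1_(loc @^-1` B) z)%R.
(* [psum] is controlled on nonnegative functions, so each coordinate is split into its positive and
   negative parts. *)
pose f (sgn : bool) (B : set (borel Omega)) j (z : S) : \bar R :=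
  (reg B z * Num.max 0 (if sgn then (last_mark z.2 : 'rV[R]_n) ord0 j else - (last_mark z.2 : 'rV[R]_n) ord0 j))%:E.
have nf sgn B j : measurable B -> nnmf (f sgn B j).
  move=> mB; apply: nnmf_EFin => [|z'].
    apply: measurable_funM.
      apply: measurable_funM; apply: measurable_indic; first exact: measurable_fresh.
      exact: measurable_loc_preimage.
    have mj : measurable_fun setT (fun z : S => (last_mark z.2 : 'rV[R]_n) ord0 j).
      apply: (measurableT_comp (measurable_coord j)).
      by apply: measurableT_comp => //; exact: measurable_last_mark.
    apply: measurable_maxr => //; case: sgn => //; exact: measurableT_comp.
  by rewrite mulr_ge0// ?le_max ?lexx// mulr_ge0// indicE.
have ps sgn B j : measurable B -> measurable_fun setT (psum xi (f sgn B j) : T' -> \bar R).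
  move=> mB; suff fA z' : ~ fresh z' -> f sgn B j z' = 0.
    by have [] := nnmf_psum_sigma xi (nf sgn B j mB) fA.
  by move=> nz; rewrite /f /reg indicE memNset// !mul0r.
pose new (t : T') (B : set Omega) : 'rV[R]_n :=
  if `[< measurable (B : set (borel Omega)) >] then
    (\row_j (fine (psum xi (f true B j) t) - fine (psum xi (f false B j) t)))%R
  else 0%R.
have mnew : measurable_fun setT (new : T' -> vmeas n Omega).
  apply: (@measurability _ _ T' (vmeas n Omega) setT new (@eval_cylinders R n Omega)) => //.
  move=> _ [_ [B [D [mB mD ->]]] <-].
  have mN : measurable_fun setT (fun t : T' => new t B : vec R n).
    apply: measurable_vec => j; rewrite /new asboolT//.
    rewrite (_ : (fun t => _) = (fun t : T' => fine (psum xi (f true B j) t) - fine (psum xi (f false B j) t))%R).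
      by apply: measurable_funB; apply: measurableT_comp => //; exact: ps.
    by apply/funext => t; rewrite mxE.
  exact: (mN measurableT D mD).
have fin : cnt_sigma (R := R) xi fresh [set t | cnt xi fresh t < +oo :> \bar R].
  have mf := @measurable_fresh R n M Omega.
  by have := cnt_sigma_preimage (xi := xi) (A := fresh) [set x : \bar R | x < +oo] mf (@subset_refl _ _).
have newE t : cnt xi fresh t < +oo :> \bar R -> forall B : set (borel Omega), measurable B ->
    new t B = new_part tau w A t B.
  move=> /cnt_tail[N hN] B mB; rewrite /new asboolT//.
  rewrite /new_part /= /new_fun (fsum_supp (r := iota 0 N)) ?iota_uniq//; last first.
    move=> k [/present_thin[t0 nobs] _]; rewrite mem_iota add0n /= -leqNgt => /hN nfr.
    apply: contrapT => Ak; apply: nfr; split; last by rewrite /= last_mks.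
    by split => //=; exact: unobserved.
  apply/rowP => j; rewrite !mxE summxE.
  have psE sgn : psum xi (f sgn B j) t = (\sum_(k < N) fine (f sgn B j (xi k t)))%R%:E.
    rewrite (psum_finite (N := N)); first by rewrite -sumEFin.
    - by move=> z'; case: (nf sgn B j mB).
    - by move=> k /hN nfr; rewrite /f /reg indicE memNset// !mul0r.
  rewrite !psE /= -sumrB [RHS]big_mkcond /=.
  rewrite -(big_mkord xpredT (fun k => fine (f true B j (xi k t)) - fine (f false B j (xi k t)))%R).
  rewrite /index_iota subn0; apply: eq_bigr => k _; rewrite /f /= -mulrBr.
  have -> (x : R) : (Num.max 0 x - Num.max 0 (- x) = x)%R.
    by case: (leP 0%R x) => x0; case: (leP 0%R (- x)%R) => x1; lra.
  rewrite /reg !indicE; case: asboolP => [[/present_thin[t0 nobs] Bk]|nk].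
    rewrite (mem_set (A := loc @^-1` B))// last_mks// mulr1.
    have [->|Ak] := pselect (A ord_max k t = vec0); first by rewrite mxE mulr0.
    rewrite mem_set ?mul1r//; split; last by rewrite /= last_mks.
    by split => //=; exact: unobserved.
  have [fk|fk] := pselect (fresh (xi k t)); last by rewrite memNset// !mul0r.
  rewrite (memNset (A := loc @^-1` B)) ?mulr0 ?mul0r// => Bk; apply: nk; split => //.
  apply/present_thin; split; first by case: fk => -[].
  by move=> [_]; apply; case: fk => -[].
rewrite (_ : _ `&` _ = [set t | C (new t)] `&` [set t | cnt xi fresh t < +oo :> \bar R]).
  apply: gsigmaI => //; have := mnew measurableT C mC; rewrite setTI; exact.
apply/seteqP; split => t [Ct ft]; split => //; apply: vmeas_ext Ct => // B mB; last exact: newE.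
by apply/esym; exact: newE.
Qed.

End good_event.

(** * Events of the past that locate the observed points *)

Section observation.
Context {R : realType} {n M : nat} {Omega : completePseudoMetricType R}.
Local Notation E := (vec R n).
Local Notation X := (R * borel Omega)%type.
Local Notation S := (X * M.+1.-tuple E)%type.
Hypothesis hO : hausdorff_space Omega.
Variable Bs : nat -> set Omega.
Hypothesis bB : countable_base Bs.
Context d (T : measurableType d) (P : probability T R).
Variables (tau : nat -> {RV P >-> R}) (w : nat -> {RV P >-> borel Omega}).
Variable A : 'I_M.+1 -> nat -> {RV P >-> vec R n}.
Variable Z : 'I_M.+1 -> {RV P >-> vmeas n Omega}.

Local Notation z k t := (mpts tau w A k t).
Local Notation past := (fun i : 'I_M => Z (lift ord_max i) : T -> vmeas n Omega).
Local Notation good := (good tau w A Z).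

(** The class generating the sigma-algebra on which the theorem conditions. [T0] is [T] with that
    smaller sigma-algebra, so measurability on [T0] means being determined by the past. *)
Definition past_sets := \big[setU/set0]_(i < M) g_sigma_algebra_preimage (past i).

Local Notation T0 := (g_sigma_algebraType past_sets).

Lemma measurable_past i : measurable_fun setT (past i : T0 -> vmeas n Omega).
Proof.
move=> _ C mC; apply: sub_sigma_algebra; rewrite /past_sets -bigcup_seq.
by exists i => /=; [exact: mem_index_enum|exists C].
Qed.

Lemma past_measurable (H : set T) : (measurable : set (set T0)) H -> measurable H.
Proof.
suff : (measurable : set (set T0)) `<=` (measurable : set (set T)) by exact.
apply: smallest_sub; first exact: sigma_algebra_measurable.
move=> F; rewrite /past_sets -bigcup_seq => -[i _ [C mC <-]].
exact: measurable_funPT.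
Qed.

Lemma measurable_past_eval i (B : set (borel Omega)) : measurable B ->
  measurable_fun setT (fun t : T0 => Z (lift ord_max i) t B : vec R n).
Proof.
move=> mB _ D mD; have := measurable_past i measurableT.
move=> /(_ [set z | D (z B)]); apply; apply: sub_sigma_algebra.
by exists B, D.
Qed.

(* A value [Z i t U] may vanish by cancellation between several features in U;
   a base set isolating one of them excludes this. *)
Definition occupied (U : set Omega) : set T0 :=
  [set t | exists j i, Z (lift ord_max i) t (U `&` Bs j) <> 0%R].

Lemma measurable_occupied (U : set (borel Omega)) : measurable U -> measurable (occupied U).
Proof.
move=> mU; rewrite (_ : occupied U = \bigcup_j \bigcup_(i in [set: 'I_M])
    ~` ((fun t : T0 => Z (lift ord_max i) t (U `&` Bs j) : vec R n) @^-1` [set vec0])).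
  apply: bigcupT_measurable => j; apply: fin_bigcup_measurable => // i _.
  apply: measurableC; rewrite -[X in measurable X]setTI.
  apply: measurable_past_eval => //; last exact: measurable_vec1.
  by apply: measurableI => //; exact: measurable_base.
apply/seteqP; split => t; first by move=> [j [i h]]; exists j => //; exists i.
by move=> [j _ [i _ h]]; exists j, i.
Qed.

(** Cells isolating the finitely many observed points supply a base set that meets them in the given
    point only, and one of the first M marks of that point is nonzero. *)
Lemma occupied_good t (U : set (borel Omega)) : good t -> measurable U ->
  occupied U t <-> exists k, obs (z k t) /\ U (w k t).
Proof.
move=> gt mU; have mUj j : measurable (U `&` Bs j : set (borel Omega)).
  by apply: measurableI => //; exact: measurable_base.
split.
  move=> [j [i]]; rewrite (first_observed gt)// => h; apply: contrapT => /forallNP nU.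
  apply: h; apply: fsbig1 => k [ok [Uk _]]; exfalso; exact: (nU k).
move=> [k [ok Uk]].
have [i hi] : exists i, tnth (first_marks (mks tau A k t)) i <> vec0.
  by apply: contrapT => /forallNP h; case: ok => _; apply; apply/no_marksE => i; exact: (contrapT (h i)).
have [s [sd [kap hk]]] := exists_located gt hO bB.
have [l lk] := (proj2 hk) k ok.
exists (nth 0%N s l), i; rewrite (first_observed gt)//.
rewrite (sum_located _ (fun k => tnth (first_marks (mks tau A k t)) i) sd hk).
rewrite (big_pred1 l) -?lk// => l' /=; apply/idP/eqP => [/set_mem[_ Bl']|->].
  apply: contrapT => /eqP/sd; apply/eqP/set0P; exists (w (kap l') t); split => //.
  by case: hk => /(_ l')[].
by apply: mem_set; split; [rewrite -lk|case: hk => /(_ l)[]].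
Qed.

(** Two distinct points would be separated by disjoint base sets, so quantifying over pairs of such
    sets expresses uniqueness by countably many events of the past. *)
Definition singly_occupied (U : set Omega) : set T0 := [set t | occupied U t /\
  forall j j', Bs j `&` Bs j' = set0 -> ~ (occupied (U `&` Bs j) t /\ occupied (U `&` Bs j') t)].

Lemma measurable_singly_occupied (U : set (borel Omega)) : measurable U ->
  measurable (singly_occupied U).
Proof.
move=> mU; apply: measurableI; first exact: measurable_occupied.
rewrite [X in measurable X](_ : _ = \bigcap_j \bigcap_j'
    (if `[< Bs j `&` Bs j' = set0 >] then ~` (occupied (U `&` Bs j) `&` occupied (U `&` Bs j')) else setT)).
  apply: bigcapT_measurable => j; apply: bigcapT_measurable => j'.
  case: asboolP => // _; apply: measurableC; apply: measurableI; apply: measurable_occupied.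
    by apply: measurableI => //; exact: measurable_base.
  by apply: measurableI => //; exact: measurable_base.
apply/seteqP; split => t h.
  by move=> j _ j' _; case: asboolP => // /h.
by move=> j j' jj'; have := h j I j' I; rewrite asboolT.
Qed.

Section cells.
Variables (K : nat) (V : 'I_K -> set Omega).
Hypotheses (mV : forall l, measurable (V l : set (borel Omega)))
  (Vd : forall l l', l != l' -> V l `&` V l' = set0).

Definition cells_exact : set T0 := [set t | (forall l, singly_occupied (V l) t) /\
  ~ occupied (~` \bigcup_l V l) t].

Lemma measurable_rest : measurable (~` \bigcup_l V l : set (borel Omega)).
Proof. by apply: measurableC; apply: fin_bigcup_measurable. Qed.

Lemma measurable_cells_exact : measurable cells_exact.
Proof.
apply: measurableI; last by apply: measurableC; exact: measurable_occupied measurable_rest.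
rewrite [X in measurable X](_ : _ = \bigcap_(l in [set: 'I_K]) singly_occupied (V l)).
  by apply: fin_bigcap_measurable => // l _; exact: measurable_singly_occupied.
by apply/seteqP; split => t h l; [move=> _; exact: h|exact: h].
Qed.

Lemma cells_exact_located t : good t ->
  cells_exact t <-> exists kap, located tau w A t V kap.
Proof.
move=> gt; split; last first.
  move=> [kap [h1 h2]]; split; last first.
    move=> /(occupied_good gt measurable_rest)[k [/h2[l ->]]]; apply; exists l => //.
    by case: (h1 l).
  move=> l; split; first by apply/(occupied_good gt (mV l)); exists (kap l); exact: h1.
  have uniq_cell k : obs (z k t) -> V l (w k t) -> k = kap l.
    move=> /h2[l' ->] Vl; congr kap; apply: contrapT => /eqP/Vd; apply/eqP/set0P.
    by exists (w (kap l') t); split => //; case: (h1 l').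
  move=> j j' jj'; have mVj i : measurable (V l `&` Bs i : set (borel Omega)).
    by apply: measurableI => //; exact: measurable_base.
  rewrite !(occupied_good gt)// => -[[k [ok [Vk Bk]]] [k' [ok' [Vk' Bk']]]].
  suff : (Bs j `&` Bs j') (w k t) by rewrite jj'.
  by split => //; rewrite (uniq_cell k)// -(uniq_cell k').
move=> [h1 h2]; have /choice[kap hk] : forall l, exists k, obs (z k t) /\ V l (w k t).
  by move=> l; apply/(occupied_good gt (mV l)); case: (h1 l).
exists kap; split => // k ok.
have [l _ Vl] : (\bigcup_l V l) (w k t).
  by apply: contrapT => nV; apply: h2; apply/(occupied_good gt measurable_rest); exists k.
exists l; apply: contrapT => kkap; have [okl Vkl] := hk l.
have [_ _ hd] := gt.
(* A second observed point in [V l] would be at another location; the two locations are written as a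
   family so that [base_sep] separates them. *)
pose x (i : 'I_2) : Omega := if i == ord0 then w k t else w (kap l) t.
have o2 (i : 'I_2) : i <> ord0 -> i = ord_max.
  by case: i => [[|[|//]] i2] h; [exfalso; apply: h|]; exact/val_inj.
have xinj : injective x.
  have neq : w k t <> w (kap l) t by move=> e; apply: kkap; exact: (hd _ _ ok okl e).
  move=> i i'; rewrite /x; case: eqP => hi; case: eqP => hi'.
  - by rewrite hi hi'.
  - by move=> e; case: neq.
  - by move=> e; case: neq; rewrite e.
  - by rewrite (o2 i hi) (o2 i' hi').
have [v [hv vd]] := base_sep hO bB xinj.
have [_ /(_ (v ord0) (v ord_max))] := h1 l; apply; first exact: vd.
have mVj i : measurable (V l `&` Bs i : set (borel Omega)).
  by apply: measurableI => //; exact: measurable_base.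
rewrite !(occupied_good gt)//; split.
  by exists k; split => //; split => //; exact: (hv ord0).
by exists (kap l); split => //; split => //; exact: (hv ord_max).
Qed.

(* The location of the feature in [V l] is tested against open sets by
   occupation events, hence agrees on the exact event with a function
   measurable for the past. *)
Lemma feature_location l : exists2 h : T0 -> borel Omega, measurable_fun setT h &
  forall t kap, good t -> located tau w A t V kap -> h t = w (kap l) t.
Proof.
have /choice[kap hk] : forall t, exists kap, good t -> cells_exact t -> located tau w A t V kap.
  move=> t; have [gt|] := pselect (good t); last by exists (fun=> 0%N).
  have [/(cells_exact_located gt)[kap hk]|] := pselect (cells_exact t); last by exists (fun=> 0%N).
  by exists kap.
have [U oU|h mh hE] := @measurable_extension R Omega hO Bs bB _ T0
    [set t | good t /\ cells_exact t] (fun t => w (kap t l) t).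
  have mU : measurable (U : set (borel Omega)) by exact: sub_sigma_algebra.
  exists (occupied (V l `&` U)); first by apply: measurable_occupied; exact: measurableI.
  move=> t [gt ct]; have [h1 h2] := hk t gt ct.
  have -> := occupied_good gt (measurableI _ _ (mV l) mU).
  split => [Ut|[k [/h2[l' ->]] [Vl' Ul']]].
    by exists (kap t l); have [] := h1 l.
  suff -> : l = l' by [].
  apply: contrapT => /eqP/Vd; apply/eqP/set0P; exists (w (kap t l') t); split => //.
  by have [] := h1 l'.
exists h => // t kap' gt hl'.
have ct : cells_exact t by apply/(cells_exact_located gt); exists kap'.
rewrite hE//; have [h1 h2] := hk t gt ct; have [h1' h2'] := hl'.
have [okl Vkl] := h1 l; have [l' e] := h2' _ okl.
suff ll : l = l' by rewrite e -ll.
apply: contrapT => /eqP/Vd; apply/eqP/set0P; exists (w (kap t l) t); split => //.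
by rewrite e; have [] := h1' l'.
Qed.

(** On the exact event [V l] contains a single feature, so the total of Z_i over [V l] is its mark,
    read without reference to the random location. *)
Definition seen_marks l t : M.-tuple E := [tuple (Z (lift ord_max i) t (V l) : E) | i < M].

(** The total of Z_{M+1} over [V l] could include features that are new at that step; hence a sum
    over observed points instead. *)
Definition next_mark l t : E := (\sum_(k \in [set k | obs (z k t) /\ V l (w k t)])
  (last_mark (mks tau A k t) : 'rV[R]_n))%R.

Lemma measurable_seen_marks l : measurable_fun setT (seen_marks l : T0 -> _).
Proof.
apply/measurable_fun_tnthP => i.
rewrite (_ : _ \o _ = fun t : T0 => Z (lift ord_max i) t (V l) : E); first exact: measurable_past_eval.
by apply/funext => t /=; rewrite tnth_mktuple.
Qed.

Lemma measurable_next_mark l : measurable_fun setT (next_mark l).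
Proof.
apply: measurable_vec_fsum => k.
  by apply: measurableT_comp; [exact: measurable_last_mark|exact: measurable_mks].
apply: measurableI.
  rewrite -[X in measurable X]setTI; apply: measurable_mpts => //; exact: measurable_obs.
by rewrite -[X in measurable X]setTI; apply: measurable_funPT => //; exact: mV.
Qed.

Lemma cell_sum t kap l (f : nat -> 'rV[R]_n) : located tau w A t V kap ->
  (\sum_(k \in [set k | obs (z k t) /\ V l (w k t)]) f k = f (kap l))%R.
Proof.
move=> hk; rewrite (sum_located _ f Vd hk) (big_pred1 l)// => l' /=.
have [h1 _] := hk; apply/idP/eqP => [/set_mem Vl'|->]; last by apply: mem_set; have [] := h1 l.
apply: contrapT => /eqP/Vd; apply/eqP/set0P; exists (w (kap l') t); split => //.
by have [] := h1 l'.
Qed.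

Lemma seen_marksE t kap l : good t -> located tau w A t V kap ->
  seen_marks l t = first_marks (mks tau A (kap l) t).
Proof.
move=> gt hk; apply: eq_from_tnth => i; rewrite tnth_mktuple (first_observed gt)//.
by rewrite (cell_sum _ (fun k => tnth (first_marks (mks tau A k t)) i) hk).
Qed.

Lemma next_markE t kap l : located tau w A t V kap ->
  next_mark l t = last_mark (mks tau A (kap l) t).
Proof. by move=> hk; exact: (cell_sum _ (fun k => last_mark (mks tau A k t)) hk). Qed.

End cells.
End observation.

Section cnt_values.
Context {R : realType} d (T : measurableType d) (P : probability T R).
Context dS (S : measurableType dS) (xi : nat -> T -> S).
Hypothesis mxi : forall k, measurable_fun setT (xi k).
Variables (L : (S -> \bar R) -> \bar R) (X0 : set S).
Hypotheses (iL : integral_like L) (LF : laplace_functional P xi L X0).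
Variable U : set S.
Hypotheses (mU : measurable U) (UX : U `<=` X0) (Uoo : L (ind U) < +oo).

Lemma cnt_lev0 : P (lev (cnt xi U : T -> \bar R) 0) = lap (L (ind U)).
Proof. by rewrite (cnt_lev mxi iL LF 0 mU UX Uoo) expr0 fact0 invr1 mulr1 mul1e. Qed.

Lemma cnt_lev1 : P (lev (cnt xi U : T -> \bar R) 1) = L (ind U) * lap (L (ind U)).
Proof.
rewrite (cnt_lev mxi iL LF 1 mU UX Uoo) expr1 factS fact0 invr1 mulr1 fineK//.
by rewrite ge0_fin_numE//; apply: (il_ge0 iL); exact: nnmf_ind.
Qed.

End cnt_values.

(** * Joint law of the cells, their data and the new part *)

Section cell_law.
Context {R : realType} {n M : nat} {Omega : completePseudoMetricType R}.
Local Notation E := (vec R n).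
Local Notation X := (R * borel Omega)%type.
Local Notation S := (X * M.+1.-tuple E)%type.
Hypothesis hO : hausdorff_space Omega.
Variable Bs : nat -> set Omega.
Hypothesis bB : countable_base Bs.
Variables (B0 : probability (borel Omega) R) (rho : R -> Omega -> R).
Hypothesis B0_nonatomic : forall w : Omega, B0 [set w] = 0.
Hypothesis rho_measurable : measurable_fun
  ([set x | (0 < x.1)%R] : set X) (fun x => rho x.1 x.2).
Hypothesis rho_ge0 : forall (s : R) w, (0 < s)%R -> (0 <= rho s w)%R.
Variable G : R.-pker R ~> vec R n.
Hypothesis finiteness : \int[B0]_w \int[lebesgue_measure]_(s in `]0%R, +oo[)
  (pi_A G s * rho s w)%:E < +oo.
Context d (T : measurableType d) (P : probability T R).
Variables (tau : nat -> {RV P >-> R}) (w : nat -> {RV P >-> borel Omega}).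
Hypothesis prm : is_PRM P (point_measure tau w) (levy_intensity rho B0).
Variable A : 'I_M.+1 -> nat -> {RV P >-> vec R n}.
Hypothesis A_marks : forall (H : set T) (r : nat) (D : 'I_M.+1 -> nat -> set (vec R n)),
  points_sigma tau w H -> (forall i k, measurable (D i k)) ->
  P (H `&` [set t | forall i k, (k < r)%N -> present tau t k -> D i k (A i k t)]) =
  \int[P]_(t in H) (\prod_(k < r | (0 < tau k t)%R) \prod_(i < M.+1)
     fine (G (tau k t) (D i k)))%:E.
Variable Z : 'I_M.+1 -> {RV P >-> vmeas n Omega}.
Hypothesis Z_points : forall i, {ae P, forall t, forall B : set (borel Omega), measurable B ->
  Z i t B = (\sum_(k \in [set k | present tau t k /\ B (w k t)]) (A i k t : 'rV[R]_n))%R}.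

Local Notation I := (marked_intensity B0 rho G (m := M.+1)).
Local Notation xi := (mpts tau w A).
Local Notation good := (good tau w A Z).

Let iL : integral_like I := marked_intensity_il (m := M.+1) B0 rho_measurable rho_ge0 G.
Let LF := marked_laplace rho_measurable rho_ge0 prm A_marks.
Let X0 : set S := @pos_points R Omega `*` setT.

Let obs_X0 : obs `<=` X0. Proof. by move=> z [z0 _]; split. Qed.
Let fresh_X0 : fresh `<=` X0. Proof. by move=> z [[z0 _] _]; split. Qed.

Lemma good_ae : {ae P, forall t, good t}.
Proof.
have mxi := measurable_mpts tau w A.
have hZ : {ae P, forall t, forall i (B : set (borel Omega)), measurable B ->
    Z i t B = (\sum_(k \in [set k | present tau t k /\ B (w k t)]) (A i k t : 'rV[R]_n))%R}.
  exact: filter_forall.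
have ho : {ae P, forall t, cnt xi obs t < +oo :> \bar R}.
  apply: negligibleS (cnt_lty mxi iL LF (@measurable_obs R n M Omega) obs_X0
    (intensity_obs rho_measurable rho_ge0 finiteness)).
  by move=> t /= /negP; rewrite -leNgt leye_eq => /eqP.
have hf : {ae P, forall t, cnt xi fresh t < +oo :> \bar R}.
  apply: negligibleS (cnt_lty mxi iL LF (@measurable_fresh R n M Omega) fresh_X0
    (intensity_fresh rho_measurable rho_ge0 finiteness)).
  by move=> t /= /negP; rewrite -leNgt leye_eq => /eqP.
have hd : {ae P, forall t, forall k k', obs (xi k t) -> obs (xi k' t) ->
    w k t = w k' t -> k = k'}.
  apply: negligibleS (distinct_points mxi iL LF hO bB (@measurable_loc R n M Omega)
    (@measurable_obs R n M Omega) obs_X0 (intensity_obs rho_measurable rho_ge0 finiteness)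
    (intensity_atom B0_nonatomic hO rho_measurable rho_ge0 G)).
  move=> t /= /existsNP[k /existsNP[k' /not_implyP[ok /not_implyP[ok' /not_implyP[e kk']]]]].
  by exists k, k'.
apply: filterS3 hZ (filterI ho hf) hd => t Zt [/cnt_tail[N hN] /cnt_tail[N' hN']] dt; split => //.
exists (maxn N N') => k; rewrite geq_max => /andP[Nk N'k].
by split; [exact: hN|exact: hN'].
Qed.

Definition mark_view (z : S) : (borel Omega * M.-tuple E) * E :=
  ((loc z, first_marks z.2), last_mark z.2).

Lemma measurable_mark_view : measurable_fun setT mark_view.
Proof.
apply: measurable_fun_pair; first apply: measurable_fun_pair.
- exact: measurable_loc.
- by apply: measurableT_comp => //; exact: measurable_first_marks.
- by apply: measurableT_comp => //; exact: measurable_last_mark.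
Qed.

Definition obs_in (V : set Omega) : set S := obs `&` loc @^-1` V.

Lemma measurable_obs_in (V : set (borel Omega)) : measurable V -> measurable (obs_in V).
Proof.
by move=> mV; apply: measurableI; [exact: measurable_obs|exact: measurable_loc_preimage].
Qed.

Section cells.
Variables (K : nat) (V : 'I_K -> set Omega).
Hypotheses (mV : forall l, measurable (V l : set (borel Omega)))
  (Vd : forall l l', l != l' -> V l `&` V l' = set0).
Local Notation T0 := (g_sigma_algebraType (past_sets Z)).
Variable W : 'I_K -> T0 -> borel Omega.
Hypotheses (mW : forall l, measurable_fun setT (W l))
  (hW : forall l t kap, good t -> located tau w A t V kap -> W l t = w (kap l) t).

Definition cell_view l t : (borel Omega * M.-tuple E) * E :=
  ((W l t, seen_marks Z V l t), next_mark tau w A V l t).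

Lemma cell_viewE t kap l : good t -> located tau w A t V kap ->
  cell_view l t = mark_view (xi (kap l) t).
Proof.
move=> gt hk; rewrite /cell_view /mark_view /loc /= (hW l gt hk).
by rewrite (seen_marksE mV Vd l gt hk) (next_markE Vd l hk).
Qed.

Lemma measurable_cell_view l : measurable_fun setT (cell_view l : T -> _).
Proof.
have past d' (Y : measurableType d') (f : T0 -> Y) : measurable_fun setT f ->
    measurable_fun setT (f : T -> Y).
  by move=> mf _ D mD; apply: (past_measurable (Z := Z)); exact: mf.
apply: measurable_fun_pair; first apply: measurable_fun_pair.
- by apply: past; exact: mW.
- by apply: past; exact: measurable_seen_marks.
- exact: measurable_next_mark.
Qed.

(** The product of the void probabilities of all observation regions. It does not depend on the
    events tested, and so is common to both computations of the joint law. *)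
Definition cells_weight : \bar R :=
  lap (I (ind (obs_in (~` \bigcup_l V l)))) * \prod_(l < K) lap (I (ind (obs_in (V l)))).

(* The event splits into counts over disjoint regions: one point in each
   [obs_in (V l)] region selected by [U l], none elsewhere among the observed
   points, and an event on the points carrying the new features. *)
Lemma cells_law (U : 'I_K -> set ((borel Omega * M.-tuple E) * E)) (C : set (vmeas n Omega)) :
  (forall l, measurable (U l)) -> measurable C ->
  P ((cells_exact Bs (Z := Z) V : set T) `&` [set t | forall l, U l (cell_view l t)] `&` (new_part tau w A @^-1` C)) =
  cells_weight * P (new_part tau w A @^-1` C) *
    \prod_(l < K) I (ind (obs_in (V l) `&` mark_view @^-1` U l)).
Proof.
move=> mU mC; have mxi := measurable_mpts tau w A.
pose r l := obs_in (V l) `&` mark_view @^-1` U l.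
pose r' l := obs_in (V l) `\` mark_view @^-1` U l.
pose rest := obs_in (~` \bigcup_l V l).
have mo l : measurable (obs_in (V l)) by exact: measurable_obs_in.
have mvU l : measurable (mark_view @^-1` U l).
  by rewrite -[X in measurable X]setTI; exact: measurable_mark_view.
have mr l : measurable (r l) by exact: measurableI.
have mr' l : measurable (r' l) by exact: measurableD.
have mrest : measurable rest by apply: measurable_obs_in; exact: measurable_rest.
have finI D : measurable D -> D `<=` obs -> I (ind D) < +oo.
  move=> mD Do; apply: le_lt_trans (intensity_obs rho_measurable rho_ge0 finiteness).
  apply: (il_le iL); [exact: nnmf_ind|apply: nnmf_ind; exact: measurable_obs|].
  by move=> z; apply: le_ind; exact: Do.
have oX V' : obs_in V' `<=` X0 by move=> z [/obs_X0].
have rX l : r l `<=` X0 by move=> z [/oX].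
have rX' l : r' l `<=` X0 by move=> z [/oX].
have mfr := @measurable_fresh R n M Omega.
pose cnd (D : set S) : T -> \bar R := cnt xi D.
(* One point in the part of the cell selected by [U l], none in the rest of the cell. The
   exponentials of the two Poisson probabilities recombine into the void probability of the whole
   cell. *)
pose Ec l := lev (cnd (r l)) 1 `&` lev (cnd (r' l)) 0.
pose Fn := [set t | C (new_part tau w A t)] `&` [set t | cnd fresh t < +oo].
(* The index None collects what happens outside the cells: no further observed point, and the event
   on the fresh points. *)
pose EE (o : option 'I_K) := if o is Some l then Ec l else lev (cnd rest) 0 `&` Fn.
pose RR (o : option 'I_K) := if o is Some l then obs_in (V l) else rest `|` fresh.
have sFn : cnt_sigma (R := R) xi fresh Fn by exact: new_part_sigma.
have sE o : cnt_sigma (R := R) xi (RR o) (EE o).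
  case: o => [l|] /=; apply: gsigmaI.
  - by apply: cnt_sigma_lev => // z [].
  - by apply: cnt_sigma_lev => // z [].
  - by apply: cnt_sigma_lev => // z; left.
  - by apply: cnt_sigma_sub sFn => z; right.
have dR o o' : o != o' -> RR o `&` RR o' = set0.
  have d1 l : obs_in (V l) `&` (rest `|` fresh) = set0.
    apply/seteqP; split => // z [[oz Vz] [[_ nV]|[[_ fz] _]]].
      by apply: nV; exists l.
    by case: oz.
  case: o => [l|]; case: o' => [l'|]//= ll'; last by rewrite setIC.
  apply/seteqP; split => // z [[_ Vz] [_ Vz']].
  by have : (V l `&` V l') (loc z) by []; rewrite Vd//; apply: contraNneq ll' => ->.
have RX o : RR o `<=` X0.
  by case: o => [l|] z /=; [move=> /oX|move=> [/oX|/fresh_X0]].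
pose s : seq (option 'I_K) := None :: map Some (index_enum 'I_K).
have us : uniq s.
  rewrite /s /= map_inj_uniq ?index_enum_uniq ?andbT; last by move=> l l' [].
  by apply/mapP => -[].
have PE l : P (Ec l) = I (ind (r l)) * lap (I (ind (obs_in (V l)))).
  have d0 : r l `&` r' l = set0 by apply/seteqP; split => // z [[_ Uz] [_ /(_ Uz)]].
  have I1 := finI _ (mr l) (fun z h => proj1 (proj1 h)).
  have I2 := finI _ (mr' l) (fun z h => proj1 (proj1 h)).
  rewrite (cnt_sigma_indep mxi iL LF (rX l) (rX' l) d0); last 2 first.
  - exact: cnt_sigma_lev.
  - exact: cnt_sigma_lev.
  rewrite (cnt_lev1 mxi iL LF (mr l) (rX l) I1) (cnt_lev0 mxi iL LF (mr' l) (rX' l) I2).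
  have i1 : 0 <= I (ind (r l)) by apply: (il_ge0 iL); exact: nnmf_ind.
  have i2 : 0 <= I (ind (r' l)) by apply: (il_ge0 iL); exact: nnmf_ind.
  rewrite -muleA -(lapD i1 i2); congr (_ * lap _).
  apply: etrans (esym (ilD iL (nnmf_ind (mr l)) (nnmf_ind (mr' l)))) _.
  congr (I _); apply/funext => z; have [oz|oz] := pselect (obs_in (V l) z); last first.
    by rewrite !ind0 ?adde0// => -[].
  rewrite (ind1 oz); have [Uz|Uz] := pselect ((mark_view @^-1` U l) z).
    by rewrite ind1// ind0 ?adde0// => -[].
  by rewrite ind0 ?add0e ?ind1// => -[].
have PFn : P Fn = P (new_part tau w A @^-1` C).
  apply: ae_measure_eq.
  - exact: (cnt_sigma_measurable mxi sFn).
  - by rewrite -[X in measurable X]setTI; exact: measurable_funPT.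
  - apply: filterS good_ae => t [_ [N hN] _]; split => [[]//|Ct]; split => //=.
    rewrite /cnd /cnt (psum_finite (N := N)); last 2 first.
    + by move=> z; exact: ind_ge0.
    + by move=> k /hN[_ nf]; rewrite ind0.
    by apply/lte_sum_pinfty => k _; apply: (le_lt_trans (ind_le1 _ _)); exact: ltry.
have PN : P (EE None) = lap (I (ind rest)) * P (new_part tau w A @^-1` C).
  have d0 : rest `&` fresh = set0 by apply/seteqP; split => // z [[[_ nz] _] [[_ /nz]]].
  rewrite /= (cnt_sigma_indep mxi iL LF (@oX _) fresh_X0 d0 _ sFn) ?PFn; last exact: cnt_sigma_lev.
  congr (_ * _); have I1 := finI _ mrest (fun z h => proj1 h).
  exact: (cnt_lev0 mxi iL LF mrest (@oX _) I1).
have mEE o : measurable (EE o) by exact: (cnt_sigma_measurable mxi (sE o)).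
transitivity (P (\big[setI/setT]_(o <- s) EE o)); last first.
  rewrite (cnt_sigma_mutual mxi iL LF us RX dR sE) big_cons big_map PN.
  have alg (a b i p : \bar R) : a * b * (i * p) = a * p * b * i.
    by rewrite (muleC i) muleACA muleA.
  by rewrite (eq_bigr _ (fun l _ => PE l)) big_split /= /cells_weight; exact: alg.
apply: ae_measure_eq.
- apply: measurableI; first apply: measurableI.
  + apply: (past_measurable (Z := Z)); exact: measurable_cells_exact.
  + rewrite [X in measurable X](_ : _ = \bigcap_(l in [set: 'I_K]) (cell_view l @^-1` U l)).
      apply: fin_bigcap_measurable => // l _; rewrite -[X in measurable X]setTI.
      by apply: measurable_cell_view.
    by apply/seteqP; split => t h l; [move=> _; exact: h|exact: h].
  + by rewrite -[X in measurable X]setTI; exact: measurable_funPT.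
- by rewrite -bigcap_seq; apply: fin_bigcap_measurable => //; exact: finite_seq.
apply: filterS good_ae => t gt.
have bigE : (\big[setI/setT]_(o <- s) EE o) t <-> forall o, EE o t.
  rewrite -bigcap_seq; split => h o; last by move=> _; exact: h.
  apply: h => /=; case: o => [l|]; last exact: mem_head.
  by rewrite in_cons map_f ?orbT// mem_index_enum.
rewrite bigE; split.
  move=> [[/(cells_exact_located hO bB mV Vd gt)[kap hk] hU] Ct].
  have [h1 h2] := hk; have kV l k : obs (xi k t) -> V l (w k t) -> k = kap l.
    move=> /h2[l' ->] Vl'; congr kap; apply: contrapT => /eqP/Vd; apply/eqP/set0P.
    by exists (w (kap l') t); split => //; have [] := h1 l'.
  case=> [l|]; split.
  - apply: (cnt_one (k := kap l)) => k'; split => [[[ok Vk] _]|->]; first exact: kV.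
    by split; [exact: h1|rewrite /preimage /= -(cell_viewE l gt hk)].
  - apply: cnt_none => k [[ok Vk] nU]; apply: nU.
    by rewrite (kV l k ok Vk) /preimage /= -(cell_viewE l gt hk).
  - apply: cnt_none => k [ok nV]; apply: nV; have [l e] := h2 k ok.
    by exists l => //; rewrite e; have [] := h1 l.
  - split => //=; have [_ [N hN] _] := gt.
    rewrite /cnd /cnt (psum_finite (N := N)); last 2 first.
    + by move=> z; exact: ind_ge0.
    + by move=> k /hN[_ nf]; rewrite ind0.
    by apply/lte_sum_pinfty => k _; apply: (le_lt_trans (ind_le1 _ _)); exact: ltry.
(* Conversely, the count 1 in [r l] names the index of the observed point of the cell, and the zero
   counts exclude all other observed points. *)
move=> h; have /choice[kap hk] : forall l, exists k, forall k', r l (xi k' t) <-> k' = k.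
  by move=> l; have [/cnt1_one] := h (Some l).
have hr l : r l (xi (kap l) t) by apply/hk.
have lk : located tau w A t V kap.
  split; first by move=> l; have [] := hr l.
  move=> k ok; have [[l _ Vl]|nV] := pselect ((\bigcup_l V l) (w k t)); last first.
    by have [/cnt0_none/(_ k)] := h None; case; split.
  exists l; apply/hk; split => //; apply: contrapT => nU.
  by have [_ /cnt0_none/(_ k)] := h (Some l); case; split.
split; last by have [_ []] := h None.
split; first by apply/(cells_exact_located hO bB mV Vd gt); exists kap.
by move=> l; rewrite (cell_viewE l gt lk); have [_] := hr l.
Qed.

End cells.
End cell_law.

(** * The next mark of an observed point *)

Section next_mark_kernel.
Context {R : realType} {n M : nat} {Omega : completePseudoMetricType R}.
Local Notation E := (vec R n).
Local Notation X := (R * borel Omega)%type.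
Local Notation S := (X * M.+1.-tuple E)%type.
Local Notation D := (borel Omega * M.-tuple E)%type.
Variable G : R.-pker R ~> vec R n.
Variable PJ : R.-pker D ~> R.

Lemma measurable_jump_pair : measurable_fun setT (fun p : (D * R) * E => (p.1.2, p.2)).
Proof. by apply: measurable_fun_pair => //; apply: measurableT_comp. Qed.

Lemma measurable_jump : measurable_fun setT (fun p : D * R => p.2).
Proof. exact: measurable_snd. Qed.

Definition next_jump : R.-pker D ~> (R * E)%type :=
  kseq_comp PJ (kseq_comp (kpull G measurable_jump) (kdirac measurable_jump_pair)).

Lemma integral_next_jump x (f : R * E -> \bar R) : nnmf f ->
  \int[next_jump x]_p f p = \int[PJ x]_s \int[G s]_a f (s, a).
Proof.
move=> nf; rewrite integral_kseq//; apply: eq_integral => s _.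
rewrite integral_kseq//; apply: eq_integral => a _.
by case: nf => mf _; rewrite integral_dirac// diracT mul1e.
Qed.

(** The law of A_l given the location of the feature and its first M marks. *)
Definition next_law (x : D) (B : set E) : \bar R := \int[PJ x]_s G s B.

Lemma nnmf_G (B : set E) : measurable B -> nnmf (fun s => G s B).
Proof. by move=> mB; split => [|s]; [exact: measurable_kernel|exact: measure_ge0]. Qed.

Lemma unit_fun_next_law (B : set E) : measurable B -> unit_fun (next_law ^~ B).
Proof.
move=> mB; split; first exact: kop_nnmf (kop_ker PJ) (nnmf_G mB).
move=> x; rewrite -(integral_prob_kernel_cst PJ x 1).
apply: (il_le (integral_like_int _)); [exact: nnmf_G|exact: nnmf_cst|].
by move=> s; exact: pker_le1.
Qed.

Lemma next_lawE x (B : set E) : measurable B -> next_jump x (setT `*` B) = next_law x B.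
Proof.
move=> mB; have mTB : measurable (setT `*` B : set (R * E)) by exact: measurableX.
rewrite -integral_ind// integral_next_jump; last exact: nnmf_ind.
apply: eq_integral => s _; rewrite -(integral_ind (G s))//; apply: eq_integral => a _.
by apply: ind_congr; split => [[]|].
Qed.

Variables (B0 : probability (borel Omega) R) (rho : R -> Omega -> R).
Hypothesis rho_measurable : measurable_fun
  ([set x | (0 < x.1)%R] : set X) (fun x => rho x.1 x.2).
Hypothesis rho_ge0 : forall (s : R) w, (0 < s)%R -> (0 <= rho s w)%R.
Hypothesis PJ_disintegrates : {ae B0, forall w, disintegrates G rho PJ w}.

Local Notation I := (marked_intensity B0 rho G (m := M.+1)).
Local Notation kp := (kprodt (gate G) M).

Lemma iterated_gate s (f : M.-tuple E -> \bar R) : (0 < s)%R -> nnmf f ->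
  iterated_integral (G s) f = \int[kp (nseq_tuple M s)]_a f a.
Proof. by move=> s0 nf; rewrite -(iterated_integralE (gate G))// /= gate_pos. Qed.

Let r (w : Omega) s := rho0 (Omega := Omega) rho (s, w).

Let nnmf_r w : nnmf (r w).
Proof.
apply: nnmf_comp (nnmf_rho0 rho_measurable rho_ge0).
exact: (pair2_measurable (w : borel Omega)).
Qed.

Let measurable_pair_loc (w : Omega) : measurable_fun setT (fun a : M.-tuple E => (w, a) : D).
Proof. exact: (pair1_measurable (w : borel Omega)). Qed.

(** The disintegration is available on nonzero mark vectors only, and these are the first marks of
    observed points. *)
Let Dw (F : set D) w : set (M.-tuple E) := [set a | a <> no_marks /\ F (w, a)].

Let measurable_Dw F w : measurable F -> measurable (Dw F w).
Proof.
move=> mF; apply: measurableI; first by apply: measurableC; exact: measurable_no_marks.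
by rewrite -[X in measurable X]setTI; exact: measurable_pair_loc.
Qed.

(** The hypothesis is the case where g is an indicator; both sides are integral-like in g. *)
Lemma disintegrates_integral w (F : set D) (g : R -> \bar R) : disintegrates G rho PJ w ->
  measurable F -> nnmf g ->
  \int[lebesgue_measure]_s (r w s * (kp (nseq_tuple M s) (Dw F w) * g s)) =
  \int[lebesgue_measure]_s (r w s *
    \int[kp (nseq_tuple M s)]_a (ind (Dw F w) a * \int[PJ (w, a)]_s' g s')).
Proof.
move=> dw mF ng; have mD := measurable_Dw w mF.
have nD : nnmf (ind (Dw F w) : M.-tuple E -> \bar R) by exact: nnmf_ind.
have mns : measurable_fun [set: R] (fun s => nseq_tuple M s) by exact: measurable_nseq_tuple.
pose kpn : R.-pker R ~> (M.-tuple E) := kpull kp mns.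
pose L1 (g : R -> \bar R) := \int[lebesgue_measure]_s (r w s * (kp (nseq_tuple M s) (Dw F w) * g s)).
pose L2 (g : R -> \bar R) := \int[lebesgue_measure]_s (r w s *
    \int[kp (nseq_tuple M s)]_a (ind (Dw F w) a * \int[PJ (w, a)]_s' g s')).
have nk : nnmf (fun s => kp (nseq_tuple M s) (Dw F w)).
  by split => [|s]; [exact: (measurable_kernel kpn)|exact: measure_ge0].
have iL1 : integral_like L1.
  apply: (integral_like_kop integral_like_lebesgue
    (K := fun g s => r w s * (kp (nseq_tuple M s) (Dw F w) * g s))).
  exact: (kop_comp (kop_mul (nnmf_r w)) (kop_mul nk)).
have iL2 : integral_like L2.
  apply: (integral_like_kop integral_like_lebesgue (K := fun g s => r w s *
    \int[kp (nseq_tuple M s)]_a (ind (Dw F w) a * \int[PJ (w, a)]_s' g s'))).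
  apply: (kop_comp (kop_mul (nnmf_r w)) _ (K := fun g s =>
    \int[kp (nseq_tuple M s)]_a (ind (Dw F w) a * \int[PJ (w, a)]_s' g s'))).
  apply: (kop_comp (kop_ker kpn) _ (K := fun g a => ind (Dw F w) a * \int[PJ (w, a)]_s' g s')).
  apply: (kop_comp (kop_mul nD) _ (K := fun g a => \int[PJ (w, a)]_s' g s')).
  exact: (kop_comp (kop_pull (measurable_pair_loc w)) (kop_ker PJ)).
apply: (integral_like_eq iL1 iL2) => // B mB.
have DE : Dw F w `<=` [set a | exists i, tnth a i != (0 : 'rV[R]_n)%R].
  by move=> a [/no_marksE/existsNP[i ai] _]; exists i; exact/eqP.
have := dw B (Dw F w) mB mD DE.
rewrite integral_mkcond [RHS]integral_mkcond => h.
transitivity (\int[lebesgue_measure]_s ((fun s => (rho s w)%:E *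
    iterated_integral (G s) (fun a => (\1_(Dw F w) a)%:E)) \_ (`]0%R, +oo[ `&` B)) s).
  apply: eq_integral => s _; rewrite patchE /r /rho0 /=; case: ifPn => s0; last first.
    rewrite mul0e memNset// => -[]; rewrite /= in_itv/= andbT => s0'.
    by rewrite s0' in s0.
  have [Bs|nB] := pselect (B s); last by rewrite ind0// !mule0 memNset// => -[].
  rewrite [X in _ * (_ * X)]ind1// mule1 mem_set; last by split => //=; rewrite in_itv/= s0.
  by rewrite (iterated_gate s0 nD) integral_ind.
rewrite h; apply: eq_integral => s _; rewrite patchE /r /rho0 /=; case: ifPn => s0s.
  have s0 : (0 < s)%R by move: s0s; rewrite inE /= in_itv/= andbT.
  rewrite s0 iterated_gate//; last first.
    apply: nnmfM => //; split => [|a]; last exact: measure_ge0.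
    exact: (measurableT_comp (measurable_kernel PJ B mB) (measurable_pair_loc w)).
  by congr (_ * _); apply: eq_integral => a _; rewrite integral_ind.
by rewrite ifF ?mul0e//; apply/negbTE/negP => s0; move/negP: s0s; apply; rewrite inE /= in_itv/= s0.
Qed.

(** This is where the posterior law of the jump enters. The marks are independent given s, so
    integrating out the last one leaves [G s B]; disintegration with g s = G s B then replaces it by
    its mean under [PJ]. The identity is integrated over locations, so almost every w suffices. *)
Lemma intensity_disintegration (V : set (borel Omega)) (F : set D) (B : set E) :
  measurable V -> measurable F -> measurable B ->
  I (ind (obs_in V `&` mark_view @^-1` (F `*` B))) =
  I (fun z => ind (obs_in V) z * (ind F (mark_view z).1 * next_law (mark_view z).1 B)).
Proof.
move=> mV mF mB; have mview : measurable_fun setT (@mark_view R n M Omega) by exact: measurable_mark_view.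
have mfst : measurable_fun setT (fun z : S => (mark_view z).1) by apply: measurableT_comp.
have nO : nnmf (ind (obs_in V) : S -> \bar R) by apply: nnmf_ind; exact: measurable_obs_in.
have nlB : nnmf (next_law ^~ B) by case: (unit_fun_next_law mB).
have nF : nnmf (ind F : D -> \bar R) by exact: nnmf_ind.
have n1 : nnmf (ind (obs_in V `&` mark_view @^-1` (F `*` B)) : S -> \bar R).
  apply: nnmf_ind; apply: measurableI; first exact: measurable_obs_in.
  by rewrite -[X in measurable X]setTI; apply: mview => //; exact: measurableX.
have n2 : nnmf (fun z : S => ind (obs_in V) z * (ind F (mark_view z).1 * next_law (mark_view z).1 B)).
  exact: (nnmfM nO (nnmfM (nnmf_comp mfst nF) (nnmf_comp mfst nlB))).
have k1 := kop_comp (kop_lebesgue (borel Omega)) (kop_mul (nnmf_rho0 rho_measurable rho_ge0)).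
have kI := kop_comp k1 (kop_hat (mark_kernel G (m := M.+1))).
have m1 := kop_nnmf kI n1; have m2 := kop_nnmf kI n2.
apply: ge0_ae_eq_integral => //; [exact: (proj1 m1)|exact: (proj1 m2)|..].
- by move=> w _; exact: (proj2 m1).
- by move=> w _; exact: (proj2 m2).
apply: negligibleS PJ_disintegrates => w /= + dw; apply => _.
have mD := measurable_Dw w mF.
have nD : nnmf (ind (Dw F w) : M.-tuple E -> \bar R) by exact: nnmf_ind.
have nBi : nnmf (ind B : E -> \bar R) by exact: nnmf_ind.
have nDl : nnmf (fun a => ind (Dw F w) a * next_law (w, a) B).
  exact: (nnmfM nD (nnmf_comp (measurable_pair_loc w) nlB)).
have [Vw|nV] := pselect (V w); last first.
  apply: eq_integral => s _; congr (_ * _); apply: eq_integral => y _.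
  by rewrite (ind0 (A := obs_in V)) ?mul0e; [rewrite ind0// => -[[]]|move=> []].
have dI := disintegrates_integral dw mF (nnmf_G mB).
transitivity (\int[lebesgue_measure]_s (r w s * (kp (nseq_tuple M s) (Dw F w) * G s B))).
  apply: eq_integral => s _; rewrite /r /rho0 /=; case: ifPn => s0; last by rewrite !mul0e.
  congr (_ * _); have := integral_split_marks (gate G) s nD nBi.
  have -> : \int[gate G s]_a ind B a = G s B by rewrite gate_pos// integral_ind.
  rewrite (integral_ind (kp (nseq_tuple M s)) mD) => <-; apply: eq_integral => y _.
  have [Dy|nDy] := pselect (Dw F w (first_marks y)); last first.
    rewrite (ind0 nDy) mul0e ind0// => -[[[_ oy] _] [Fy _]]; apply: nDy; split => //.
  rewrite (ind1 Dy) mul1e; apply: ind_congr; case: Dy => oy Fy.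
  by split => [[_ []]|By]//; split => //; split.
rewrite dI; apply: eq_integral => s _; rewrite /r /rho0 /=; case: ifPn => s0; last by rewrite !mul0e.
congr (_ * _); have := integral_split_marks (gate G) s nDl (nnmf_cst E lee01).
rewrite integral_prob_kernel_cst mule1 => <-; apply: eq_integral => y _.
rewrite mule1 /=.
have [oy|noy] := pselect (first_marks y = no_marks).
  by rewrite (ind0 (A := obs_in V)) ?mul0e; [rewrite ind0 ?mul0e// => -[]|move=> [[]]].
rewrite (ind1 (A := obs_in V))// mul1e; congr (_ * _); apply: ind_congr.
by split => // -[].
Qed.

End next_mark_kernel.

Lemma prod_upd_ord {R : realType} d (S : measurableType d) K
    (H : 'I_K -> (S -> \bar R) -> \bar R) (psi : nat -> S -> \bar R) k (kK : (k < K)%N) f :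
  \prod_(l < K) H l (upd psi k f l) =
  (\prod_(l < K | l != Ordinal kK) H l (psi l)) * H (Ordinal kK) f.
Proof.
rewrite (bigD1 (Ordinal kK))//= {1}/upd eqxx muleC; congr (_ * _).
by apply: eq_bigr => l lk; rewrite /upd ifF//; exact: negbTE.
Qed.

Lemma multilinear_product {R : realType} d (T : measurableType d) (P : probability T R)
    dS (S : measurableType dS) K (view : 'I_K -> T -> S) (E0 : set T) (c : \bar R)
    (L : 'I_K -> (S -> \bar R) -> \bar R) :
  (forall l, measurable_fun setT (view l)) -> measurable E0 -> 0 <= c ->
  (forall l, integral_like (L l)) ->
  (forall U : 'I_K -> set S, (forall l, measurable (U l)) ->
    P (E0 `&` [set t | forall l, U l (view l t)]) = c * \prod_(l < K) L l (ind (U l))) ->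
  forall phi : nat -> S -> \bar R, (forall i, unit_fun (phi i)) ->
  \int[P]_t (ind E0 t * \prod_(l < K) phi l (view l t)) = c * \prod_(l < K) L l (phi l).
Proof.
move=> mview mE0 c0 iL PU.
have nE0 : nnmf (ind E0 : T -> \bar R) by exact: nnmf_ind.
pose F1 (phi : nat -> S -> \bar R) := \int[P]_t (ind E0 t * \prod_(l < K) phi l (view l t)).
pose F2 (phi : nat -> S -> \bar R) := c * \prod_(l < K) L l (phi l).
have uprod (psi : nat -> S -> \bar R) p : (forall i, unit_fun (psi i)) ->
    nnmf (fun t : T => \prod_(l < K | p l) psi l (view l t)).
  by move=> upsi; apply: nnmf_prod => l; exact: (nnmf_comp (mview l) (proj1 (upsi l))).
apply: (@multilinear_unique R _ _ K measurable F1 F2).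
- by rewrite sigma_algebra_id//; exact: sigma_algebra_measurable.
- exact: measurableI.
- exact: measurableT.
- move=> psi k kK upsi; pose k' := Ordinal kK.
  have -> : (fun f => F1 (upd psi k f)) = (fun f => \int[P]_t
      ((ind E0 t * \prod_(l < K | l != k') psi l (view l t)) * f (view k' t))).
    apply/funext => f; apply: eq_integral => t _; rewrite -muleA; congr (_ * _).
    exact: (prod_upd_ord (fun l f => f (view l t)) psi kK f).
  have nn := nnmfM nE0 (uprod psi (fun l => l != k') upsi).
  exact: (integral_like_kop (integral_like_int P) (kop_comp (kop_mul nn) (kop_pull (mview k')))).
- move=> psi k kK upsi; pose k' := Ordinal kK.
  have -> : (fun f => F2 (upd psi k f)) = (fun f => (c *
      \prod_(l < K | l != k') L l (psi l)) * L k' f).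
    by apply/funext => f; rewrite -muleA; congr (_ * _); exact: (prod_upd_ord L psi kK f).
  apply: integral_like_scale => //; rewrite mule_ge0//.
  by apply: prode_ge0 => l _; apply: (il_ge0 (iL l)); case: (upsi l).
- move=> psi upsi; apply: unit_fun_prob_lty; split; first exact: (nnmfM nE0 (uprod psi xpredT upsi)).
  move=> t; rewrite -[leRHS]mule1; apply: lee_pmul; [exact: ind_ge0| |exact: ind_le1|].
    by apply: prode_ge0 => l _; case: (upsi l) => -[].
  by apply: prod_unit => l; case: (upsi l) => -[_ h0] h1; rewrite h0 h1.
- by move=> psi psi' h; apply: eq_integral => t _; congr (_ * _); apply: eq_bigr => l _; rewrite h.
- by move=> psi psi' h; congr (_ * _); apply: eq_bigr => l _; rewrite h.
move=> U mU; rewrite /F1 /F2 -(PU (fun l => U l))// -integral_ind; last first.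
  apply: measurableI => //; rewrite [X in measurable X](_ : _ = \bigcap_(l in [set: 'I_K]) (view l @^-1` U l)).
    apply: fin_bigcap_measurable => // l _; rewrite -[X in measurable X]setTI; exact: mview.
  by apply/seteqP; split => t h l; [move=> _; exact: h|exact: h].
apply: eq_integral => t _; rewrite indI; congr (_ * _).
have [h|/existsNP[l nl]] := pselect (forall l : 'I_K, U l (view l t)).
  by rewrite (ind1 (A := [set t | _]))// big1// => l _; rewrite ind1.
rewrite (ind0 (A := [set t | _])) => [|/(_ l)//].
by rewrite (bigD1 l)//= ind0// mul0e.
Qed.

(** * Replacing the next marks by their conditional laws *)

Section prediction.
#[local] Opaque marked_intensity.
Context {R : realType} {n M : nat} {Omega : completePseudoMetricType R}.
Local Notation E := (vec R n).
Local Notation X := (R * borel Omega)%type.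
Local Notation S := (X * M.+1.-tuple E)%type.
Hypothesis hO : hausdorff_space Omega.
Variable Bs : nat -> set Omega.
Hypothesis bB : countable_base Bs.
Variables (B0 : probability (borel Omega) R) (rho : R -> Omega -> R).
Hypothesis B0_nonatomic : forall w : Omega, B0 [set w] = 0.
Hypothesis rho_measurable : measurable_fun
  ([set x | (0 < x.1)%R] : set X) (fun x => rho x.1 x.2).
Hypothesis rho_ge0 : forall (s : R) w, (0 < s)%R -> (0 <= rho s w)%R.
Variable G : R.-pker R ~> vec R n.
Hypothesis finiteness : \int[B0]_w \int[lebesgue_measure]_(s in `]0%R, +oo[)
  (pi_A G s * rho s w)%:E < +oo.
Context d (T : measurableType d) (P : probability T R).
Variables (tau : nat -> {RV P >-> R}) (w : nat -> {RV P >-> borel Omega}).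
Hypothesis prm : is_PRM P (point_measure tau w) (levy_intensity rho B0).
Variable A : 'I_M.+1 -> nat -> {RV P >-> vec R n}.
Hypothesis A_marks : forall (H : set T) (r : nat) (D : 'I_M.+1 -> nat -> set (vec R n)),
  points_sigma tau w H -> (forall i k, measurable (D i k)) ->
  P (H `&` [set t | forall i k, (k < r)%N -> present tau t k -> D i k (A i k t)]) =
  \int[P]_(t in H) (\prod_(k < r | (0 < tau k t)%R) \prod_(i < M.+1)
     fine (G (tau k t) (D i k)))%:E.
Variable Z : 'I_M.+1 -> {RV P >-> vmeas n Omega}.
Hypothesis Z_points : forall i, {ae P, forall t, forall B : set (borel Omega), measurable B ->
  Z i t B = (\sum_(k \in [set k | present tau t k /\ B (w k t)]) (A i k t : 'rV[R]_n))%R}.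

Local Notation I := (marked_intensity B0 rho G (m := M.+1)).
Local Notation xi := (mpts tau w A).
Local Notation good := (good tau w A Z).

Let iL : integral_like I := marked_intensity_il (m := M.+1) B0 rho_measurable rho_ge0 G.

Local Notation D := (borel Omega * M.-tuple E)%type.
Variable PJ : R.-pker D ~> R.
Hypothesis PJ_disintegrates : {ae B0, forall w, disintegrates G rho PJ w}.

Section cells.
Variables (K : nat) (V : 'I_K -> set Omega).
Hypotheses (mV : forall l, measurable (V l : set (borel Omega)))
  (Vd : forall l l', l != l' -> V l `&` V l' = set0).
Local Notation T0 := (g_sigma_algebraType (past_sets Z)).
Variable W : 'I_K -> T0 -> borel Omega.
Hypotheses (mW : forall l, measurable_fun setT (W l))
  (hW : forall l t kap, good t -> located tau w A t V kap -> W l t = w (kap l) t).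

Local Notation cex := (cells_exact Bs (Z := Z) V : set T).
Local Notation new := (new_part tau w A).
Local Notation view := (cell_view tau w A V W).

Let LV l (f : D * E -> \bar R) := I (fun z => ind (obs_in (V l)) z * f (mark_view z)).

Let iLV l : integral_like (LV l).
Proof.
have nO : nnmf (ind (obs_in (V l)) : S -> \bar R) by apply: nnmf_ind; exact: measurable_obs_in.
apply: (integral_like_kop iL (K := fun f z => ind (obs_in (V l)) z * f (mark_view z))).
exact: (kop_comp (kop_mul nO) (kop_pull (@measurable_mark_view R n M Omega))).
Qed.

Let mview l : measurable_fun setT (view l : T -> _).
Proof. exact: measurable_cell_view. Qed.

Let mcex : measurable cex.
Proof. by apply: (past_measurable (Z := Z)); exact: measurable_cells_exact. Qed.

Let mnew (C : set (vmeas n Omega)) : measurable C -> measurable (new @^-1` C).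
Proof. by move=> mC; rewrite -[X in measurable X]setTI; exact: measurable_funPT. Qed.

Let weight_ge0 : 0 <= cells_weight (M := M) B0 rho G V.
Proof.
by apply: mule_ge0; [exact: lap_ge0|apply: prode_ge0 => l _; exact: lap_ge0].
Qed.

Lemma cells_law_fun (C : set (vmeas n Omega)) (phi : nat -> D * E -> \bar R) :
  measurable C -> (forall i, unit_fun (phi i)) ->
  \int[P]_t (ind (cex `&` new @^-1` C) t * \prod_(l < K) phi l (view l t)) =
  cells_weight (M := M) B0 rho G V * P (new @^-1` C) * \prod_(l < K) LV l (phi l).
Proof.
move=> mC; have mE0 : measurable (cex `&` new @^-1` C) by apply: measurableI => //; exact: mnew.
have cge0 : 0 <= cells_weight (M := M) B0 rho G V * P (new @^-1` C).
  by apply: mule_ge0; [exact: weight_ge0|exact: measure_ge0].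
apply: (multilinear_product mview mE0 cge0 iLV) => U mU.
rewrite setIAC; apply: etrans (cells_law hO bB B0_nonatomic rho_measurable rho_ge0 finiteness
  prm A_marks Z_points mV Vd mW hW mU mC) _.
have LE l : I (ind (obs_in (V l) `&` mark_view @^-1` U l)) = LV l (ind (U l)).
  by congr (I _); apply/funext => z; rewrite indI.
have LP : \prod_(l < K) I (ind (obs_in (V l) `&` mark_view @^-1` U l)) =
    \prod_(l < K) LV l (ind (U l)) by apply: eq_bigr => l _; exact: LE.
exact: (congr1 (fun x => cells_weight (M := M) B0 rho G V * P (new @^-1` C) * x) LP).
Qed.

Definition cells_data (t : T) : K.-tuple D := [tuple (view l t).1 | l < K].

Definition cells_next (t : T) : K.-tuple E := [tuple (view l t).2 | l < K].

(** [cells_law_fun] is used twice, with the true next marks and the event C, and with [next_law] and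
    no condition on the new part. The functionals agree cell by cell, and what remains is the factor
    P (new in C), that is, independence of the new part. *)
Lemma predict_rect (F : 'I_K -> set D) (B : 'I_K -> set E) (C : set (vmeas n Omega)) :
  (forall l, measurable (F l)) -> (forall l, measurable (B l)) -> measurable C ->
  \int[P]_t (ind cex t * (ind (tuple_rect F) (cells_data t) *
    (ind (tuple_rect B) (cells_next t) * ind C (new t)))) =
  \int[P]_t (ind cex t * (ind (tuple_rect F) (cells_data t) *
    (\prod_(l < K) next_law G PJ (tnth (cells_data t) l) (B l) * P (new @^-1` C)))).
Proof.
move=> mF mB mC.
(* Families over 'I_K are extended by the full set to fit the [nat]-indexed test functions of
   [cells_law_fun]. *)
pose ext (d' : measure_display) (Y : measurableType d') (H : 'I_K -> set Y) (i : nat) : set Y :=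
  if insub i is Some l then H l else setT.
have extE d' (Y : measurableType d') (H : 'I_K -> set Y) (l : 'I_K) : ext d' Y H l = H l.
  by rewrite /ext insubT//= => lK; congr H; exact/val_inj.
have mext d' (Y : measurableType d') (H : 'I_K -> set Y) i : (forall l, measurable (H l)) ->
    measurable (ext d' Y H i).
  by move=> mH; rewrite /ext; case: insub.
pose phi i (p : D * E) : \bar R := ind (ext _ _ F i) p.1 * ind (ext _ _ B i) p.2.
pose psi i (p : D * E) : \bar R := ind (ext _ _ F i) p.1 * next_law G PJ p.1 (ext _ _ B i).
have uM (f g : D * E -> \bar R) : unit_fun f -> unit_fun g -> unit_fun (fun p => f p * g p).
  move=> [nf f1] [ng g1]; split; first exact: nnmfM.
  by move=> p; rewrite -[leRHS]mule1; apply: lee_pmul => //; [case: nf|case: ng].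
have uF i : unit_fun (fun p : D * E => ind (ext _ _ F i) p.1 : \bar R).
  split; last by move=> p; exact: ind_le1.
  by apply: (nnmf_comp measurable_fst); apply: nnmf_ind; exact: mext.
have uphi i : unit_fun (phi i).
  apply: uM => //; split; last by move=> p; exact: ind_le1.
  by apply: (nnmf_comp measurable_snd); apply: nnmf_ind; exact: mext.
have upsi i : unit_fun (psi i).
  have [nl l1] := unit_fun_next_law G PJ (mext _ _ B i mB).
  by apply: uM => //; split => //; exact: (nnmf_comp measurable_fst nl).
have phiE t : \prod_(l < K) phi l (view l t) =
    ind (tuple_rect F) (cells_data t) * ind (tuple_rect B) (cells_next t).
  rewrite !ind_tuple_rect -big_split /=; apply: eq_bigr => l _.
  by rewrite /phi !extE !tnth_mktuple.
have psiE t : \prod_(l < K) psi l (view l t) =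
    ind (tuple_rect F) (cells_data t) * \prod_(l < K) next_law G PJ (tnth (cells_data t) l) (B l).
  rewrite ind_tuple_rect -big_split /=; apply: eq_bigr => l _.
  by rewrite /psi !extE !tnth_mktuple.
have LVE (l : 'I_K) : LV l (phi l) = LV l (psi l).
  have h := intensity_disintegration rho_measurable rho_ge0 PJ_disintegrates (mV l) (mF l) (mB l).
  rewrite /LV /psi /phi !extE -[RHS]h; congr (I _); apply/funext => z.
  apply: etrans _ (esym (indI _ _ _)).
  exact: (congr1 (fun x => ind (obs_in (V l)) z * x) (esym (ind_prod (F l) (B l) (mark_view z)))).
transitivity (\int[P]_t (ind (cex `&` new @^-1` C) t * \prod_(l < K) phi l (view l t))).
  apply: eq_integral => t _; rewrite phiE indI -!muleA; congr (_ * _).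
  by rewrite [RHS]muleC -!muleA.
have LP : \prod_(l < K) LV l (phi l) = \prod_(l < K) LV l (psi l).
  by apply: eq_bigr => l _; exact: LVE.
have e1 := cells_law_fun mC uphi.
have e2 := cells_law_fun measurableT upsi.
rewrite LP in e1; rewrite preimage_setT [X in _ * X * _]probability_setT mule1 setIT in e2.
apply: etrans e1 _; apply: etrans (muleAC _ _ _) _; rewrite -[X in X * _]e2.
have nn : nnmf (fun t : T => ind cex t * \prod_(l < K) psi l (view l t)).
  apply: nnmfM; first exact: nnmf_ind.
  by apply: nnmf_prod => l; exact: (nnmf_comp (mview l) (proj1 (upsi l))).
apply: etrans (esym (nnmf_integralZr P nn (measure_ge0 P (new @^-1` C)))) _.
by apply: eq_integral => t _; rewrite psiE -!muleA.
Qed.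

End cells.
End prediction.

(** * The predictive law *)

Section kernel_probability.
Context {R : realType} d d' (X : measurableType d) (Y : measurableType d').
Variables (k : R.-pker X ~> Y) (x : X).

Definition kernel_prob : set Y -> \bar R := k x.

HB.instance Definition _ := Measure.copy kernel_prob (k x : {measure set Y -> \bar R}).

Let kernel_prob_setT : kernel_prob setT = 1. Proof. exact: prob_kernel. Qed.

HB.instance Definition _ := Measure_isProbability.Build _ _ _ kernel_prob kernel_prob_setT.

End kernel_probability.

Section assemble.
Context {R : realType} {n M : nat} {Omega : completePseudoMetricType R} {K : nat}.
Local Notation E := (vec R n).
Local Notation D := (borel Omega * M.-tuple E)%type.

Definition atoms (x : 'I_K -> Omega) (a : 'I_K -> E) : set Omega -> 'rV[R]_n :=
  fun B => (\sum_(l < K | x l \in B) (a l : 'rV[R]_n))%R.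

Definition assemble (x : K.-tuple D) (b : K.-tuple E) (z : set Omega -> 'rV[R]_n) :
    set Omega -> 'rV[R]_n :=
  fun B => (z B + atoms (fun l => (tnth x l).1) (tnth b) B)%R.

(** Rebuilds Z_i from locations and marks; on the exact event it agrees with Z_i on Borel sets. *)
Definition past_of (x : K.-tuple D) (i : 'I_M) : set Omega -> 'rV[R]_n :=
  atoms (fun l => (tnth x l).1) (fun l => tnth (tnth x l).2 i).

Lemma measurable_evals d (Y : measurableType d) (f : Y -> set Omega -> 'rV[R]_n) :
  (forall B : set (borel Omega), measurable B -> measurable_fun setT (fun y => f y B : E)) ->
  measurable_fun setT (f : Y -> vmeas n Omega).
Proof.
move=> mf; apply: (@measurability _ _ Y (vmeas n Omega) setT f (@eval_cylinders R n Omega)) => //.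
by move=> _ [_ [B [C [mB mC ->]]] <-]; exact: (mf B mB measurableT C mC).
Qed.

Lemma measurable_eval (B : set (borel Omega)) : measurable B ->
  measurable_fun setT (fun z : vmeas n Omega => (z : set Omega -> 'rV[R]_n) B : E).
Proof. by move=> mB _ C mC; rewrite setTI; apply: sub_sigma_algebra; exists B, C. Qed.

Lemma measurable_atoms d (Y : measurableType d) (x : Y -> 'I_K -> borel Omega) (a : Y -> 'I_K -> E)
    (B : set (borel Omega)) :
  (forall l, measurable_fun setT (x ^~ l)) -> (forall l, measurable_fun setT (a ^~ l)) ->
  measurable B -> measurable_fun setT (fun y => atoms (x y) (a y) B : E).
Proof.
move=> mx ma mB; rewrite (_ : (fun y => _) = fun y =>
    (\sum_(l < K) ((if x y l \in B then a y l else vec0) : 'rV[R]_n))%R); last first.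
  by apply/funext => y; rewrite /atoms big_mkcond.
apply: measurable_vec_sum => l; apply: measurable_fun_ifT => //.
apply: (measurable_fun_bool true); rewrite setTI (_ : _ @^-1` _ = (x ^~ l) @^-1` B).
  by rewrite -[X in measurable X]setTI; exact: mx.
by apply/seteqP; split => y /= => [/set_mem|/mem_set].
Qed.

Lemma measurable_assemble d (Y : measurableType d) (x : Y -> K.-tuple D) (b : Y -> K.-tuple E)
    (z : Y -> vmeas n Omega) :
  measurable_fun setT x -> measurable_fun setT b -> measurable_fun setT z ->
  measurable_fun setT (fun y => assemble (x y) (b y) (z y) : vmeas n Omega).
Proof.
move=> mx mb mz; apply: measurable_evals => B mB; apply: measurable_vecD.
  exact: (measurableT_comp (measurable_eval mB) mz).
apply: measurable_atoms => // l.
  exact: (measurableT_comp measurable_fst (measurableT_comp (measurable_tnth l) mx)).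
exact: (measurableT_comp (measurable_tnth l) mb).
Qed.

Lemma measurable_past_of i : measurable_fun setT (past_of ^~ i : _ -> vmeas n Omega).
Proof.
apply: measurable_evals => B mB; apply: measurable_atoms => // l.
  exact: (measurableT_comp measurable_fst (measurable_tnth l)).
exact: (measurableT_comp (measurable_tnth i) (measurableT_comp measurable_snd (measurable_tnth l))).
Qed.

Definition marks_of (y : K.-tuple (R * E)) : K.-tuple E := [tuple (tnth y l).2 | l < K].

Lemma measurable_marks_of : measurable_fun setT marks_of.
Proof.
apply/measurable_fun_tnthP => l.
rewrite (_ : _ \o _ = fun y => (tnth y l).2).
  exact: (measurableT_comp measurable_snd (measurable_tnth l)).
by apply/funext => y /=; rewrite tnth_mktuple.
Qed.

Context d (T : measurableType d) (P : probability T R).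
Variables (G : R.-pker R ~> E) (PJ : R.-pker D ~> R).
Variable new : {RV P >-> vmeas n Omega}.

Local Notation kn := (kprodt (next_jump G PJ) K).

(** The predictive expectation given the data x: jumps and marks are drawn by [next_jump] for each
    feature, independently of the new part. *)
Definition pred_law (f : K.-tuple D * (K.-tuple E * vmeas n Omega) -> \bar R) (x : K.-tuple D) :
  \bar R := \int[P]_t \int[kn x]_y f (x, (marks_of y, new t)).

Lemma kop_pred_law : kernel_op pred_law.
Proof.
have ms : measurable_fun setT (fun p : T * K.-tuple D => p.2) by exact: measurable_snd.
pose k2 : R.-pker (T * K.-tuple D) ~> (K.-tuple (R * E)) := kpull kn ms.
pose h (q : (T * K.-tuple D) * K.-tuple (R * E)) : K.-tuple D * (K.-tuple E * vmeas n Omega) :=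
  (q.1.2, (marks_of q.2, new q.1.1)).
have mh : measurable_fun setT h.
  apply: measurable_fun_pair; first exact: (measurableT_comp measurable_snd measurable_fst).
  apply: measurable_fun_pair; first exact: (measurableT_comp measurable_marks_of measurable_snd).
  have mn : measurable_fun setT new by exact: measurable_funPT.
  exact: (measurableT_comp mn (measurableT_comp measurable_fst measurable_fst)).
exact: (kop_comp (kop_fubini (K.-tuple D) P) (kop_ker2 k2 mh)).
Qed.

Lemma pred_law_rect x (F : set (K.-tuple D)) (B : 'I_K -> set E) (C : set (vmeas n Omega)) :
  (forall l, measurable (B l)) -> measurable C ->
  pred_law (fun p => ind F p.1 * (ind (tuple_rect B) p.2.1 * ind C p.2.2)) x =
  ind F x * (\prod_(l < K) next_law G PJ (tnth x l) (B l) * P (new @^-1` C)).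
Proof.
move=> mB mC; have mnC : measurable (new @^-1` C).
  by rewrite -[X in measurable X]setTI; exact: measurable_funPT.
have mTB l : measurable (setT `*` B l : set (R * E)) by exact: measurableX.
have nB l : nnmf (ind (setT `*` B l : set (R * E)) : _ -> \bar R) by exact: nnmf_ind.
have np : nnmf (fun y : K.-tuple (R * E) => \prod_(l < K) ind (setT `*` B l : set (R * E)) (tnth y l) : \bar R).
  by apply: nnmf_prod => l; exact: (nnmf_comp (measurable_tnth l) (nB l)).
have inner t : \int[kn x]_y (ind F x * (ind (tuple_rect B) (marks_of y) * ind C (new t))) =
    (ind F x * ind C (new t)) * \prod_(l < K) next_law G PJ (tnth x l) (B l).
  transitivity (\int[kn x]_y ((ind F x * ind C (new t)) *
      \prod_(l < K) ind (setT `*` B l : set (R * E)) (tnth y l))).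
    apply: eq_integral => y _; rewrite ind_tuple_rect -muleA; congr (_ * _).
    rewrite muleC; congr (_ * _); apply: eq_bigr => l _; rewrite tnth_mktuple.
    by apply: ind_congr; split => [|[]].
  rewrite nnmf_integralZl//; last by rewrite mule_ge0 ?ind_ge0.
  congr (_ * _); rewrite (integral_kprodt_prod _ _ (f := fun l => ind (setT `*` B l)))//.
  by apply: eq_bigr => l _; rewrite integral_ind// next_lawE.
rewrite /pred_law /=; under eq_integral do rewrite inner.
set p := \prod_(l < K) _; have p0 : 0 <= p.
  by apply: prode_ge0 => l _; have [[_ h] _] := unit_fun_next_law G PJ (mB l); exact: h.
transitivity (\int[P]_t ((ind F x * p) * ind (new @^-1` C) t)).
  by apply: eq_integral => t _; rewrite muleAC.
rewrite nnmf_integralZl; [|exact: nnmf_ind|by rewrite mule_ge0 ?ind_ge0].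
by rewrite integral_ind// muleA.
Qed.

Variables (cex : set T) (data : T -> K.-tuple D) (next : T -> K.-tuple E).
Hypotheses (mcex : measurable cex) (mdata : measurable_fun setT data)
  (mnext : measurable_fun setT next).
Hypothesis rects : forall (F : 'I_K -> set D) (B : 'I_K -> set E) (C : set (vmeas n Omega)),
  (forall l, measurable (F l)) -> (forall l, measurable (B l)) -> measurable C ->
  \int[P]_t (ind cex t * (ind (tuple_rect F) (data t) *
    (ind (tuple_rect B) (next t) * ind C (new t)))) =
  \int[P]_t (ind cex t * (ind (tuple_rect F) (data t) *
    (\prod_(l < K) next_law G PJ (tnth (data t) l) (B l) * P (new @^-1` C)))).

(** Both sides are integral-like in f and finite at f = 1, so the nested rectangles, a generating
    pi-system, decide. *)
Lemma predict_fun (f : K.-tuple D * (K.-tuple E * vmeas n Omega) -> \bar R) : nnmf f ->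
  \int[P]_t (ind cex t * f (data t, (next t, new t))) =
  \int[P]_t (ind cex t * pred_law f (data t)).
Proof.
have nc : nnmf (ind cex : T -> \bar R) by exact: nnmf_ind.
have mn : measurable_fun setT new by exact: measurable_funPT.
have mall : measurable_fun setT (fun t => (data t, (next t, new t))).
  by apply: measurable_fun_pair => //; exact: measurable_fun_pair.
pose L1 (f : K.-tuple D * (K.-tuple E * vmeas n Omega) -> \bar R) :=
  \int[P]_t (ind cex t * f (data t, (next t, new t))).
pose L2 (f : K.-tuple D * (K.-tuple E * vmeas n Omega) -> \bar R) :=
  \int[P]_t (ind cex t * pred_law f (data t)).
have iL1 : integral_like L1.
  exact: (integral_like_kop (integral_like_int P) (kop_comp (kop_mul nc) (kop_pull mall))).
have iL2 : integral_like L2.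
  exact: (integral_like_kop (integral_like_int P)
    (kop_comp (kop_mul nc) (kop_comp (kop_pull mdata) kop_pred_law))).
pose G2 : set (set (K.-tuple E * vmeas n Omega)) :=
  [set A `*` B | A in @tuple_rects _ E K & B in measurable].
pose G1 : set (set (K.-tuple D * (K.-tuple E * vmeas n Omega))) :=
  [set A `*` B | A in @tuple_rects _ D K & B in G2].
have T2 : G2 setT.
  by exists setT; [exact: tuple_rectsT|exists setT => //; rewrite setXTT].
have T1 : G1 setT.
  by exists setT; [exact: tuple_rectsT|exists setT => //; rewrite setXTT].
have vE : measurable = <<s (measurable : set (set (vmeas n Omega))) >>.
  by rewrite sigma_algebra_id//; exact: sigma_algebra_measurable.
have E2 := measurable_prod_rects (tuple_rectsE E K) (tuple_rectsT E K) vE measurableT.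
have E1 := measurable_prod_rects (tuple_rectsE D K) (tuple_rectsT D K) E2 T2.
have I2 : setI_closed G2 by apply: prod_rectsI; [exact: tuple_rectsI|exact: measurableI].
have I1 : setI_closed G1 by apply: prod_rectsI; [exact: tuple_rectsI|exact: I2].
have L12 U : G1 U -> L1 (ind U) = L2 (ind U).
  move=> [_ [F mF ->] [_ [_ [B mB ->] [C mC <-]] <-]].
  have fE : ind (tuple_rect F `*` (tuple_rect B `*` C)) =
      (fun p => ind (tuple_rect F) p.1 * (ind (tuple_rect B) p.2.1 * ind C p.2.2)) :> (_ -> \bar R).
    by apply/funext => p; rewrite ind_prod ind_prod.
  rewrite /L1 /L2 fE; apply: etrans (rects mF mB mC) _; apply: eq_integral => t _.
  by rewrite pred_law_rect.
apply: (integral_like_unique iL1 iL2 E1 I1 L12).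
  by have := L12 _ T1; rewrite indT.
apply: unit_fun_prob_lty; split; first by apply: nnmfM => //; exact: nnmf_cst.
by move=> t; rewrite mule1; exact: ind_le1.
Qed.

End assemble.

Lemma is_IBP_law_ext {R : realType} {n : nat} {Omega : completePseudoMetricType R}
    (G : R.-pker R ~> vec R n) (rho : R -> Omega -> R) (B0 : probability (borel Omega) R)
    (L L' : set (vmeas n Omega) -> \bar R) :
  (forall C, measurable C -> L' C = L C) -> is_IBP_law G rho B0 L -> is_IBP_law G rho B0 L'.
Proof.
move=> LL [d [T [P [tau [w [mu [Z [h1 h2 h3]]]]]]]].
by exists d, T, P, tau, w, mu, Z; split => // C mC; rewrite LL// h3.
Qed.

Section predictive_law.
Context {R : realType} {n M : nat} {Omega : completePseudoMetricType R} {K : nat}.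
Local Notation E := (vec R n).
Local Notation D := (borel Omega * M.-tuple E)%type.
Context d (T : measurableType d) (P : probability T R).
Variables (G : R.-pker R ~> E) (PJ : R.-pker D ~> R).
Variable new : {RV P >-> vmeas n Omega}.
Variable x : K.-tuple D.

Local Notation kn := (kprodt (next_jump G PJ) K).

(** [is_predictive_law] asks for random variables on some space: here the original space carries the
    new part, and an independent factor carries the jumps and marks. *)
Definition draw_prob : probability (T * K.-tuple (R * E))%type R := P \x kernel_prob kn x.

Lemma draw_probE (A : set T) (B : set (K.-tuple (R * E))) : measurable A -> measurable B ->
  draw_prob (A `*` B) = P A * kn x B.
Proof. by move=> mA mB; rewrite /draw_prob /= product_measure1E. Qed.

Definition draw_fun (p : T * K.-tuple (R * E)) : vmeas n Omega :=
  assemble x (marks_of p.2) (new p.1).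

Lemma measurable_draw : measurable_fun setT draw_fun.
Proof.
apply: measurable_assemble; first exact: measurable_cst.
  exact: (measurableT_comp measurable_marks_of measurable_snd).
have mn : measurable_fun setT new by exact: measurable_funPT.
exact: (measurableT_comp mn measurable_fst).
Qed.

HB.instance Definition _ := isMeasurableFun.Build _ _ _ _ draw_fun measurable_draw.

Definition draw : {RV draw_prob >-> vmeas n Omega} := draw_fun.

Definition draw_law : probability (vmeas n Omega) R := distribution draw_prob draw.

Lemma draw_lawE (C : set (vmeas n Omega)) : measurable C ->
  draw_law C = pred_law G PJ new (fun p => ind C (assemble p.1 p.2.1 p.2.2)) x.
Proof.
move=> mC; have mp : measurable (draw_fun @^-1` C).
  by rewrite -[X in measurable X]setTI; exact: measurable_draw.
rewrite /draw_law /distribution /pushforward /= /draw_prob /product_measure1.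
apply: eq_integral => t _ /=; rewrite /kernel_prob -integral_ind; last exact: measurable_xsection.
apply: eq_integral => y _; apply: ind_congr; split => [/xsectionP//|h].
exact/xsectionP.
Qed.

Definition draw_new_fun (p : T * K.-tuple (R * E)) : vmeas n Omega := new p.1.

Lemma measurable_draw_new : measurable_fun setT draw_new_fun.
Proof.
have mn : measurable_fun setT new by exact: measurable_funPT.
exact: (measurableT_comp mn measurable_fst).
Qed.

HB.instance Definition _ := isMeasurableFun.Build _ _ _ _ draw_new_fun measurable_draw_new.

Definition draw_jump_fun (l : 'I_K) (p : T * K.-tuple (R * E)) : R := (tnth p.2 l).1.

Lemma measurable_draw_jump l : measurable_fun setT (draw_jump_fun l).
Proof.
exact: (measurableT_comp measurable_fst (measurableT_comp (measurable_tnth l) measurable_snd)).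
Qed.

HB.instance Definition _ l := isMeasurableFun.Build _ _ _ _ (draw_jump_fun l) (measurable_draw_jump l).

Definition draw_mark_fun (l : 'I_K) (p : T * K.-tuple (R * E)) : E := (tnth p.2 l).2.

Lemma measurable_draw_mark l : measurable_fun setT (draw_mark_fun l).
Proof.
exact: (measurableT_comp measurable_snd (measurableT_comp (measurable_tnth l) measurable_snd)).
Qed.

HB.instance Definition _ l := isMeasurableFun.Build _ _ _ _ (draw_mark_fun l) (measurable_draw_mark l).

Definition draw_new : {RV draw_prob >-> vmeas n Omega} := draw_new_fun.
Definition draw_jump l : {RV draw_prob >-> R} := draw_jump_fun l.
Definition draw_mark l : {RV draw_prob >-> E} := draw_mark_fun l.

Lemma measurable_new_preimage (C : set (vmeas n Omega)) : measurable C -> measurable (new @^-1` C).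
Proof. by move=> mC; rewrite -[X in measurable X]setTI; exact: measurable_funPT. Qed.

Lemma kn_rect (U : 'I_K -> set (R * E)) : (forall l, measurable (U l)) ->
  kn x (tuple_rect U) = \prod_(l < K) next_jump G PJ (tnth x l) (U l).
Proof. by move=> mU; exact: kprodt_rect. Qed.

Lemma draw_prob_new (C : set (vmeas n Omega)) : measurable C ->
  draw_prob (draw_new_fun @^-1` C) = P (new @^-1` C).
Proof.
move=> mC; rewrite (_ : _ @^-1` _ = (new @^-1` C) `*` setT).
  by rewrite draw_probE ?prob_kernel ?mule1//; exact: measurable_new_preimage.
by apply/seteqP; split => p //= [].
Qed.

Lemma draw_prob_one (l : 'I_K) (U : set (R * E)) : measurable U ->
  draw_prob [set p | U (tnth p.2 l)] = next_jump G PJ (tnth x l) U.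
Proof.
move=> mU; pose U' j : set (R * E) := if j == l then U else setT.
have mU' j : measurable (U' j) by rewrite /U'; case: ifP.
rewrite (_ : [set p | _] = setT `*` tuple_rect U'); last first.
  apply/seteqP; split => p /=.
    by move=> Up; split => // j; rewrite /U'; case: eqP => // ->.
  by move=> [_ /(_ l)]; rewrite /U' eqxx.
rewrite draw_probE//; last exact: measurable_tuple_rect.
rewrite probability_setT mul1e kn_rect// (bigD1 l)//= /U' eqxx big1 ?mule1// => j /negbTE jl.
by rewrite jl; apply: (@prob_kernel _ _ _ _ _ (next_jump G PJ)).
Qed.

Lemma next_jump_rect y (A : set R) (B : set E) : measurable A -> measurable B ->
  next_jump G PJ y (A `*` B) = \int[PJ y]_(s in A) G s B.
Proof.
move=> mA mB; have mAB : measurable (A `*` B : set (R * E)) by exact: measurableX.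
rewrite -integral_ind// integral_next_jump; last exact: nnmf_ind.
rewrite -[RHS]integral_ind_mul//; apply: eq_integral => s _.
rewrite -(integral_ind (G s))// -nnmf_integralZl ?ind_ge0//; last exact: nnmf_ind.
by apply: eq_integral => a _; rewrite ind_prod.
Qed.

Lemma prod_option (F : option 'I_K -> \bar R) :
  \prod_o F o = F None * \prod_(l < K) F (Some l).
Proof.
rewrite (bigD1 None)//=; congr (_ * _).
rewrite (reindex_omap Some id)/=; last by case.
by apply: eq_bigl => l; rewrite eqxx.
Qed.

Lemma predictive (B0 : probability (borel Omega) R) (rho : R -> Omega -> R)
    (z : 'I_M -> set Omega -> 'rV[R]_n) (Q : set (vmeas n Omega) -> \bar R) :
  injective (fun l => (tnth x l).1 : Omega) ->
  range (fun l => (tnth x l).1 : Omega) = features z ->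
  (forall l, (tnth x l).2 = [tuple z i [set ((tnth x l).1 : Omega)] | i < M]) ->
  is_IBP_law G (rho_upd G rho M) B0 (distribution P new) ->
  (forall C, measurable C -> Q C = draw_law C) ->
  is_predictive_law B0 G rho PJ z Q.
Proof.
move=> xi xr xz iI QE.
have xE l : ((tnth x l).1, [tuple z i [set ((tnth x l).1 : Omega)] | i < M]) = tnth x l.
  by rewrite -xz -surjective_pairing.
have mpair l : measurable_fun setT (fun p : T * K.-tuple (R * E) => tnth p.2 l).
  exact: (measurableT_comp (measurable_tnth l) measurable_snd).
have jumpE l S : measurable S -> distribution draw_prob (draw_jump l) S = PJ (tnth x l) S.
  move=> mS; have mST : measurable (S `*` setT : set (R * E)) by exact: measurableX.
  transitivity (next_jump G PJ (tnth x l) (S `*` setT)).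
    rewrite -(draw_prob_one l mST) /distribution /pushforward; congr (draw_prob _).
    by apply/seteqP; split => p //= [].
  rewrite next_jump_rect// -integral_ind_mul// -(integral_ind (PJ (tnth x l)) mS).
  apply: eq_integral => s _; rewrite (_ : G s setT = 1) ?mule1//; exact: prob_kernel.
exists _, (T * K.-tuple (R * E))%type, draw_prob, draw_new, K,
  (fun l => (tnth x l).1 : Omega), draw_jump, draw_mark; split.
- by split.
- apply: is_IBP_law_ext iI => C mC; exact: draw_prob_new.
- move=> l; split => [S mS|S B mS mB]; first by rewrite xE jumpE.
  transitivity (next_jump G PJ (tnth x l) (S `*` B)).
    by rewrite -(draw_prob_one l)//; exact: measurableX.
  rewrite next_jump_rect//; apply: eq_measure_integral => A mA _; exact: esym (jumpE l A mA).
- move=> H HH.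
  have [C0 mC0 H0] : exists2 C0, measurable C0 & H None = draw_new_fun @^-1` C0.
    by have [C mC <-] := HH None; exists C => //; rewrite setTI.
  have /choice[U hU] : forall l, exists U : set (R * E), measurable U /\
      H (Some l) = [set p | U (tnth p.2 l)].
    move=> l; have [U mU <-] := HH (Some l); exists U; split => //; rewrite setTI.
    apply/seteqP; split => p /=; rewrite /draw_jump /draw_mark /= /draw_jump_fun /draw_mark_fun;
      by rewrite -surjective_pairing.
  have mU l : measurable (U l) by case: (hU l).
  have Hl l : H (Some l) = [set p | U l (tnth p.2 l)] by case: (hU l).
  have PH o : draw_prob (H o) \is a fin_num.
    apply: fin_num_measure; case: o => [l|].
      by rewrite Hl -[X in measurable X]setTI; exact: mpair.
    by rewrite H0 -[X in measurable X]setTI; exact: measurable_draw_new.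
  rewrite -prodEFin (eq_bigr (fun o => draw_prob (H o))); last by move=> o _; rewrite fineK.
  rewrite prod_option H0 draw_prob_new// (eq_bigr (fun l => next_jump G PJ (tnth x l) (U l))); last first.
    by move=> l _; rewrite Hl draw_prob_one.
  rewrite -kn_rect// -draw_probE//; last 2 first.
  + exact: measurable_new_preimage.
  + exact: measurable_tuple_rect.
  congr (draw_prob _); apply/seteqP; split => p.
    move=> h; split; first by have := h None I; rewrite H0.
    by move=> l; have := h (Some l) I; rewrite Hl.
  by move=> [h0 h1] [l|] _; [rewrite Hl; exact: h1|rewrite H0].
- move=> C mC; rewrite QE//; congr (draw_prob _); apply/seteqP.
  have E0 p : draw_fun p = (fun B : set Omega => (draw_new p B +
      \sum_(l < K | (tnth x l).1 \in B) (draw_mark l p : 'rV[R]_n))%R).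
    apply/funext => B; rewrite /draw_fun /assemble /atoms; congr (_ + _)%R.
    by apply: eq_bigr => l _; rewrite tnth_mktuple.
  by split => p /=; rewrite -E0.
Qed.

End predictive_law.

(** * Gluing conditional laws over countably many events *)

Section glue.
Context {R : realType} d (T : measurableType d) (P : probability T R).
Variable gen : set (set T).
Hypothesis gen_measurable : <<s gen >> `<=` measurable.
Local Notation T0 := (g_sigma_algebraType gen).
Context dY (Y : measurableType dY) (X : {RV P >-> Y}).
Variables (F : nat -> set T0) (q : nat -> T -> probability Y R) (q0 : probability Y R).
Hypotheses (mF : forall c, measurable (F c))
  (mq : forall c C, measurable C -> measurable_fun setT (fun t : T0 => q c t C))
  (Fq : forall c (H : set T0) C, measurable H -> measurable C ->
    P ((H : set T) `&` F c `&` X @^-1` C) = \int[P]_t (ind ((H : set T) `&` F c) t * q c t C))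
  (F_ae : {ae P, forall t, exists c, F c t}).

(** The first event containing t decides, which keeps the choice measurable; [q0] fills the null set
    outside all events. *)
Definition glued (t : T) : probability Y R :=
  match pselect (exists c, `[< F c t >]) with
  | left e => q (ex_minn e) t
  | right _ => q0
  end.

Lemma gluedE t : (exists c, F c t) -> exists2 c, F c t & glued t = q c t.
Proof.
move=> [c Fc]; rewrite /glued; case: pselect => [e|]; last by case; exists c; exact/asboolP.
by case: ex_minnP => c' /asboolP Fc' _; exists c'.
Qed.

Let before c : set T0 := \bigcup_(i < c) F i.
Let FF c : set T0 := F c `\` before c.

Let mbefore c : measurable (before c).
Proof. by apply: bigcup_measurable => i _; exact: mF. Qed.

Let mFF c : measurable (FF c).
Proof. exact: measurableD. Qed.

Let glued_FF c t : FF c t -> glued t = q c t.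
Proof.
move=> [Fc nb]; rewrite /glued; case: pselect => [e|]; last by case; exists c; exact/asboolP.
case: ex_minnP => c' /asboolP Fc' mini; suff -> : c' = c by [].
apply/eqP; rewrite eqn_leq mini ?andTb; last exact/asboolP.
by rewrite leqNgt; apply/negP => cc; apply: nb; exists c'.
Qed.

Let FF_disj c c' t : FF c t -> FF c' t -> c = c'.
Proof.
move=> [Fc nb] [Fc' nb']; apply/eqP; rewrite eqn_leq.
by apply/andP; split; rewrite leqNgt; apply/negP => cc; [apply: nb; exists c'|apply: nb'; exists c].
Qed.

Let FF_cover t : (exists c, F c t) -> exists c, FF c t.
Proof.
move=> [c Fc]; have e : exists c, `[< F c t >] by exists c; exact/asboolP.
case: (ex_minnP e) => c' /asboolP Fc' mini; exists c'; split => // -[i ic Fi].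
by have := mini i (asboolT Fi); rewrite leqNgt ic.
Qed.

Let glued_preimage C (B : set (\bar R)) : [set t | B (glued t C)] =
  (\bigcup_c (FF c `&` (fun t => q c t C) @^-1` B)) `|`
  (if `[< B (q0 C) >] then ~` \bigcup_c F c else set0).
Proof.
apply/seteqP; split => t /=.
  move=> Bt; have [[c Fc]|nF] := pselect (exists c, FF c t).
    by left; exists c => //; split => //=; rewrite -(glued_FF Fc).
  right; have nF' : ~ exists c, F c t by move=> /FF_cover.
  have gt : glued t = q0.
    rewrite /glued; case: pselect => // e; exfalso; case: e => c /asboolP Fc.
    by apply: nF'; exists c.
  by rewrite -gt asboolT// => -[c _ Fc]; apply: nF'; exists c.
move=> [[c _ [Fc]]|]; first by rewrite /= -(glued_FF Fc).
case: asboolP => // B0 nF; rewrite /glued; case: pselect => // e; exfalso.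
by case: e => c /asboolP Fc; apply: nF; exists c.
Qed.

Let mglued C (B : set (\bar R)) : measurable C -> measurable B ->
  measurable ([set t | B (glued t C)] : set T0).
Proof.
move=> mC mB; rewrite [X in measurable X](glued_preimage C B).
apply: measurableU.
  apply: bigcupT_measurable => c; apply: measurableI => //.
  by have := mq c mC measurableT mB; rewrite setTI.
by case: asboolP => // _; apply: measurableC; exact: bigcupT_measurable.
Qed.

Lemma glued_law : regular_conditional_law P <<s gen >> X glued.
Proof.
move=> C mC; split; first by move=> B mB; exact: mglued.
move=> H sH; have mH0 : measurable (H : set T0) by [].
have mH : measurable H by exact: gen_measurable.
have mFT c : measurable (FF c : set T) by apply: gen_measurable; exact: mFF.
have mX : measurable (X @^-1` C) by rewrite -[X in measurable X]setTI; exact: measurable_funPT.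
pose A c : set T := H `&` FF c `&` X @^-1` C.
have mA c : measurable (A c) by apply: measurableI => //; exact: measurableI.
have PA c : P (A c) = \int[P]_t (ind (H `&` FF c) t * q c t C).
  (* Removing the earlier events from H leaves an event of the past, so [Fq] applies on the part
     where [q c] is in force. *)
  have mHb : measurable ((H : set T0) `\` before c) by exact: measurableD.
  have E : (H `\` before c) `&` F c = H `&` FF c.
    by apply/seteqP; split => t; [move=> [[]]|move=> [? []]].
  by have := Fq c mHb mC; rewrite [(_ `\` _) `&` _]E.
have tA : trivIset setT A.
  by move=> c c' _ _ [t [[[_ h] _] [[_ h'] _]]]; exact: FF_disj h h'.
transitivity (P (\bigcup_c A c)).
  apply: ae_measure_eq; [exact: measurableI|exact: bigcupT_measurable|].
  apply: negligibleS F_ae => t /= nP /FF_cover[c Fc]; apply: nP; split => [[Ht Xt]|[c' _ [[Ht _] Xt]]//].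
  by exists c.
rewrite measure_semi_bigcup//; last exact: bigcupT_measurable.
have nq c : nnmf (fun t => ind (H `&` FF c) t * q c t C).
  apply: nnmfM; first by apply: nnmf_ind; exact: measurableI.
  split => [|t]; last exact: measure_ge0.
  by move=> _ B mB; rewrite setTI; apply: gen_measurable; have := mq c mC measurableT mB; rewrite setTI.
rewrite (eq_eseriesr (fun c _ => PA c)) -integral_nneseries//; last 2 first.
- by move=> c; case: (nq c).
- by move=> c t _; case: (nq c).
have mg : measurable_fun setT (fun t => glued t C).
  by move=> _ B mB; rewrite setTI; apply: gen_measurable; exact: (mglued mC mB).
rewrite -[RHS]integral_ind_mul//; apply: ge0_ae_eq_integral => //.
- by apply: ge0_emeasurable_sum => [c t _ _|c]; case: (nq c).
- by apply: emeasurable_funM => //; exact: (proj1 (nnmf_ind mH)).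
- by move=> t _; apply: nneseries_ge0 => c _ _; case: (nq c).
- by move=> t _; rewrite mule_ge0 ?ind_ge0.
apply: negligibleS F_ae => t /= nP /FF_cover[c Fc]; apply: nP => _; rewrite (@nneseriesD1 R _ c)//; last first.
  by move=> c' _; case: (nq c').
rewrite eseries0 ?adde0; last first.
  move=> c' _ /eqP cc'; rewrite ind0 ?mul0e// => -[_ Fc']; apply: cc'.
  exact: FF_disj Fc' Fc.
by rewrite (glued_FF Fc); congr (_ * _); apply: ind_congr; split => [[]|].
Qed.

End glue.

(** * Conditional law on one choice of cells *)

Section conditional_law.
#[local] Opaque marked_intensity.
Context {R : realType} {n M : nat} {Omega : completePseudoMetricType R}.
Local Notation E := (vec R n).
Local Notation X := (R * borel Omega)%type.
Local Notation S := (X * M.+1.-tuple E)%type.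
Hypothesis hO : hausdorff_space Omega.
Variable Bs : nat -> set Omega.
Hypothesis bB : countable_base Bs.
Variables (B0 : probability (borel Omega) R) (rho : R -> Omega -> R).
Hypothesis B0_nonatomic : forall w : Omega, B0 [set w] = 0.
Hypothesis rho_measurable : measurable_fun
  ([set x | (0 < x.1)%R] : set X) (fun x => rho x.1 x.2).
Hypothesis rho_ge0 : forall (s : R) w, (0 < s)%R -> (0 <= rho s w)%R.
Variable G : R.-pker R ~> vec R n.
Hypothesis finiteness : \int[B0]_w \int[lebesgue_measure]_(s in `]0%R, +oo[)
  (pi_A G s * rho s w)%:E < +oo.
Context d (T : measurableType d) (P : probability T R).
Variables (tau : nat -> {RV P >-> R}) (w : nat -> {RV P >-> borel Omega}).
Hypothesis prm : is_PRM P (point_measure tau w) (levy_intensity rho B0).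
Variable A : 'I_M.+1 -> nat -> {RV P >-> vec R n}.
Hypothesis A_marks : forall (H : set T) (r : nat) (D : 'I_M.+1 -> nat -> set (vec R n)),
  points_sigma tau w H -> (forall i k, measurable (D i k)) ->
  P (H `&` [set t | forall i k, (k < r)%N -> present tau t k -> D i k (A i k t)]) =
  \int[P]_(t in H) (\prod_(k < r | (0 < tau k t)%R) \prod_(i < M.+1)
     fine (G (tau k t) (D i k)))%:E.
Variable Z : 'I_M.+1 -> {RV P >-> vmeas n Omega}.
Hypothesis Z_points : forall i, {ae P, forall t, forall B : set (borel Omega), measurable B ->
  Z i t B = (\sum_(k \in [set k | present tau t k /\ B (w k t)]) (A i k t : 'rV[R]_n))%R}.

Local Notation I := (marked_intensity B0 rho G (m := M.+1)).
Local Notation xi := (mpts tau w A).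
Local Notation good := (good tau w A Z).

Local Notation D := (borel Omega * M.-tuple E)%type.
Variable PJ : R.-pker D ~> R.
Hypothesis PJ_disintegrates : {ae B0, forall w, disintegrates G rho PJ w}.

Local Notation T0 := (g_sigma_algebraType (past_sets Z)).
Local Notation new := (new_part tau w A).

Lemma past_fun_measurable d' (Y : measurableType d') (f : T0 -> Y) :
  measurable_fun setT f -> measurable_fun setT (f : T -> Y).
Proof. by move=> mf _ B mB; apply: (past_measurable (Z := Z)); exact: mf. Qed.

Section cells.
Variables (K : nat) (V : 'I_K -> set Omega).
Hypotheses (mV : forall l, measurable (V l : set (borel Omega)))
  (Vd : forall l l', l != l' -> V l `&` V l' = set0).

Local Notation cex := (cells_exact Bs (Z := Z) V).

Lemma located_loc_inj t kap : located tau w A t V kap ->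
  injective (fun l => w (kap l) t : Omega).
Proof.
move=> [h1 _] l l' e; apply: contrapT => /eqP/Vd; apply/eqP/set0P.
by exists (w (kap l) t); split; [case: (h1 l)|rewrite e; case: (h1 l')].
Qed.

Lemma located_mass t kap l i : good t -> located tau w A t V kap ->
  Z (lift ord_max i) t [set (w (kap l) t : Omega)] =
  tnth (first_marks (mks tau A (kap l) t)) i.
Proof.
move=> gt hk; have mp : measurable ([set (w (kap l) t : Omega)] : set (borel Omega)).
  exact: measurable_point.
rewrite (first_observed gt)// (sum_located _ (fun k => tnth (first_marks (mks tau A k t)) i) Vd hk).
rewrite (big_pred1 l)// => l' /=; apply/idP/eqP => [/set_mem e|->]; last exact: mem_set.
exact: (located_loc_inj hk e).
Qed.

Lemma located_features t kap : good t -> located tau w A t V kap ->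
  range (fun l => w (kap l) t : Omega) = features (fun i : 'I_M => Z (lift ord_max i) t).
Proof.
move=> gt hk; apply/seteqP; split => [_ [l _ <-]|y [i /eqP hy]].
  have [h1 _] := hk; have [ol _] := h1 l.
  have [i hi] : exists i, tnth (first_marks (mks tau A (kap l) t)) i <> vec0.
    by apply: contrapT => /forallNP h; case: ol => _; apply; apply/no_marksE => i; exact: (contrapT (h i)).
  by exists i; apply/eqP; rewrite located_mass.
apply: contrapT => ny; apply: hy.
have mp : measurable ([set y] : set (borel Omega)) by exact: measurable_point.
rewrite (first_observed gt)// (sum_located _ (fun k => tnth (first_marks (mks tau A k t)) i) Vd hk).
by rewrite big1// => l /set_mem yl; exfalso; apply: ny; exists l.
Qed.

Lemma cells_predict : exists x : T0 -> K.-tuple D, [/\ measurable_fun setT x,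
  (forall t, good t -> cex t -> [/\ injective (fun l => (tnth (x t) l).1 : Omega),
     range (fun l => (tnth (x t) l).1 : Omega) = features (fun i : 'I_M => Z (lift ord_max i) t) &
     forall l, (tnth (x t) l).2 =
       [tuple (Z (lift ord_max i) t [set ((tnth (x t) l).1 : Omega)] : E) | i < M]]) &
  forall (H : set T0) C, measurable H -> measurable C ->
    P ((H : set T) `&` cex `&` Z ord_max @^-1` C) =
    \int[P]_t (ind ((H : set T) `&` cex) t *
      pred_law G PJ new (fun p => ind C (assemble p.1 p.2.1 p.2.2)) (x t))].
Proof.
have /choice[W hW0] : forall l, exists h : T0 -> borel Omega, measurable_fun setT h /\
    forall t kap, good t -> located tau w A t V kap -> h t = w (kap l) t.
  by move=> l; have [h mh hE] := feature_location hO bB tau w A Z mV Vd l; exists h.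
have mW l : measurable_fun setT (W l) by case: (hW0 l).
have hW l t kap : good t -> located tau w A t V kap -> W l t = w (kap l) t by case: (hW0 l) => _; exact.
pose x : T0 -> K.-tuple D := cells_data tau w A V W.
pose next : T -> K.-tuple E := cells_next tau w A V W.
have mx : measurable_fun setT x.
  apply/measurable_fun_tnthP => l.
  rewrite (_ : _ \o _ = fun t : T0 => (W l t, seen_marks Z V l t)).
    by apply: measurable_fun_pair => //; exact: measurable_seen_marks.
  by apply/funext => t /=; rewrite tnth_mktuple.
have mnext : measurable_fun setT next.
  apply/measurable_fun_tnthP => l.
  rewrite (_ : _ \o _ = next_mark tau w A V l); first exact: measurable_next_mark.
  by apply/funext => t /=; rewrite tnth_mktuple.
have xE t kap l : good t -> located tau w A t V kap ->
    tnth (x t) l = (w (kap l) t, first_marks (mks tau A (kap l) t)).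
  by move=> gt hk; rewrite tnth_mktuple (cell_viewE mV Vd hW l gt hk).
have nE t kap l : good t -> located tau w A t V kap ->
    tnth (next t) l = last_mark (mks tau A (kap l) t).
  by move=> gt hk; rewrite tnth_mktuple (cell_viewE mV Vd hW l gt hk).
have loc t : good t -> cex t -> exists kap, located tau w A t V kap.
  by move=> gt /(cells_exact_located hO bB mV Vd gt).
exists x; split => //.
  move=> t gt /(loc t gt)[kap hk].
  have fE : (fun l => (tnth (x t) l).1 : Omega) = (fun l => w (kap l) t : Omega).
    by apply/funext => l; rewrite (xE t kap l gt hk).
  split.
  - by rewrite fE; exact: located_loc_inj hk.
  - by rewrite fE; exact: located_features.
  - move=> l; apply: eq_from_tnth => i; rewrite (xE t kap l gt hk) tnth_mktuple.
    by rewrite (located_mass l i gt hk).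
have pastE t kap i (B : set (borel Omega)) : good t -> located tau w A t V kap -> measurable B ->
    Z (lift ord_max i) t B = past_of (x t) i B.
  move=> gt hk mB; rewrite (first_observed gt)//.
  rewrite (sum_located _ (fun k => tnth (first_marks (mks tau A k t)) i) Vd hk).
  rewrite /past_of /atoms; apply: eq_big => l; first by rewrite (xE t kap l gt hk).
  by move=> _; rewrite (xE t kap l gt hk).
have futE t kap (B : set (borel Omega)) : good t -> located tau w A t V kap -> measurable B ->
    Z ord_max t B = assemble (x t) (next t) (new t) B.
  move=> gt hk mB; rewrite (last_observed gt)//.
  rewrite (sum_located _ (fun k => last_mark (mks tau A k t)) Vd hk).
  rewrite /assemble /atoms; congr (_ + _)%R; apply: eq_big => l.
    by rewrite (xE t kap l gt hk).
  by move=> _; rewrite (nE t kap l gt hk).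
(* By [pastE] the past is a function of the data [x t] on the good exact outcomes, so each of its
   events becomes a condition on [x t]. This condition can then be absorbed into the test function
   of [predict_fun]. *)
have traceH (H : set T0) : measurable H -> exists2 H' : set (K.-tuple D), measurable H' &
    forall t, good t -> cex t -> (H t <-> H' (x t)).
  suff : (measurable : set (set T0)) `<=` [set H | exists2 H' : set (K.-tuple D), measurable H' &
      forall t, good t -> cex t -> (H t <-> H' (x t))] by exact.
  apply: smallest_sub.
    split => /=.
    - by exists set0.
    - move=> F [F' mF' FE]; exists (~` F'); first exact: measurableC.
      move=> t gt ct; have [h1 h2] := FE t gt ct.
      split => [[_ nF] h|nF']; first exact: (nF (h2 h)).
      by split => // Ft; exact: (nF' (h1 Ft)).
    - move=> F hF; have /choice[F' hF'] : forall c, exists F' : set (K.-tuple D),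
          measurable F' /\ forall t, good t -> cex t -> (F c t <-> F' (x t)).
        by move=> c; have [F' mF' FE] := hF c; exists F'.
      exists (\bigcup_c F' c); first by apply: bigcupT_measurable => c; case: (hF' c).
      move=> t gt ct; split => -[c _ Fc]; exists c => //; have [_ /(_ t gt ct)[h1 h2]] := hF' c;
        [exact: h1|exact: h2].
  move=> U; rewrite /past_sets -bigcup_seq => -[i _ [C mC <-]] /=.
  exists ((past_of ^~ i) @^-1` C).
    rewrite -[X in measurable X]setTI; exact: (measurable_past_of i measurableT mC).
  move=> t gt /(loc t gt)[kap hk]; split => [[_ h]|h]; [|split => //]; apply: vmeas_ext h => // B mB.
    exact: (pastE t kap).
  exact/esym/(pastE t kap).
move=> H C mH mC; have [H' mH' HE] := traceH H mH.
have mcex : measurable (cex : set T).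
  by apply: (past_measurable (Z := Z)); exact: measurable_cells_exact.
have mHT : measurable (H : set T) by exact: (past_measurable (Z := Z)).
have mnew : measurable_fun setT new by exact: measurable_funPT.
have mxT : measurable_fun setT (x : T -> K.-tuple D) by exact: past_fun_measurable.
have masm : measurable_fun setT (fun p : K.-tuple D * (K.-tuple E * vmeas n Omega) =>
    assemble p.1 p.2.1 p.2.2 : vmeas n Omega).
  apply: measurable_assemble; first exact: measurable_fst.
    exact: (measurableT_comp measurable_fst measurable_snd).
  exact: (measurableT_comp measurable_snd measurable_snd).
pose fC (p : K.-tuple D * (K.-tuple E * vmeas n Omega)) : \bar R := ind C (assemble p.1 p.2.1 p.2.2).
have nfC : nnmf fC by exact: (nnmf_comp masm (nnmf_ind mC)).
pose f p := ind H' p.1 * fC p.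
have nf : nnmf f by apply: nnmfM => //; exact: (nnmf_comp measurable_fst (nnmf_ind mH')).
have mall : measurable_fun setT (fun t : T => (x t, (next t, new t))).
  by apply: measurable_fun_pair => //; exact: measurable_fun_pair.
have gae := good_ae hO bB B0_nonatomic rho_measurable rho_ge0 finiteness prm A_marks Z_points.
have mE : measurable ((H : set T) `&` cex `&` Z ord_max @^-1` C).
  apply: measurableI; first exact: measurableI.
  by rewrite -[X in measurable X]setTI; exact: measurable_funPT.
rewrite -(integral_ind P mE).
have ncex : nnmf (ind (cex : set T) : T -> \bar R) by exact: nnmf_ind.
have nl : nnmf (fun t : T => pred_law G PJ new fC (x t)).
  exact: (nnmf_comp mxT (kop_nnmf (kop_pred_law G PJ new) nfC)).
have nlf : nnmf (fun t : T => pred_law G PJ new f (x t)).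
  exact: (nnmf_comp mxT (kop_nnmf (kop_pred_law G PJ new) nf)).
have nff := nnmf_comp mall nf.
transitivity (\int[P]_t (ind (cex : set T) t * f (x t, (next t, new t)))).
  have n1 := nnmf_ind (R := R) mE; have n2 := nnmfM ncex nff.
  apply: ge0_ae_eq_integral => //; [exact: (proj1 n1)|exact: (proj1 n2)|..].
  - by move=> t _; exact: (proj2 n1).
  - by move=> t _; exact: (proj2 n2).
  apply: filterS gae => t gt _; have [ct|nct] := pselect (cex t); last first.
    by rewrite (ind0 (A := (cex : set T)) nct) mul0e ind0// => -[[]].
  have [kap hk] := loc t gt ct; rewrite (ind1 (A := (cex : set T)) ct) mul1e /f /fC /=.
  rewrite indI [X in X * _ = _]indI [X in _ * X * _]ind1// mule1; congr (_ * _); first exact/ind_congr/(HE t gt ct).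
  apply: ind_congr; split => h; apply: vmeas_ext h => // B mB; first exact: (futE t kap).
  exact/esym/(futE t kap).
rewrite (predict_fun mcex mxT mnext (G := G) (PJ := PJ)) => [|F B C' mF mB mC'|//]; last first.
  exact: (predict_rect hO bB B0_nonatomic rho_measurable rho_ge0 finiteness prm A_marks Z_points
    PJ_disintegrates mV Vd mW hW mF mB mC').
have plE y : pred_law G PJ new f y = ind H' y * pred_law G PJ new fC y.
  have [h|h] := pselect (H' y).
    rewrite (ind1 h) mul1e; apply: eq_integral => t' _; apply: eq_integral => m _.
    by rewrite /f /= (ind1 h) mul1e.
  rewrite (ind0 h) mul0e; apply: integral0_eq => t' _; apply: integral0_eq => m _.
  by rewrite /f /= (ind0 h) mul0e.
have n1 := nnmfM ncex nlf.
have n2 : nnmf (fun t : T => ind ((H : set T) `&` cex) t * pred_law G PJ new fC (x t)).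
  by apply: nnmfM => //; apply: nnmf_ind; exact: measurableI.
apply: ge0_ae_eq_integral => //; [exact: (proj1 n1)|exact: (proj1 n2)|..].
- by move=> t _; exact: (proj2 n1).
- by move=> t _; exact: (proj2 n2).
apply: filterS gae => t gt _.
have [ct|nct] := pselect (cex t); last first.
  have i0 : ind (cex : set T) t = 0 :> \bar R by exact: ind0.
  have i1 : ind ((H : set T) `&` cex) t = 0 :> \bar R by apply: ind0 => -[].
  by rewrite [X in X * _ = _]i0 [X in _ = X * _]i1 !mul0e.
have i0 : ind (cex : set T) t = 1 :> \bar R by exact: ind1.
have i1 : ind ((H : set T) `&` cex) t = ind H' (x t) :> \bar R.
  have [h1 h2] := HE t gt ct; apply: ind_congr; split => [[Ht _]|h]; [exact: h1|split; [exact: h2|exact: ct]].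
rewrite [X in X * _ = _]i0 [X in _ = X * _]i1 [LHS]mul1e; exact: plE.
Qed.

End cells.
End conditional_law.

Theorem proposition2p1 (R : realType) (n M : nat)
  (Omega : completePseudoMetricType R)
  (Omega_hausdorff : hausdorff_space Omega)
  (Omega_second_countable : @second_countable Omega)
  (B0 : probability (borel Omega) R)
  (B0_nonatomic : forall w : Omega, B0 [set w] = 0)
  (rho : R -> Omega -> R)
  (rho_measurable : measurable_fun 
     ([set x | (0 < x.1)%R] : set (R * borel Omega)%type)
     (fun x => rho x.1 x.2))
  (rho_ge0 : forall (s : R) w, (0 < s)%R -> (0 <= rho s w)%R)
  (rho_levy : forall w, \int[lebesgue_measure]_(s in `]0%R, +oo[)
     (Num.min s 1 * rho s w)%:E < +oo)
  (G : R.-pker R ~> vec R n)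
  (G_zero : forall s : R, (0 < s)%R -> 0 < G s [set (0 : 'rV[R]_n)%R])
  (finiteness : \int[B0]_w \int[lebesgue_measure]_(s in `]0%R, +oo[)
     (pi_A G s * rho s w)%:E < +oo)
  (PJ : R.-pker (borel Omega * M.-tuple (vec R n))%type ~> R)
  (PJ_disintegrates : {ae B0, forall w, disintegrates G rho PJ w})
  (d : measure_display) (T : measurableType d) (P : probability T R)
  (tau : nat -> {RV P >-> R}) (w : nat -> {RV P >-> borel Omega})
  (mu : T -> set (borel Omega) -> \bar R)
  (mu_CRM : is_CRM P rho B0 tau w mu)
  (Z : 'I_M.+1 -> {RV P >-> vmeas n Omega})
  (Z_IBP : iid_IBP G tau w Z) :
  exists Q : T -> probability (vmeas n Omega) R,
    regular_conditional_law P
      (g_sigma_preimage (fun i : 'I_M => Z (lift ord_max i) : T -> vmeas n Omega))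
      (Z ord_max) Q /\
    {ae P, forall t,
      is_predictive_law B0 G rho PJ (fun i : 'I_M => Z (lift ord_max i) t) (Q t)}.
Proof.
have [Bs bB] := countable_base_exists Omega_second_countable.
have [prm _] := mu_CRM.
have [A [A_marks Z_points]] := Z_IBP.
pose new := new_part tau w A.
pose T0 := g_sigma_algebraType (past_sets Z).
(* The codes c enumerate all lists of base indices, including those whose sets overlap; [valid]
   sorts these out. *)
pose sq c : seq nat := odflt [::] (unpickle c).
pose V c (l : 'I_(size (sq c))) := Bs (nth 0%N (sq c) l).
pose valid c := forall l l', l != l' -> V c l `&` V c l' = set0.
have mV c l : measurable (V c l : set (borel Omega)) by exact: measurable_base.
have gae := good_ae Omega_hausdorff bB B0_nonatomic rho_measurable rho_ge0 finiteness
  prm A_marks Z_points.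
have /(_ _)/cid-/all_sig[x hx] : forall c, exists x : T0 -> (size (sq c)).-tuple (borel Omega * M.-tuple (vec R n)),
    measurable_fun setT x /\ (valid c ->
      (forall t, good tau w A Z t -> cells_exact Bs (Z := Z) (V c) t ->
        [/\ injective (fun l => (tnth (x t) l).1 : Omega),
          range (fun l => (tnth (x t) l).1 : Omega) = features (fun i : 'I_M => Z (lift ord_max i) t) &
          forall l, (tnth (x t) l).2 =
            [tuple (Z (lift ord_max i) t [set ((tnth (x t) l).1 : Omega)] : vec R n) | i < M]]) /\
      (forall (H : set T0) C, measurable H -> measurable C ->
        P ((H : set T) `&` cells_exact Bs (Z := Z) (V c) `&` Z ord_max @^-1` C) =
        \int[P]_t (ind ((H : set T) `&` cells_exact Bs (Z := Z) (V c)) t *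
          pred_law G PJ new (fun p => ind C (assemble p.1 p.2.1 p.2.2)) (x t)))).
  move=> c; have [vc|nv] := pselect (valid c); last first.
    (* An invalid list gets constant dummy data; its event [F c] is empty. *)
    by exists (fun=> [tuple (point, no_marks) | _ < size (sq c)]); split.
  have [x [h1 h2 h3]] := cells_predict Omega_hausdorff bB B0_nonatomic rho_measurable rho_ge0
    finiteness prm A_marks Z_points PJ_disintegrates (mV c) vc.
  by exists x.
pose F c : set T0 := if `[< valid c >] then cells_exact Bs (Z := Z) (V c) else set0.
pose q c t := draw_law G PJ new (x c t).
have mF c : measurable (F c).
  by rewrite /F; case: asboolP => // vc; exact: measurable_cells_exact.
have mq c C : measurable C -> measurable_fun setT (fun t : T0 => q c t C).
  move=> mC; have masm : measurable_fun setT
      (fun p : (size (sq c)).-tuple (borel Omega * M.-tuple (vec R n)) *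
        ((size (sq c)).-tuple (vec R n) * vmeas n Omega) =>
        assemble p.1 p.2.1 p.2.2 : vmeas n Omega).
    apply: measurable_assemble; first exact: measurable_fst.
      exact: (measurableT_comp measurable_fst measurable_snd).
    exact: (measurableT_comp measurable_snd measurable_snd).
  have nfC := nnmf_comp masm (nnmf_ind (R := R) mC).
  rewrite (_ : (fun t : T0 => _) = fun t : T0 =>
    pred_law G PJ new (fun p => ind C (assemble p.1 p.2.1 p.2.2)) (x c t)); last first.
    by apply/funext => t; rewrite /q draw_lawE.
  exact: (measurableT_comp (kop_meas (kop_pred_law G PJ new) nfC) (hx c).1).
have Fq c (H : set T0) C : measurable H -> measurable C ->
    P ((H : set T) `&` F c `&` Z ord_max @^-1` C) =
    \int[P]_t (ind ((H : set T) `&` F c) t * q c t C).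
  move=> mH mC; rewrite /F; case: asboolP => [vc|_]; last first.
    rewrite setI0 set0I measure0 integral0_eq// => t _.
    by rewrite [X in X * _]ind0// mul0e.
  apply: etrans (((hx c).2 vc).2 H C mH mC) _.
  apply: eq_integral => t _; congr (_ * _).
  by rewrite /q draw_lawE.
have cover t : good tau w A Z t -> exists c, F c t.
  move=> gt; have [s [sd [kap hk]]] := exists_located gt Omega_hausdorff bB.
  have [c sc] : exists c, sq c = s by exists (pickle s); rewrite /sq pickleK.
  subst s; exists c; rewrite /F asboolT//.
  by apply/(cells_exact_located Omega_hausdorff bB (mV c) sd gt); exists kap.
have F_ae : {ae P, forall t, exists c, F c t} by apply: filterS gae => t; exact: cover.
have gm : <<s past_sets Z >> `<=` measurable by exact: past_measurable.
exists (glued (gen := past_sets Z) F q (distribution P new)); split.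
  exact: (glued_law gm (distribution P new) mF mq Fq F_ae).
apply: filterS gae => t gt.
(* Several codes may fit t, with different cells and orders of the features. Any of them serves,
   since [is_predictive_law] leaves the enumeration of the features free. *)
have [c Fc ->] := gluedE (gen := past_sets Z) q (distribution P new) (cover t gt).
move: Fc; rewrite /F; case: asboolP => // vc ct.
have [xi xr xz] := ((hx c).2 vc).1 t gt ct.
have new_law := new_part_law rho_measurable rho_ge0 prm A_marks.
exact: (predictive xi xr xz new_law (fun C _ => erefl (draw_law G PJ new (x c t) C))).
Qed.
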